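(* Let $k\in\{0,1,2,3\}$ and $C\in\mathbb{C}\cup\{\infty\}$. Then the holomorphic function $f_{k,C}$ on $\mathbb{H}$ has only simple zeros, i.e. $f_{k,C}'(\tau)\neq 0$ whenever $\tau\in\mathbb{H}$ and $f_{k,C}(\tau)=0$.
   Context: $\mathbb{H}=\{\tau\in\mathbb{C}:\operatorname{Im}\tau>0\}$. For $\tau\in\mathbb{H}$ let $\Lambda_\tau=\mathbb{Z}+\mathbb{Z}\tau$, $\wp(z|\tau)=\frac1{z^2}+\sum_{\omega\in\Lambda_\tau\setminus\{0\}}\left(\frac1{(z-\omega)^2}-\frac1{\omega^2}\right)$, and let $\zeta(z|\tau)$ be the Weierstrass zeta function, i.e. the odd meromorphic function with $\zeta'(z|\tau)=-\wp(z|\tau)$. Its quasi-periods are $\eta_1(\tau)=\zeta(z+1|\tau)-\zeta(z|\tau)$ and $\eta_2(\tau)=\zeta(z+\tau|\tau)-\zeta(z|\tau)$. Put $\omega_1=1$, $\omega_2=\tau$, $\omega_3=1+\tau$, $e_k(\tau)=\wp(\omega_k/2|\tau)$ for $k=1,2,3$, and let $g_2(\tau)=-4(e_1e_2+e_1e_3+e_2e_3)$, $g_3(\tau)=4e_1e_2e_3$, so that $(\wp')^2=4\wp^3-g_2\wp-g_3$. The functions $f_{k,C}$ are defined by $$f_{0,C}(\tau)=\begin{cases}12(C\eta_1(\tau)-\eta_2(\tau))^2-g_2(\tau)(C-\tau)^2, & C\neq\infty,\\ 12\eta_1(\tau)^2-g_2(\tau), & C=\infty,\end{cases}$$ and for $k\in\{1,2,3\}$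 $$f_{k,C}(\tau)=\begin{cases}3e_k(\tau)(C\eta_1(\tau)-\eta_2(\tau))+\left(\tfrac{g_2(\tau)}2-3e_k(\tau)^2\right)(C-\tau), & C\neq\infty,\\ 3e_k(\tau)\eta_1(\tau)+\tfrac{g_2(\tau)}2-3e_k(\tau)^2, & C=\infty.\end{cases}$$ *)

(* Defs.v *)
From mathcomp Require Export all_boot all_order all_algebra.
From mathcomp Require Export all_classical all_reals all_analysis.
From mathcomp Require Export complex summability.

Set Implicit Arguments.
Unset Strict Implicit.
Unset Printing Implicit Defensive.

Import Order.TTheory GRing.Theory Num.Theory.
Import numFieldNormedType.Exports.

Local Open Scope classical_set_scope.
Local Open Scope ring_scope.

(* The type [R[i]] itself carries no topology: the normed-module structure is
   attached to the carrier of an arbitrary [numClosedFieldType], whence this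
   packaging.  Derivatives of maps [cplx R -> cplx R] in the direction [1] are
   then complex derivatives. *)
Definition cplx (R : realType) : numClosedFieldType := complex R.

Definition upper_half_plane (R : realType) : set (cplx R) :=
  [set tau | 0 < complex.Im tau].

Definition lattice (R : realType) (tau : cplx R) : set (cplx R) :=
  [set w | exists m n : int, w = m%:~R + n%:~R * tau].

(* [summability.sum] is the limit of the finite partial sums along the directed
   set of finite subsets of the index type, i.e. the unordered sum.  For
   [0 < Im tau] the nonzero lattice points are parametrized bijectively by the
   pairs [(m, n) != (0, 0)].  Values at points of the lattice are junk. *)
Definition wp (R : realType) (tau z : cplx R) : cplx R :=
  (z ^+ 2)^-1 +
  summability.sum (fun p : int * int =>
    if p == (0, 0) then 0 : cplx R
    else let w := p.1%:~R + p.2%:~R * tau in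
         ((z - w) ^+ 2)^-1 - (w ^+ 2)^-1).

Definition meromorphic (R : realType) (f : cplx R -> cplx R) : Prop :=
  forall z0 : cplx R, exists (n : nat) (g : cplx R -> cplx R),
    (\forall z \near z0, derivable g z 1) /\
    (\forall z \near z0^', f z = g z / (z - z0) ^+ n).

(* The odd meromorphic primitive of [- wp tau].  As [Z] is a total function, its
   value at the poles is fixed by convention to be 0, which makes it unique. *)
Definition is_wzeta (R : realType) (tau : cplx R) (Z : cplx R -> cplx R) : Prop :=
  [/\ meromorphic Z,
      forall z, ~ lattice tau z -> is_derive z 1 Z (- wp tau z),
      forall z, Z (- z) = - Z z
    & forall z, lattice tau z -> Z z = 0].

Definition wzeta (R : realType) (tau : cplx R) : cplx R -> cplx R :=
  get [set Z | is_wzeta tau Z].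

(* The constant value of [z |-> wzeta tau (z + w) - wzeta tau z] off the poles,
   for a period [w]. *)
Definition quasi_period (R : realType) (tau w : cplx R) : cplx R :=
  get [set eta | forall z, ~ lattice tau z ->
                   wzeta tau (z + w) - wzeta tau z = eta].

Definition eta1 (R : realType) (tau : cplx R) : cplx R := quasi_period tau 1.
Definition eta2 (R : realType) (tau : cplx R) : cplx R := quasi_period tau tau.

(* Only the indices 1, 2, 3 are meaningful. *)
Definition omega (R : realType) (k : nat) (tau : cplx R) : cplx R :=
  match k with
  | 1%N => 1
  | 2%N => tau
  | _ => 1 + tau
  end.

Definition wp_e (R : realType) (k : nat) (tau : cplx R) : cplx R :=
  wp tau (omega k tau / 2).

Definition g2 (R : realType) (tau : cplx R) : cplx R :=
  - 4 * (wp_e 1%N tau * wp_e 2%N tau + wp_e 1%N tau * wp_e 3%N tau + wp_e 2%N tau * wp_e 3%N tau).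

(* The parameter [c] ranges over the Riemann sphere, with [None] for infinity. *)
Definition f0 (R : realType) (c : option (cplx R)) (tau : cplx R) : cplx R :=
  match c with
  | Some C => 12 * (C * eta1 tau - eta2 tau) ^+ 2 - g2 tau * (C - tau) ^+ 2
  | None => 12 * eta1 tau ^+ 2 - g2 tau
  end.

Definition f123 (R : realType) (k : nat) (c : option (cplx R)) (tau : cplx R) :
    cplx R :=
  match c with
  | Some C => 3 * wp_e k tau * (C * eta1 tau - eta2 tau)
              + (g2 tau / 2 - 3 * wp_e k tau ^+ 2) * (C - tau)
  | None => 3 * wp_e k tau * eta1 tau + g2 tau / 2 - 3 * wp_e k tau ^+ 2
  end.

Definition fkC (R : realType) (k : 'I_4) (c : option (cplx R)) :
    cplx R -> cplx R :=
  if k == ord0 then f0 c else f123 k c.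

(* Main.v *)
Require Import Defs.
From mathcomp Require Import finmap.
From mathcomp Require Import ring lra zify.

(** Put [phi = C eta1 - eta2], [u = C - tau] for finite [C], and [phi = eta1],
    [u = 1] for [C = oo].  Then [f_0 = 12 phi^2 - g2 u^2] and
    [f_k = 3 e_k phi + (g2/2 - 3 e_k^2) u] are forms in [(phi, u)] whose
    coefficients are functions of [tau].  With [c = tau eta1 - eta2], all these
    functions obey one closed differential system (the Ramanujan-Halphen
    system, [quasi_period_system]):
      [c e_k' = 2 e_k^2 - 2 eta1 e_k - g2/3],
      [c phi' = - eta1 phi + g2 u / 12],   [c u' = eta1 u - phi].
    Hence on the zero set of [f] the derivative [c f'] is, up to a factor,
    another form in [(phi, u)].  The resultant of the two forms is, up to a
    constant, a product of differences of the [e_k], so it does not vanish, and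
    [(phi, u)] is not [(0, 0)] because [c <> 0].  Therefore [f] and [f'] have no
    common zero ([quadratic_form_simple], [linear_form_simple]).

    The system comes from two identities between elliptic functions,
      [wp'' = 6 wp^2 - A],
      [c d(wp)/d(tau) = 2 wp^2 - 2 eta1 wp + (zeta - z eta1) wp' - kap],
    for constants [A] and [kap] depending on [tau] alone.  In each of them the
    difference of the two sides is elliptic and bounded near 0, so it is
    constant by Liouville ([wp2_ode], [wp_heat_equation]).  The constants are
    then read off from the half periods.  There [wp'] vanishes, so the [e_k] are
    roots of [4 X^3 - 2 A X - B]; as they are distinct, Vieta gives
    [e_1 + e_2 + e_3 = 0] and [g2 = 2 A].  Differentiating the first relation in
    [tau] gives [kap = g2/3].  At the half periods the second identity reads
    [c e_k' = 2 e_k^2 - 2 eta1 e_k - g2/3]; were [c] zero, three distinct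
    numbers would solve one quadratic equation.  Integrating the identity in [z]
    ([zeta_heat_equation]) yields the derivatives of [eta1] and [eta2].

    Liouville's theorem is obtained here from second differences.  If [h] has
    two complex derivatives at [p], then
    [h(p+t) + h(p-t) + h(p+it) + h(p-it) - 4 h(p) = o(t^2)], so
    [Re h + eps |z|^2] has no local maximum; this is the maximum principle on
    squares.  Finitely many singular points [q] at which [f] stays bounded are
    handled by applying the principle to [f^N prod (z - q)] and letting [N] grow
    ([max_principle_punctured]).  Dividing [f] by [(z - p)^n] then gives both
    Liouville's theorem ([n = 1]) and the identity theorem ([n] arbitrary).  The
    identity theorem enters in the distinctness of the [e_k]
    ([wp_half_periods_neq]).

    The lattice sums and their derivatives in [z] and in [tau] are treated
    together: a family of terms of size [O(|w|^-3)], locally uniformly, may be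
    differentiated term by term along any affine path
    [t |-> (a + b t, c + d t)] in the [(z, tau)] space
    ([isD_lattice_sum_path]). *)
Set Implicit Arguments.
Unset Strict Implicit.
Unset Printing Implicit Defensive.
Import Order.TTheory GRing.Theory Num.Theory.
Import numFieldNormedType.Exports.
Local Open Scope classical_set_scope.
Local Open Scope ring_scope.

(** * Real absolute value and derivatives on the complex numbers *)

Notation toC := (real_complex _ : _ -> cplx _).

Section CplxNorm.
Variable R : realType.
Local Notation C := (cplx R).
Implicit Types (x y z w : C).

(** The norm of [cplx R] takes its values in [cplx R], where the order is only
    partial; [cabs] is the same number as an element of [R], so that case
    analysis on the order and linear arithmetic apply. *)
Definition cabs (z : C) : R := complex.Re `|z|.

Lemma toC_le (a b : R) : (toC a <= toC b) = (a <= b).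
Proof. exact: lecR. Qed.
Lemma toC_lt (a b : R) : (toC a < toC b) = (a < b).
Proof. exact: ltcR. Qed.
Lemma toCM (a b : R) : toC (a * b) = toC a * toC b.
Proof. exact: rmorphM. Qed.
Lemma toCD (a b : R) : toC (a + b) = toC a + toC b.
Proof. exact: rmorphD. Qed.
Lemma toCN (a : R) : toC (- a) = - toC a.
Proof. exact: rmorphN. Qed.
Lemma toCX (a : R) n : toC (a ^+ n) = toC a ^+ n.
Proof. exact: rmorphXn. Qed.
Lemma toCV (a : R) : toC (a^-1) = (toC a)^-1.
Proof. exact: fmorphV. Qed.
Lemma toC_inj : injective (toC : R -> C).
Proof. exact: complexI. Qed.

Lemma normE z : `|z| = toC (cabs z).
Proof. by rewrite /cabs; case: z => a b; rewrite (normc_def (a +i* b)%C). Qed.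

Lemma cabsE z : cabs z = Num.sqrt (complex.Re z ^+ 2 + complex.Im z ^+ 2).
Proof. by rewrite /cabs (normc_def z). Qed.

Lemma cabs_ge0 z : 0 <= cabs z.
Proof. by rewrite cabsE sqrtr_ge0. Qed.
Lemma cabs0 : cabs 0 = 0.
Proof. by rewrite /cabs normr0. Qed.
Lemma cabs1 : cabs 1 = 1.
Proof. by rewrite /cabs normr1. Qed.
Lemma cabs_eq0 z : (cabs z == 0) = (z == 0).
Proof. by rewrite -(normr_eq0 z) normE -(inj_eq toC_inj). Qed.
Lemma cabs_gt0 z : (0 < cabs z) = (z != 0).
Proof. by rewrite lt_def cabs_eq0 cabs_ge0 andbT. Qed.
Lemma cabsN z : cabs (- z) = cabs z.
Proof. by rewrite /cabs normrN. Qed.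
Lemma cabsC z w : cabs (z - w) = cabs (w - z).
Proof. by rewrite -cabsN opprB. Qed.
Lemma cabsM z w : cabs (z * w) = cabs z * cabs w.
Proof. by apply: toC_inj; rewrite toCM -!normE normrM. Qed.
Lemma cabsX z n : cabs (z ^+ n) = cabs z ^+ n.
Proof. by apply: toC_inj; rewrite toCX -!normE normrX. Qed.
Lemma cabsV z : cabs (z^-1) = (cabs z)^-1.
Proof. by apply: toC_inj; rewrite toCV -!normE normfV. Qed.
Lemma cabs_div z w : cabs (z / w) = cabs z / cabs w.
Proof. by rewrite cabsM cabsV. Qed.
Lemma cabsD z w : cabs (z + w) <= cabs z + cabs w.
Proof. by rewrite -toC_le toCD -!normE ler_normD. Qed.
Lemma cabsB z w : cabs (z - w) <= cabs z + cabs w.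
Proof. by rewrite -(cabsN w) cabsD. Qed.
Lemma cabsBr z w : cabs z - cabs w <= cabs (z - w).
Proof. by have := cabsD (z - w) w; rewrite subrK; lra. Qed.
Lemma cabs_toC (a : R) : cabs (toC a) = `|a|.
Proof. by rewrite cabsE /= expr0n addr0 sqrtr_sqr. Qed.
Lemma cabs_Re z : `|complex.Re z| <= cabs z.
Proof.
rewrite cabsE -sqrtr_sqr ler_wsqrtr // lerDl sqr_ge0 //.
Qed.
Lemma cabs_Im z : `|complex.Im z| <= cabs z.
Proof.
rewrite cabsE -sqrtr_sqr ler_wsqrtr // lerDr sqr_ge0 //.
Qed.
Lemma complexE2 z : z = toC (complex.Re z) + 'i%C * toC (complex.Im z).
Proof. exact: complexE. Qed.
Lemma cabs_i : cabs 'i%C = 1.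
Proof. by rewrite cabsE /= expr0n expr1n add0r sqrtr1. Qed.
Lemma cabs_ReIm z : cabs z <= `|complex.Re z| + `|complex.Im z|.
Proof.
rewrite {1}(complexE2 z); apply: (le_trans (cabsD _ _)).
by rewrite cabsM cabs_i !cabs_toC mul1r.
Qed.
Lemma cabs_sum (I : Type) (r : seq I) (P : pred I) (F : I -> C) :
  cabs (\sum_(i <- r | P i) F i) <= \sum_(i <- r | P i) cabs (F i).
Proof.
elim/big_rec2 : _ => [|i a b _ h]; first by rewrite cabs0.
by apply: (le_trans (cabsD _ _)); rewrite lerD2l.
Qed.
Lemma cabs_prod (I : Type) (r : seq I) (P : pred I) (F : I -> C) :
  cabs (\prod_(i <- r | P i) F i) = \prod_(i <- r | P i) cabs (F i).
Proof. exact: (big_morph cabs cabsM cabs1). Qed.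
Lemma cabs_int (n : int) : cabs n%:~R = `|n|%:~R.
Proof.
by rewrite -(rmorph_int (real_complex R)) cabs_toC intr_norm.
Qed.

Lemma nearCP z (P : set C) :
  (\forall w \near z, P w) <-> exists2 d : R, 0 < d & forall w, cabs (w - z) < d -> P w.
Proof.
split=> [/nbhs_normP [e /= e0 H]|[d d0 H]].
  have eE : e = toC (complex.Re e) by have := gtr0_norm e0; rewrite normE => <-.
  exists (complex.Re e); first by rewrite -(toC_lt 0) -eE.
  by move=> w wz; apply: H => /=; rewrite normE cabsC eE toC_lt.
apply/nbhs_normP; exists (toC d); rewrite /= ?toC_lt //.
by move=> w /=; rewrite normE toC_lt cabsC => /H.
Qed.

Lemma cvgCP (T : Type) (F : set_system T) (FF : Filter F) (f : T -> C) (l : C) :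
  f @ F --> l <-> forall e : R, 0 < e -> \forall t \near F, cabs (f t - l) < e.
Proof.
split=> [/cvgr_distC_lt H e e0|H].
  have := H (toC e); rewrite toC_lt => /(_ e0).
  by apply: filterS => t; rewrite normE toC_lt.
apply/cvgrPdistC_lt => e e0.
have eE : e = toC (complex.Re e) by have := gtr0_norm e0; rewrite normE => <-.
have := H (complex.Re e); rewrite -(toC_lt 0) -eE => /(_ e0).
by apply: filterS => t; rewrite normE eE toC_lt.
Qed.

Lemma is_deriveCP (f : C -> C) z d :
  is_derive z 1 f d <-> forall e : R, 0 < e -> exists2 r : R, 0 < r &
    forall h, cabs h < r -> cabs (f (z + h) - f z - d * h) <= e * cabs h.
Proof.
have slopeE h : h != 0 -> (h^-1 *: (f (h *: 1 + z) - f z) : C) - d =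
    (f (z + h) - f z - d * h) / h.
  move=> h0; have -> : h *: 1 = h by exact: mulr1.
  rewrite addrC [z + h]addrC; have -> : h^-1 *: (f (h + z) - f z) =
    h^-1 * (f (h + z) - f z) by [].
  by field.
have key : (fun h => h^-1 *: (f (h *: 1 + z) - f z)) @ 0^' --> d <->
   forall e : R, 0 < e -> exists2 r : R, 0 < r &
    forall h, cabs h < r -> cabs (f (z + h) - f z - d * h) <= e * cabs h.
  split=> [/cvgCP H e e0|H].
    have := H e e0; rewrite near_withinE => /nearCP[r r0 Hr].
    exists r => // h hr.
    have [->|h0] := eqVneq h 0.
      by rewrite addr0 mulr0 subr0 subrr cabs0 mulr0.
    have := Hr h; rewrite subr0 => /(_ hr h0) /ltW.
    by rewrite slopeE // cabs_div ler_pdivrMr ?cabs_gt0.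
  apply/cvgCP => e e0; have [|r r0 Hr] := H (e / 2); first by lra.
  rewrite near_withinE; apply/nearCP; exists r => // h; rewrite subr0 => hr h0.
  rewrite slopeE // cabs_div ltr_pdivrMr ?cabs_gt0 //.
  apply: (le_lt_trans (Hr h hr)).
  by rewrite ltr_pM2r ?cabs_gt0 //; lra.
split=> [[/= H1 H2]|H]; first by apply/key; rewrite -H2.
by move/key in H; split; [apply/cvg_ex; exists d | exact: cvg_lim].
Qed.

End CplxNorm.

Lemma is_deriveRP (R : realType) (f : R -> R) t d :
  (forall e : R, 0 < e -> exists2 r : R, 0 < r &
    forall h, `|h| < r -> `|f (t + h) - f t - d * h| <= e * `|h|) ->
  is_derive t 1 f d.
Proof.
move=> H; have key : (fun h => h^-1 *: (f (h *: 1 + t) - f t)) @ 0^' --> d.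
  apply/cvgrPdist_le => e e0; have [r r0 Hr] := H e e0.
  rewrite near_withinE; apply/nbhs_normP; exists r => //= h.
  rewrite /ball_ /= sub0r normrN => hr h0.
  have -> : d - h^-1 *: (f (h *: 1 + t) - f t) = - ((f (t + h) - f t - d * h) / h).
    have -> : h *: 1 = h by exact: mulr1.
    rewrite [t + h]addrC; have -> : h^-1 *: (f (h + t) - f t) =
      h^-1 * (f (h + t) - f t) by [].
    by field.
  by rewrite normrN normrM normfV ler_pdivrMr ?normr_gt0 // Hr.
by split; [apply/cvg_ex; exists d | exact: cvg_lim].
Qed.

(** With the derivative as an argument and the direction fixed, the rules below
    apply to functions written pointwise. *)
Definition isD (R : realType) (f : cplx R -> cplx R) (z d : cplx R) : Prop :=
  is_derive z 1 f d.

Section Rules.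
Variable R : realType.
Local Notation C := (cplx R).
Implicit Types (f g : C -> C) (z w a b d : C).

Lemma isDP f z d :
  isD f z d <-> forall e : R, 0 < e -> exists2 r : R, 0 < r &
    forall h, cabs h < r -> cabs (f (z + h) - f z - d * h) <= e * cabs h.
Proof. exact: is_deriveCP. Qed.

Lemma isD_eq f z d d' : isD f z d -> d = d' -> isD f z d'.
Proof. by move=> ? <-. Qed.

Lemma isD_unique f z d d' : isD f z d -> isD f z d' -> d = d'.
Proof. by move=> [_ <-] [_ <-]. Qed.

Lemma isD_cst a z : isD (fun=> a) z 0.
Proof. exact: is_derive_cst. Qed.
Lemma isD_id z : isD (fun z => z) z 1.
Proof. exact: is_derive_id. Qed.
Lemma isD_add f g z df dg :
  isD f z df -> isD g z dg -> isD (fun z => f z + g z) z (df + dg).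
Proof. by move=> ? ?; apply: is_deriveD. Qed.
Lemma isD_opp f z df : isD f z df -> isD (fun z => - f z) z (- df).
Proof. by move=> ?; apply: is_deriveN. Qed.
Lemma isD_sub f g z df dg :
  isD f z df -> isD g z dg -> isD (fun z => f z - g z) z (df - dg).
Proof. by move=> ? ?; apply: is_deriveB. Qed.
Lemma isD_mul f g z df dg :
  isD f z df -> isD g z dg -> isD (fun z => f z * g z) z (df * g z + f z * dg).
Proof.
move=> hf hg; have := @is_deriveM _ _ f g z 1 df dg hf hg.
by move=> h; apply: isD_eq h _; rewrite addrC /GRing.scale /= mulrC.
Qed.
Lemma isD_inv f z df :
  f z != 0 -> isD f z df -> isD (fun z => (f z)^-1) z (- df / f z ^+ 2).
Proof.
move=> fz [hf hdf]; split; first exact: derivableV.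
by rewrite deriveV // hdf /GRing.scale /= !mulNr mulrC.
Qed.
Lemma isD_exp f n z df :
  isD f z df -> isD (fun z => f z ^+ n) z (n%:R * f z ^+ n.-1 * df).
Proof.
move=> hf; have h := @is_deriveX _ _ f n z 1 df hf.
have -> : (fun z => f z ^+ n) = f ^+ n.
  by apply/funext => x; rewrite exprfctE.
by apply: isD_eq h _; rewrite /GRing.scale /= mulr_natl.
Qed.
Lemma isD_near f g z d :
  (\forall w \near z, f w = g w) -> isD f z d -> isD g z d.
Proof.
move=> fg hf; have [r r0 Hr] := (nearCP _ _).1 fg.
apply/isDP => e e0; have [s s0 Hs] := (isDP _ _ _).1 hf e e0.
exists (Num.min r s); first by rewrite lt_min r0 s0.
move=> h; rewrite lt_min => /andP[hr hsm].
rewrite -!Hr; first exact: Hs.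
  by rewrite subrr cabs0.
by rewrite addrC addKr.
Qed.
Lemma isD_affine_comp f a b z d :
  isD f (a + b * z) d -> isD (fun z => f (a + b * z)) z (b * d).
Proof.
move=> /isDP H; apply/isDP => e e0.
have [|r r0 Hr] := H (e / (cabs b + 1)).
  by rewrite divr_gt0 // ltr_wpDl ?cabs_ge0.
have b1 : 0 < cabs b + 1 by rewrite ltr_wpDl ?cabs_ge0.
exists (r / (cabs b + 1)); first by rewrite divr_gt0.
move=> h hr; have := Hr (b * h).
have -> : a + b * z + b * h = a + b * (z + h) by ring.
have -> : b * d * h = d * (b * h) by ring.
have hh : cabs (b * h) <= (cabs b + 1) * cabs h.
  by rewrite cabsM ler_wpM2r ?cabs_ge0 // lerDl.
move=> /(_ _)/le_trans; apply.
  apply: le_lt_trans hh _; rewrite mulrC -ltr_pdivlMr //.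
by rewrite -mulrA ler_pM2l // ler_pdivrMl.
Qed.
Lemma isD_shift f a z d : isD f (z + a) d -> isD (fun z => f (z + a)) z d.
Proof.
move=> h; have := @isD_affine_comp f a 1 z d; rewrite mul1r [a + z]addrC => /(_ h).
by rewrite mul1r (_ : (fun z => f (a + 1 * z)) = (fun z => f (z + a))) //;
   apply/funext => x; rewrite mul1r addrC.
Qed.

Lemma isD_sum (I : Type) (r : seq I) (F : I -> C -> C) z (d : I -> C) :
  (forall i, isD (F i) z (d i)) ->
  isD (fun z => \sum_(i <- r) F i z) z (\sum_(i <- r) d i).
Proof.
move=> H; elim: r => [|i r IH].
  rewrite big_nil; have -> : (fun z => \sum_(i <- [::]) F i z) = (fun=> 0).
    by apply/funext => x; rewrite big_nil.
  exact: isD_cst.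
rewrite big_cons; have -> : (fun z => \sum_(i <- i :: r) F i z) =
   (fun z => F i z + \sum_(i <- r) F i z).
  by apply/funext => x; rewrite big_cons.
exact: isD_add.
Qed.

Lemma isD_continuous f z d : isD f z d -> forall e : R, 0 < e ->
  \forall w \near z, cabs (f w - f z) < e.
Proof.
move=> /isDP H e e0; have [|r r0 Hr] := H 1; first by [].
apply/nearCP; exists (Num.min r (e / (cabs d + 1))).
  by rewrite lt_min r0 divr_gt0 // ltr_wpDl ?cabs_ge0.
move=> w; rewrite lt_min => /andP[wr we].
have := Hr (w - z) wr; rewrite [z + _]addrC subrK mul1r => h.
have d1 : 0 < cabs d + 1 by rewrite ltr_wpDl ?cabs_ge0.
have : cabs (f w - f z) <= cabs (w - z) + cabs d * cabs (w - z).
  rewrite -cabsM; have -> : f w - f z = (f w - f z - d * (w - z)) + d * (w - z).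
    by rewrite subrK.
  by apply: (le_trans (cabsD _ _)); rewrite lerD2r.
move: we; rewrite ltr_pdivlMr // => we hle; apply: le_lt_trans hle _; lra.
Qed.

Lemma isD_neq0 f z d : isD f z d -> f z != 0 -> \forall w \near z, f w != 0.
Proof.
move=> hf fz; have := isD_continuous hf (e := cabs (f z)); rewrite cabs_gt0 => /(_ fz).
apply: filterS => w; apply: contraTneq => ->.
by rewrite sub0r cabsN ltxx.
Qed.

Lemma isD_Re f a h (t : R) d : isD f (a + toC t * h) d ->
  is_derive t 1 (fun t : R => complex.Re (f (a + toC t * h))) (complex.Re (d * h)).
Proof.
move=> hf; have hf' : isD (fun z => f (a + h * z)) (toC t) (h * d).
  by apply: isD_affine_comp; rewrite mulrC.
apply: is_deriveRP => e e0; have [r r0 Hr] := (isDP _ _ _).1 hf' e e0.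
exists r => // s sr; have := Hr (toC s); rewrite cabs_toC => /(_ sr).
apply: le_trans; apply: le_trans (cabs_Re _).
rewrite -toCD [h * toC (t + s)]mulrC [h * toC t]mulrC [h * d]mulrC.
rewrite !raddfB /= (_ : complex.Re (d * h * toC s) = complex.Re (d * h) * s) //.
by case: (d * h) => x y; rewrite /= mulr0 subr0.
Qed.

(** Rotating a value onto the positive axis lets one bound an absolute value by
    bounding a real part. *)
Lemma rotation_to_norm (v : C) : exists2 u : C, cabs u = 1 & u * v = toC (cabs v).
Proof.
have [->|v0] := eqVneq v 0; first by exists 1; rewrite ?cabs1 // cabs0 mulr0.
exists (toC (cabs v) / v); last by rewrite divfK.
by rewrite cabs_div cabs_toC ger0_norm ?cabs_ge0 // divff // cabs_eq0.
Qed.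

(** The real mean value theorem applied to [Re (u * f)] along the segment, where
    the unit [u] turns [f b - f a] into its absolute value. *)
Lemma mean_value_bound f (f' : C -> C) a b (M : R) :
  (forall t : R, 0 <= t <= 1 -> isD f (a + toC t * (b - a)) (f' (a + toC t * (b - a)))) ->
  (forall t : R, 0 <= t <= 1 -> cabs (f' (a + toC t * (b - a))) <= M) ->
  cabs (f b - f a) <= M * cabs (b - a).
Proof.
move=> Hd HM; have [u dtau_zeta_term uv] := rotation_to_norm (f b - f a).
pose phi (t : R) := complex.Re (u * f (a + toC t * (b - a))).
pose dphi (t : R) := complex.Re (u * f' (a + toC t * (b - a)) * (b - a)).
have D (t : R) : 0 <= t <= 1 -> is_derive t 1 phi (dphi t).
  move=> t01; apply: (@isD_Re (fun z => u * f z)).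
  by apply: isD_eq (isD_mul (isD_cst _ _) (Hd _ t01)) _; rewrite mul0r add0r.
have [x||c c01] := @MVT R phi dphi 0 1 ltr01.

- rewrite in_itv /= => /andP[? ?]; apply: D; rewrite !ltW //.
- apply: derivable_within_continuous => x; rewrite in_itv /= => x01.
  by have [] := D x x01.
rewrite subr0 mulr1 /phi /dphi => E.
have := cabs_Re (u * f' (a + toC c * (b - a)) * (b - a)).
rewrite -E -raddfB /= -mulrBr.
have -> : a + toC 1 * (b - a) = b by rewrite mul1r addrC subrK.
have -> : a + toC 0 * (b - a) = a by rewrite mul0r addr0.
rewrite uv /= ger0_norm ?cabs_ge0 // !cabsM dtau_zeta_term mul1r => /le_trans; apply.
rewrite ler_wpM2r ?cabs_ge0 // HM //.
by move: c01; rewrite in_itv /= => /andP[? ?]; rewrite !ltW.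
Qed.

End Rules.

(** * Two complex derivatives and second differences *)

(** Exactly the regularity used by the maximum principle; stated with an explicit
    first derivative so that products, inverses and shifts compose. *)
Definition derivable2 (R : realType) (f : cplx R -> cplx R) (z : cplx R) : Prop :=
  exists f' : cplx R -> cplx R,
    (\forall w \near z, isD f w (f' w)) /\ exists d, isD f' z d.

Section C2Rules.
Variable R : realType.
Local Notation C := (cplx R).
Implicit Types (f g : C -> C) (z w a b d : C).

Lemma near_here z (P : set C) : (\forall w \near z, P w) -> P z.
Proof. by move/nearCP => [d d0]; apply; rewrite subrr cabs0. Qed.

Lemma near_all z (P : set C) : (forall w, P w) -> \forall w \near z, P w.
Proof. by move=> H; apply/nearCP; exists 1. Qed.


Lemma derivable2_isD f z : derivable2 f z -> exists d, isD f z d.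
Proof. by move=> [f' [/near_here ? _]]; exists (f' z). Qed.

Lemma derivable2_cst a z : derivable2 (fun=> a) z.
Proof.
exists (fun=> 0); split; first by apply: near_all => w; exact: isD_cst.
by exists 0; exact: isD_cst.
Qed.
Lemma derivable2_id z : derivable2 (fun z => z) z.
Proof.
exists (fun=> 1); split; first by apply: near_all => w; exact: isD_id.
by exists 0; exact: isD_cst.
Qed.
Lemma derivable2_add f g z : derivable2 f z -> derivable2 g z -> derivable2 (fun z => f z + g z) z.
Proof.
move=> [f' [nf [df hf]]] [g' [ng [dg hg]]]; exists (fun z => f' z + g' z); split.
  by apply: filterS2 nf ng => w; exact: isD_add.
by eexists; exact: isD_add hf hg.
Qed.
Lemma derivable2_mul f g z : derivable2 f z -> derivable2 g z -> derivable2 (fun z => f z * g z) z.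
Proof.
move=> [f' [nf [df hf]]] [g' [ng [dg hg]]].
exists (fun z => f' z * g z + f z * g' z); split.
  by apply: filterS2 nf ng => w; exact: isD_mul.
eexists; apply: isD_add.
  exact: isD_mul hf (near_here ng).
exact: isD_mul (near_here nf) hg.
Qed.
Lemma derivable2_opp f z : derivable2 f z -> derivable2 (fun z => - f z) z.
Proof.
move=> [f' [nf [df hf]]]; exists (fun z => - f' z); split.
  by apply: filterS nf => w; exact: isD_opp.
by eexists; exact: isD_opp hf.
Qed.
Lemma derivable2_sub f g z : derivable2 f z -> derivable2 g z -> derivable2 (fun z => f z - g z) z.
Proof. by move=> hf hg; apply: derivable2_add => //; exact: derivable2_opp. Qed.
Lemma derivable2_exp f n z : derivable2 f z -> derivable2 (fun z => f z ^+ n) z.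
Proof.
move=> [f' [nf [df hf]]]; exists (fun z => n%:R * f z ^+ n.-1 * f' z); split.
  by apply: filterS nf => w; exact: isD_exp.
eexists; apply: isD_mul hf; apply: isD_mul (isD_cst _ _) _.
exact: isD_exp (near_here nf).
Qed.
Lemma derivable2_inv f z : f z != 0 -> derivable2 f z -> derivable2 (fun z => (f z)^-1) z.
Proof.
move=> fz [f' [nf [df hf]]]; exists (fun z => - f' z * (f z ^+ 2)^-1); split.
  have := isD_neq0 (near_here nf) fz; apply: filterS2 nf => w hw fw.
  by apply: isD_inv.
eexists; apply: isD_mul (isD_opp hf) _; apply: isD_inv.
  by rewrite expf_neq0.
exact: isD_exp (near_here nf).
Qed.
Lemma derivable2_prod (I : Type) (r : seq I) (F : I -> C -> C) z :
  (forall i, derivable2 (F i) z) -> derivable2 (fun z => \prod_(i <- r) F i z) z.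
Proof.
move=> H; elim: r => [|i r IH].
  have -> : (fun z => \prod_(i <- [::]) F i z) = (fun=> 1).
    by apply/funext => x; rewrite big_nil.
  exact: derivable2_cst.
have -> : (fun z => \prod_(i <- i :: r) F i z) =
   (fun z => F i z * \prod_(i <- r) F i z).
  by apply/funext => x; rewrite big_cons.
exact: derivable2_mul.
Qed.
Lemma near_shift z a (P : set C) : (\forall w \near z + a, P w) ->
  \forall w \near z, P (w + a).
Proof.
move/nearCP => [d d0 H]; apply/nearCP; exists d => // w wd; apply: H.
by rewrite opprD addrACA subrr addr0.
Qed.
Lemma derivable2_shift f a z : derivable2 f (z + a) -> derivable2 (fun z => f (z + a)) z.
Proof.
move=> [f' [nf [df hf]]]; exists (fun z => f' (z + a)); split.
  by apply: filterS (near_shift nf) => w; exact: isD_shift.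
by exists df; exact: isD_shift.
Qed.

(** The value of a discrete Laplacian: the quadratic terms in the four directions
    [1, -1, i, -i] cancel because [1 + i^2 = 0].  The derivative in [t] of the
    sum is [o(t)], and the mean value bound integrates it. *)
Lemma second_difference_bound f p : derivable2 f p -> forall e : R, 0 < e -> exists2 r : R, 0 < r &
  forall t : R, 0 < t < r ->
  cabs (f (p + toC t) + f (p - toC t) + f (p + 'i%C * toC t) + f (p - 'i%C * toC t)
        - 4 * f p) <= e * t ^+ 2.
Proof.
move=> [f' [nf [d hd]]] e e0.
have [r r0 Hr] := (nearCP _ _).1 nf.
have [|s s0 Hs] := (isDP _ _ _).1 hd (e / 4); first by lra.
exists (Num.min r s); first by rewrite lt_min r0 s0.
move=> t /andP[t0]; rewrite lt_min => /andP[tr ts].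
pose S z := f (p + 1 * z) + f (p + (-1) * z) + f (p + 'i%C * z) + f (p + (- 'i%C) * z).
pose S' z := 1 * f' (p + 1 * z) + (-1) * f' (p + (-1) * z) + 'i%C * f' (p + 'i%C * z)
   + (- 'i%C) * f' (p + (- 'i%C) * z).
have ii : 'i%C * 'i%C = -1 :> C by rewrite -expr2 sqr_i.
have := @mean_value_bound _ S S' 0 (toC t) (e * t).
rewrite (subr0 (toC t)) cabs_toC (gtr0_norm t0) -mulrA -expr2.
have -> : S (toC t) - S 0 = f (p + toC t) + f (p - toC t) + f (p + 'i%C * toC t)
   + f (p - 'i%C * toC t) - 4 * f p.
  by rewrite /S !mulr0 !addr0 !mul1r !mulN1r mulNr; ring.
have seg x : 0 <= x <= 1 -> cabs (0 + toC x * toC t) <= t.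
  move=> /andP[x0 x1]; rewrite add0r -toCM cabs_toC ger0_norm ?mulr_ge0 ?(ltW t0) //.
  by rewrite ler_piMl ?(ltW t0).
have rot u z : cabs u = 1 -> cabs z < r -> isD f (p + u * z) (f' (p + u * z)).
  move=> dtau_zeta_term zr; apply: Hr; rewrite addrC addKr cabsM dtau_zeta_term mul1r //.
apply.
  move=> x /seg xt; have xr := le_lt_trans xt tr.
  rewrite /S /S'; do ! apply: isD_add; apply: isD_affine_comp; apply: rot => //;
    by rewrite ?cabsN ?cabs1 ?cabs_i.
move=> x /seg xt; set z := 0 + _ in xt *.
have zs := le_lt_trans xt ts.
pose rho w := f' (p + w) - f' p - d * w.
have rhoE w : f' (p + w) = f' p + d * w + rho w by rewrite /rho; ring.
have rhob u : cabs u = 1 -> cabs (u * rho (u * z)) <= e / 4 * t.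
  move=> dtau_zeta_term; rewrite cabsM dtau_zeta_term mul1r.
  have := Hs (u * z); rewrite cabsM dtau_zeta_term mul1r => /(_ zs)/le_trans; apply.
  by rewrite ler_wpM2l //; lra.
have -> : S' z = 1 * rho (1 * z) + (-1) * rho ((-1) * z) + 'i%C * rho ('i%C * z)
   + (- 'i%C) * rho ((- 'i%C) * z).
  rewrite /S' !rhoE.
  transitivity (d * z * (2 + 2 * ('i%C * 'i%C)) + (1 * rho (1 * z) + (-1) * rho ((-1) * z) + 'i%C * rho ('i%C * z)
   + (- 'i%C) * rho ((- 'i%C) * z))); first by ring.
  by rewrite ii mulrN1 subrr mulr0 add0r.
have h1 := rhob 1 (cabs1 _).
have h2 : cabs ((-1) * rho ((-1) * z)) <= _ := rhob (-1) _.
have h3 := rhob 'i%C (cabs_i _).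
have h4 : cabs ((- 'i%C) * rho ((- 'i%C) * z)) <= _ := rhob (- 'i%C) _.
have {}h2 := h2 (etrans (cabsN _) (cabs1 _)).
have {}h4 := h4 (etrans (cabsN _) (cabs_i _)).
apply: (le_trans (cabsD _ _)); have := cabsD (1 * rho (1 * z) + -1 * rho (-1 * z)) ('i%C * rho ('i%C * z)).
have := cabsD (1 * rho (1 * z)) (-1 * rho (-1 * z)).
lra.
Qed.

End C2Rules.

(** * The maximum principle *)

Definition in_square (R : realType) (p : cplx R) (r : R) (z : cplx R) : Prop :=
  `|complex.Re (z - p)| <= r /\ `|complex.Im (z - p)| <= r.

Definition continuous_at (R : realType) (f : cplx R -> cplx R) (z : cplx R) : Prop :=
  forall e : R, 0 < e -> \forall w \near z, cabs (f w - f z) < e.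

Section MaxPrinciple.
Variable R : realType.
Local Notation C := (cplx R).
Implicit Types (f g : C -> C) (z w a b d p : C).

Lemma Re_toC (a b : R) : complex.Re (toC a + 'i%C * toC b) = a.
Proof. by rewrite /=; ring. Qed.
Lemma Im_toC (a b : R) : complex.Im (toC a + 'i%C * toC b) = b.
Proof. by rewrite /=; ring. Qed.

Lemma ReD z w : complex.Re (z + w) = complex.Re z + complex.Re w.
Proof. by case: z w => ? ? []. Qed.
Lemma ImD z w : complex.Im (z + w) = complex.Im z + complex.Im w.
Proof. by case: z w => ? ? []. Qed.
Lemma ReN z : complex.Re (- z) = - complex.Re z.
Proof. by case: z. Qed.
Lemma ImN z : complex.Im (- z) = - complex.Im z.
Proof. by case: z. Qed.

Lemma sqr_cabs z : cabs z ^+ 2 = complex.Re z ^+ 2 + complex.Im z ^+ 2.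
Proof. by rewrite cabsE sqr_sqrtr // addr_ge0 ?sqr_ge0. Qed.

Lemma square_cabs p r z : in_square p r z -> cabs (z - p) <= 2 * r.
Proof. by move=> [h1 h2]; have := cabs_ReIm (z - p); lra. Qed.

Lemma plane_map_continuous p (x : R * R) (e : R) : 0 < e ->
  \forall y \near x, cabs ((p + (toC y.1 + 'i%C * toC y.2)) -
    (p + (toC x.1 + 'i%C * toC x.2))) < e.
Proof.
move=> e0.
have h1 : \forall y \near x, `|x.1 - y.1| < e / 2.
  have /cvgrPdist_lt : (fun y : R * R => y.1) @ x --> x.1.
    by case: x => ? ?; exact: cvg_fst.
  by apply; lra.
have h2 : \forall y \near x, `|x.2 - y.2| < e / 2.
  have /cvgrPdist_lt : (fun y : R * R => y.2) @ x --> x.2.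
    by case: (x) => ? ?; exact: cvg_snd.
  by apply; lra.
apply: filterS2 h1 h2 => y h1 h2.
have -> : p + (toC y.1 + 'i%C * toC y.2) - (p + (toC x.1 + 'i%C * toC x.2)) = toC (y.1 - x.1) + 'i%C * toC (y.2 - x.2).
  by rewrite !rmorphB /=; ring.
apply: (le_lt_trans (cabsD _ _)); rewrite cabsM cabs_i mul1r !cabs_toC.
by rewrite distrC [X in _ + X]distrC; lra.
Qed.

Lemma plane_map_square p (r : R) (x : R * R) :
  (`[- r, r] `*` `[- r, r])%classic x <-> in_square p r (p + (toC x.1 + 'i%C * toC x.2)).
Proof.
rewrite /in_square [p + _]addrC addrK Re_toC Im_toC.
by rewrite /= !in_itv /= !ler_norml.
Qed.

(** Compactness is transported from a square in [R * R]. *)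
Lemma square_max (h : C -> R) p (r : R) : 0 < r ->
  (forall z, in_square p r z -> forall e : R, 0 < e ->
     \forall w \near z, `|h w - h z| < e) ->
  exists2 z, in_square p r z & forall w, in_square p r w -> h w <= h z.
Proof.
move=> r0 hc.
pose plane_map (x : R * R) : C := p + (toC x.1 + 'i%C * toC x.2).
pose A : set (R * R) := `[- r, r] `*` `[- r, r].
have gamP x : A x <-> in_square p r (plane_map x) by exact: plane_map_square.
have gamc x : forall e : R, 0 < e -> \forall y \near x, cabs (plane_map y - plane_map x) < e.
  by move=> e; exact: plane_map_continuous.
have [||| x /set_mem /gamP xA Hx] := @compact_EVT_max _ R (h \o plane_map) A.
- exists (0, 0); rewrite /A /= !in_itv /=; lra.
- by apply: compact_setX; apply: segment_compact.
- apply: continuous_in_subspaceT => x /set_mem /gamP xA.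
  apply/cvgrPdist_lt => e e0.
  have [d d0 Hd] := (nearCP _ _).1 (hc _ xA e e0).
  by apply: filterS (gamc x d d0) => y /Hd; rewrite distrC.
exists (plane_map x) => // w wQ.
have wE : w = plane_map (complex.Re (w - p), complex.Im (w - p)).
  by rewrite /plane_map /= -complexE2 addrC subrK.
rewrite wE; apply: Hx; apply/mem_set/gamP; rewrite -wE //.
Qed.

Lemma isD_continuous_at f z d : isD f z d -> continuous_at f z.
Proof. by move=> h e e0; exact: isD_continuous h e e0. Qed.

Lemma derivable2_continuous_at f z : derivable2 f z -> continuous_at f z.
Proof. by move=> /derivable2_isD [d /isD_continuous_at]. Qed.

Lemma sqr_cabs_cont p z (e : R) : 0 < e ->
  \forall w \near z, `|cabs (w - p) ^+ 2 - cabs (z - p) ^+ 2| < e.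
Proof.
move=> e0; set b := cabs (z - p).
have b0 : 0 <= b by exact: cabs_ge0.
have k0 : 0 < 2 * b + 1 by lra.
apply/nearCP; exists (Num.min 1 (e / (2 * b + 1))); first by rewrite lt_min ltr01 divr_gt0.
move=> w; rewrite lt_min ltr_pdivlMr // => /andP[w1 w2].
set a := cabs (w - p); have a0 : 0 <= a by exact: cabs_ge0.
have h1 := cabsD (w - z) (z - p); have h2 := cabsD (z - w) (w - p).
rewrite !addrA !subrK -/a -/b in h1 h2; rewrite [cabs (z - w)]cabsC in h2.
have hab : `|a - b| <= cabs (w - z) by rewrite ler_norml; lra.
rewrite subr_sqr normrM (ger0_norm (_ : 0 <= a + b)); last by lra.
apply: le_lt_trans w2; apply: ler_pM => //; lra.
Qed.

(** Suppose [|f z0| > M].  After a rotation, [v = Re (u f) + eps |z - p|^2] with a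
    small [eps] attains its maximum over the square at an interior point where
    [f] does not vanish; there the second difference of [Re (u f)] is [o(t^2)]
    whereas that of [eps |z - p|^2] is [4 eps t^2].  Regularity is asked only
    where [f <> 0], which leaves room for zeros placed at singular points. *)
Lemma max_principle f p (r M : R) : 0 < r -> 0 <= M ->
  (forall z, in_square p r z -> continuous_at f z) ->
  (forall z, `|complex.Re (z - p)| < r -> `|complex.Im (z - p)| < r ->
     f z != 0 -> derivable2 f z) ->
  (forall z, in_square p r z ->
     `|complex.Re (z - p)| = r \/ `|complex.Im (z - p)| = r -> cabs (f z) <= M) ->
  forall z, in_square p r z -> cabs (f z) <= M.
Proof.
move=> r0 M0 fc fC2 fM z0 z0Q; rewrite leNgt; apply/negP => Mm.
set m := cabs (f z0) in Mm.
have [u dtau_zeta_term um] := rotation_to_norm (f z0).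
(* On the square [|z - p|^2 <= 2 r^2], so the perturbation stays below half the gap. *)
pose eps := (m - M) / (4 * r ^+ 2).
have r2 : 0 < r ^+ 2 by rewrite exprn_gt0.
have eps0 : 0 < eps by rewrite divr_gt0 ?subr_gt0 //; lra.
have epsE : eps * (2 * r ^+ 2) = (m - M) / 2.
  by rewrite /eps; field; rewrite gt_eqF.
clearbody eps.
pose v z := complex.Re (u * f z) + eps * cabs (z - p) ^+ 2.
have sqQ z : in_square p r z -> eps * cabs (z - p) ^+ 2 <= (m - M) / 2.
  move=> [h1 h2]; rewrite -epsE ler_pM2l // sqr_cabs.
  have : complex.Re (z - p) ^+ 2 <= r ^+ 2.
    by move: h1; rewrite ler_norml => /andP[? ?]; nra.
  have : complex.Im (z - p) ^+ 2 <= r ^+ 2.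
    by move: h2; rewrite ler_norml => /andP[? ?]; nra.
  lra.
have vle z : v z <= cabs (f z) + eps * cabs (z - p) ^+ 2.
  rewrite /v lerD2r; have := cabs_Re (u * f z); rewrite cabsM dtau_zeta_term mul1r.
  by apply: le_trans; exact: ler_norm.
have [|z1 z1Q z1max] := @square_max v p r r0.
  move=> z zQ e e0.
  have e2 : 0 < e / 2 by lra.
  have ee : 0 < e / (eps * 2) by rewrite divr_gt0 // mulr_gt0.
  have h1 := fc z zQ _ e2.
  have h2 := sqr_cabs_cont p z ee.
  apply: filterS2 h1 h2 => w h1 h2; rewrite /v.
  have -> : complex.Re (u * f w) + eps * cabs (w - p) ^+ 2 - (complex.Re (u * f z) + eps * cabs (z - p) ^+ 2)
     = complex.Re (u * (f w - f z)) + eps * (cabs (w - p) ^+ 2 - cabs (z - p) ^+ 2).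
    by rewrite mulrBr raddfB /=; ring.
  apply: (le_lt_trans (ler_normD _ _)).
  have := cabs_Re (u * (f w - f z)); rewrite cabsM dtau_zeta_term mul1r => h3.
  rewrite normrM (gtr0_norm eps0); move: h2; rewrite ltr_pdivlMr ?mulr_gt0 // => h2.
  set X := `|_ ^+ 2 - _| in h2 *; lra.
have vm : m <= v z1.
  apply: le_trans (z1max _ z0Q); rewrite /v um /= lerDl.
  by rewrite mulr_ge0 ?sqr_ge0 // ltW.
have := vle z1; have := sqQ _ z1Q => h1 h2.
have f1 : f z1 != 0.
  by apply/eqP => E; move: h2; rewrite E cabs0 add0r; lra.
have nb : ~ (`|complex.Re (z1 - p)| = r \/ `|complex.Im (z1 - p)| = r).
  by move=> /(fM z1 z1Q); lra.
have [hre him] := z1Q.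
have {}hre : `|complex.Re (z1 - p)| < r.
  by rewrite lt_neqAle hre andbT; apply/eqP => E; apply: nb; left.
have {}him : `|complex.Im (z1 - p)| < r.
  by rewrite lt_neqAle him andbT; apply/eqP => E; apply: nb; right.
have hC : derivable2 (fun z => u * f z) z1 by apply: derivable2_mul; [exact: derivable2_cst | exact: fC2].
have [|s s0 Hs] := second_difference_bound hC (e := 2 * eps); first by lra.
pose t := Num.min (s / 2) (Num.min (r - `|complex.Re (z1 - p)|) (r - `|complex.Im (z1 - p)|)).
have t0 : 0 < t by rewrite /t !lt_min divr_gt0 // !subr_gt0 hre him.
have ts : t <= s / 2 by rewrite /t ge_min lexx.
have tr : t <= r - `|complex.Re (z1 - p)| by rewrite /t !ge_min lexx !orbT.
have ti : t <= r - `|complex.Im (z1 - p)| by rewrite /t !ge_min lexx !orbT.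
have t_s : 0 < t < s by lra.
have H4 := Hs t t_s.
set x := complex.Re (z1 - p) in hre tr; set y := complex.Im (z1 - p) in him ti.
have inQ (a b : R) : `|a| <= t -> `|b| <= t -> in_square p r (z1 + (toC a + 'i%C * toC b)).
  move=> ha hb; rewrite /in_square addrAC.
  rewrite ReD ImD Re_toC Im_toC -/x -/y.
  split; [have := ler_normD x a | have := ler_normD y b]; lra.
have vE (a b : R) : eps * cabs (z1 + (toC a + 'i%C * toC b) - p) ^+ 2 = eps * ((x + a) ^+ 2 + (y + b) ^+ 2).
  by rewrite sqr_cabs addrAC ReD ImD Re_toC Im_toC.
have tt : `|t| <= t by rewrite ger0_norm // ltW.
have ntt : `|-t| <= t by rewrite normrN.
have t00 : `|0 : R| <= t by rewrite normr0 ltW.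
have m1 := z1max _ (inQ t 0 tt t00).
have m2 := z1max _ (inQ (- t) 0 ntt t00).
have m3 := z1max _ (inQ 0 t t00 tt).
have m4 := z1max _ (inQ 0 (- t) t00 ntt).
rewrite /v !vE in m1 m2 m3 m4.
have E0 : eps * cabs (z1 - p) ^+ 2 = eps * (x ^+ 2 + y ^+ 2) by rewrite sqr_cabs.
rewrite E0 !(rmorph0, mulr0, addr0, add0r) in m1 m2 m3 m4.
rewrite !(toCN, mulrN) in m1 m2 m3 m4.
have := le_trans (cabs_Re _) H4; rewrite ler_norml => /andP[+ _].
rewrite !(ReD, ReN).
have -> : complex.Re (4 * (u * f z1)) = 4 * complex.Re (u * f z1).
  have -> : (4 : C) = toC 4 by rewrite rmorph_nat.
  by case: (u * f z1) => ? ?; rewrite /= mul0r subr0.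
have et : 0 < eps * t ^+ 2 by rewrite mulr_gt0 ?exprn_gt0.
move: m1 m2 m3 m4; clear -et; lra.
Qed.

Lemma bernoulli_unbounded (x A : R) : 1 < x -> exists N, A < x ^+ N.
Proof.
move=> x1; pose N := (Num.truncn (`|A| / (x - 1))).+1; exists N.
have bern n : 1 + n%:R * (x - 1) <= x ^+ n.
  elim: n => [|n IH]; first by rewrite mul0r addr0 expr0.
  rewrite exprS; apply: (@le_trans _ _ (x * (1 + n%:R * (x - 1)))).
    have := mulr_ge0 (ler0n R n) (sqr_ge0 (x - 1)); rewrite -natr1; lra.
  by rewrite ler_pM2l //; lra.
apply: lt_le_trans (bern N).
have : `|A| / (x - 1) < N%:R by exact: truncnS_gt.
rewrite ltr_pdivrMr ?subr_gt0 //; have := ler_norm A; lra.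
Qed.

(** For [H = f^N * prod (z - q)] the singular points are zeros, so the maximum
    principle bounds [|f|^N |prod (z - q)|] by [M^N D].  Taking [N]-th roots as
    [N] grows removes the influence of the product. *)
Lemma max_principle_punctured f p (r M : R) (L : seq C) : 0 < r -> 0 < M ->
  (forall z, in_square p r z -> z \notin L -> derivable2 f z) ->
  (forall z, in_square p r z -> z \in L -> exists K : R,
     \forall w \near z, w \notin L -> cabs (f w) <= K) ->
  (forall z, in_square p r z -> z \notin L ->
     `|complex.Re (z - p)| = r \/ `|complex.Im (z - p)| = r -> cabs (f z) <= M) ->
  forall z, in_square p r z -> z \notin L -> cabs (f z) <= M.
Proof.
move=> r0 M0 fC fb fM z0 z0Q z0L; rewrite leNgt; apply/negP => Mz0.
pose P z := \prod_(q <- L) (z - q).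
have PL z : z \in L -> P z = 0.
  by move=> zL; rewrite /P (big_rem z) //= subrr mul0r.
have Pn0 z : z \notin L -> P z != 0.
  move=> zL; rewrite /P prodf_seq_neq0; apply/allP => q qL /=.
  by rewrite subr_eq0; apply: contraNneq zL => ->.
have PC z : derivable2 P z.
  by apply: derivable2_prod => q; apply: derivable2_sub; [exact: derivable2_id | exact: derivable2_cst].
pose D := \prod_(q <- L) (2 * r + cabs (p - q)).
have PD z : in_square p r z -> cabs (P z) <= D.
  move=> /square_cabs zQ; rewrite cabs_prod; apply: ler_prod => q _.
  rewrite cabs_ge0 /= (_ : z - q = (z - p) + (p - q)); last by rewrite addrA subrK.
  by apply: (le_trans (cabsD _ _)); rewrite lerD2r.
have x1 : 1 < cabs (f z0) / M by rewrite ltr_pdivlMr // mul1r.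
have c0 : 0 < cabs (P z0) by rewrite cabs_gt0 Pn0.
(* If [|f z0| > M] then the powers of [|f z0| / M] exceed [D / |P z0|]. *)
have [N] := bernoulli_unbounded (D / cabs (P z0)) x1.
apply/negP; rewrite -leNgt expr_div_n ler_pdivrMr ?exprn_gt0 //.
rewrite mulrAC ler_pdivlMr //.
have -> : cabs (f z0) ^+ N * cabs (P z0) = cabs (f z0 ^+ N * P z0).
  by rewrite cabsM cabsX.
have D0 : 0 <= D by apply: le_trans (PD _ z0Q); exact: cabs_ge0.
apply: (@max_principle (fun z => f z ^+ N * P z) p r) => //.
- by rewrite mulr_ge0 // exprn_ge0 // ltW.
- move=> z zQ; have [zL|zL] := boolP (z \in L); last first.
    by apply: derivable2_continuous_at; apply: derivable2_mul => //; apply: derivable2_exp; exact: fC.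
  have [K HK] := fb z zQ zL; move=> e e0.
  have K0 : 0 < `|K| ^+ N + 1 by rewrite ltr_wpDl ?exprn_ge0.
  have HP := derivable2_continuous_at (PC z) (divr_gt0 e0 K0).
  apply: filterS2 HK HP => w HK; rewrite (PL _ zL) !subr0 mulr0 subr0 => HP.
  have [wL|wL] := boolP (w \in L); first by rewrite PL // mulr0 cabs0.
  rewrite cabsM cabsX; move: HP; rewrite ltr_pdivlMr // mulrC => HP.
  apply: le_lt_trans HP; rewrite ler_wpM2r ?cabs_ge0 //.
  apply: (@le_trans _ _ (`|K| ^+ N)); last by rewrite lerDl.
  by rewrite lerXn2r ?nnegrE ?cabs_ge0 //; exact: le_trans (HK wL) (ler_norm _).
- move=> z h1 h2 nz; apply: derivable2_mul => //; apply: derivable2_exp; apply: fC.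
    by split; exact: ltW.
  by apply: contraNN nz => zL; rewrite PL // mulr0.
- move=> z zQ zb; have [zL|zL] := boolP (z \in L).
    by rewrite PL // mulr0 cabs0 mulr_ge0 // exprn_ge0 // ltW.
  rewrite cabsM cabsX mulrC; apply: ler_pM; rewrite ?exprn_ge0 ?cabs_ge0 ?PD //.
  by rewrite lerXn2r ?nnegrE ?cabs_ge0 ?(ltW M0) // fM.
Qed.

End MaxPrinciple.

(** * Liouville's theorem and the identity theorem *)

Section Liouville.
Variable R : realType.
Local Notation C := (cplx R).
Implicit Types (f g : C -> C) (z w a b d p : C) (B : set C).

Definition locally_finite B : Prop := forall p (r : R),
  exists L : seq C, forall z, in_square p r z -> B z -> z \in L.

(** The singular points themselves are excluded: values there are conventional. *)
Definition bounded_near B f z : Prop := exists K : R,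
  \forall w \near z, ~ B w -> cabs (f w) <= K.

Lemma cabs_square p r z : cabs (z - p) <= r -> in_square p r z.
Proof.
by move=> h; split; apply: le_trans h; [exact: cabs_Re|exact: cabs_Im].
Qed.

Lemma square_near p r z : 0 < r -> in_square p r z ->
  \forall w \near z, in_square p (2 * r) w.
Proof.
move=> r0 [h1 h2]; apply/nearCP; exists r => // w wz.
have h3 := cabs_Re (w - z); have h4 := cabs_Im (w - z).
rewrite /in_square (_ : w - p = (w - z) + (z - p)); last by rewrite addrA subrK.
rewrite ReD ImD; split; apply: (le_trans (ler_normD _ _)); lra.
Qed.

Lemma bounded_near_square B f p r :
  (forall z, in_square p r z -> bounded_near B f z) ->
  exists K : R, forall z, in_square p r z -> ~ B z -> cabs (f z) <= K.
Proof.
move=> H.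
pose plane_map (x : R * R) : C := p + (toC x.1 + 'i%C * toC x.2).
pose A : set (R * R) := `[- r, r] `*` `[- r, r].
have gamc x : forall e : R, 0 < e -> \forall y \near x, cabs (plane_map y - plane_map x) < e.
  exact: plane_map_continuous.
have cA : compact A by apply: compact_setX; apply: segment_compact.
move/compact_near_coveringP : cA => cA.
have := cA R (pinfty_nbhs R) (fun K x => ~ B (plane_map x) -> cabs (f (plane_map x)) <= K) _ _.
case.
  move=> x xA; have [K HK] := H (plane_map x) ((plane_map_square _ _ _).1 xA); have [d d0 Hd] := (nearCP _ _).1 HK.
  exists ([set y | cabs (plane_map y - plane_map x) < d], [set K' | K <= K']).
    split => /=; first exact: gamc.
    by exists K; split; [exact: num_real | move=> y /ltW].
  by move=> [y K'] /= [/Hd h1 h2] /h1 /le_trans; apply.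
move=> K [_ HK]; exists (K + 1) => z zQ Bz.
have zE : z = plane_map (complex.Re (z - p), complex.Im (z - p)).
  by rewrite /plane_map /= -complexE2 addrC subrK.
rewrite zE; apply: HK; rewrite -?zE //; first lra.
by case: zQ => h1 h2; rewrite /A /= !in_itv /= -!ler_norml.
Qed.

(** Schwarz's lemma: on the boundary of the square [|z - p| >= r], so the
    quotient [f / (z - p)^n] is at most [K / r^n] there, hence inside as well. *)
Lemma schwarz_bound B f p (r K : R) n : locally_finite B -> 0 < r -> 0 < K ->
  (forall z, ~ B z -> derivable2 f z) -> (forall z, in_square p r z -> bounded_near B f z) ->
  (forall z, in_square p r z -> ~ B z -> cabs (f z) <= K) ->
  bounded_near [set w | B w \/ w = p] (fun w => f w / (w - p) ^+ n) p ->
  forall z, in_square p r z -> ~ B z -> z != p ->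
  cabs (f z) <= K * (cabs (z - p) / r) ^+ n.
Proof.
move=> lf r0 K0 fC fb fK fp z zQ Bz zp.
have [L0 HL0] := lf p (2 * r).
pose L := [seq q <- p :: L0 | `[< B q \/ q = p >] ].
have Lin w : w \in L -> B w \/ w = p.
  by rewrite mem_filter => /andP[/asboolP].
have notL w : in_square p (2 * r) w -> w \notin L -> ~ B w /\ w != p.
  move=> wQ wL; split.
    move=> Bw; move: wL; rewrite mem_filter inE HL0 // orbT andbT => /asboolP; apply.
    by left.
  apply: contraNneq wL => ->; rewrite mem_filter inE eqxx /= andbT.
  by apply/asboolP; right.
have sub w : in_square p r w -> in_square p (2 * r) w.
  by move=> [h1 h2]; split; lra.
have zL : z \notin L by apply/negP => /Lin[//|/eqP]; rewrite (negbTE zp).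
have zp0 : 0 < cabs (z - p) by rewrite cabs_gt0 subr_eq0.
suff : cabs (f z / (z - p) ^+ n) <= K / r ^+ n.
  rewrite cabs_div cabsX ler_pdivrMr ?exprn_gt0 // => /le_trans; apply.
  by rewrite expr_div_n mulrA mulrAC.
apply: (@max_principle_punctured _ (fun z => f z / (z - p) ^+ n) p r _ L) => //.
- by rewrite divr_gt0 ?exprn_gt0.
- move=> w wQ wL; have [Bw wp] := notL w (sub _ wQ) wL.
  apply: derivable2_mul; first exact: fC.
  apply: derivable2_inv; first by rewrite expf_neq0 // subr_eq0.
  by apply: derivable2_exp; apply: derivable2_sub; [exact: derivable2_id | exact: derivable2_cst].
- move=> w wQ _; have [->|wp] := eqVneq w p.
    have [K' HK'] := fp; exists K'.
    have pQ : in_square p r p by apply: cabs_square; rewrite subrr cabs0 ltW.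
    apply: filterS2 HK' (square_near r0 pQ) => x hx xQ xL; apply: hx.
    by have [h1 /eqP h2] := notL x xQ xL; case.
  have [K' HK'] := fb w wQ.
  exists (`|K'| / (cabs (w - p) / 2) ^+ n).
  have wp0 : 0 < cabs (w - p) by rewrite cabs_gt0 subr_eq0.
  have hw : \forall x \near w, cabs (w - p) / 2 <= cabs (x - p).
    apply/nearCP; exists (cabs (w - p) / 2); first lra.
    move=> x xw; have := cabsD (w - x) (x - p); rewrite addrA subrK cabsC; lra.
  apply: filterS3 HK' (square_near r0 wQ) hw => x h1 xQ hx xL.
  have [Bx xp] := notL x xQ xL; rewrite cabs_div cabsX.
  apply: ler_pM; rewrite ?invr_ge0 ?exprn_ge0 ?cabs_ge0 //.
    by apply: le_trans (h1 Bx) _; exact: ler_norm.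
  rewrite lef_pV2 ?posrE ?exprn_gt0 //; first last.
  - lra.
  - by apply: lt_le_trans hx; lra.
  by rewrite lerXn2r ?nnegrE ?cabs_ge0 //; lra.
- move=> w wQ wL wb; have [Bw wp] := notL w (sub _ wQ) wL.
  have rw : r <= cabs (w - p).
    by case: wb => <-; [exact: cabs_Re | exact: cabs_Im].
  rewrite cabs_div cabsX; apply: ler_pM; rewrite ?invr_ge0 ?exprn_ge0 ?cabs_ge0 //.
    exact: fK.
  rewrite lef_pV2 ?posrE ?exprn_gt0 //; last exact: lt_le_trans rw.
  by rewrite lerXn2r ?nnegrE ?cabs_ge0 // ltW.
Qed.

(** Schwarz's bound for [f - f p] with [n = 1] is [O(1/r)], and [r] is arbitrary. *)
Theorem liouville B f (K : R) : locally_finite B ->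
  (forall z, ~ B z -> derivable2 f z) -> (forall z, ~ B z -> cabs (f z) <= K) ->
  forall z w, ~ B z -> ~ B w -> f z = f w.
Proof.
move=> lf fC fK p w Bp Bw; have [->//|wp] := eqVneq w p.
have K0 : 0 <= K by apply: le_trans (fK _ Bp); exact: cabs_ge0.
pose g z := f z - f p.
have gK z : ~ B z -> cabs (g z) <= 2 * K + 1.
  by move=> Bz; have := cabsB (f z) (f p); have := fK _ Bz; have := fK _ Bp; rewrite /g; lra.
have wp0 : 0 < cabs (w - p) by rewrite cabs_gt0 subr_eq0.
suff H : forall e : R, 0 < e -> cabs (g w) <= e.
  apply/eqP; rewrite eq_sym -subr_eq0 -cabs_eq0 eq_le cabs_ge0 andbT.
  by apply/ler_addgt0Pr => e /H; rewrite add0r.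
move=> e e0.
(* Chosen so that [(2 K + 1) |w - p| / r <= e]. *)
pose r := cabs (w - p) * (1 + (2 * K + 1) / e).
have q0 : 0 < (2 * K + 1) / e by rewrite divr_gt0 //; lra.
have r0 : 0 < r by rewrite mulr_gt0 //; lra.
have wr : cabs (w - p) <= r by rewrite /r ler_peMr ?(ltW wp0) //; lra.
have K1 : 0 < 2 * K + 1 by lra.
have := @schwarz_bound B g p r (2 * K + 1) 1 lf r0 K1 _ _ _ _ w (cabs_square wr) Bw wp.
move=> /(_ _ _ _ _)/le_trans; apply.
- by move=> z Bz; apply: derivable2_sub; [exact: fC | exact: derivable2_cst].
- by move=> z _; exists (2 * K + 1); apply: near_all => x; exact: gK.
- by move=> z _; exact: gK.
- have [d hd] := derivable2_isD (fC _ Bp).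
  have [s s0 Hs] := (isDP _ _ _).1 hd 1 ltr01.
  exists (cabs d + 1); apply/nearCP; exists s => // x xs nB.
  have xp : x != p by apply/eqP => E; apply: nB; right.
  have := Hs _ xs; rewrite [p + _]addrC subrK mul1r expr1 => h.
  rewrite cabs_div ler_pdivrMr ?cabs_gt0 ?subr_eq0 // mulrDl mul1r -cabsM.
  rewrite /g (_ : f x - f p = (f x - f p - d * (x - p)) + d * (x - p)); last by rewrite subrK.
  by apply: (le_trans (cabsD _ _)); rewrite addrC lerD2l.
have X0 : 0 < 1 + (2 * K + 1) / e by lra.
have -> : cabs (w - p) / r = (1 + (2 * K + 1) / e)^-1.
  by rewrite /r invfM mulrA divff ?mul1r // gt_eqF.
rewrite expr1 ler_pdivrMr // mulrDr mulr1 [e * (_ / _)]mulrC divfK ?gt_eqF //; lra.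
Qed.

(** A function that vanishes near [p] can be divided by any power of [z - p], so
    Schwarz's bound gives [|f z| <= K 2^-n] for all [n]. *)
Theorem identity_theorem B f p (r : R) : locally_finite B -> 0 < r ->
  (forall z, ~ B z -> derivable2 f z) -> (forall z, in_square p r z -> bounded_near B f z) ->
  (\forall w \near p, ~ B w -> f w = 0) ->
  forall z, cabs (z - p) <= r / 2 -> ~ B z -> f z = 0.
Proof.
move=> lf r0 fC fb f0 z zr Bz.
have [zp|zp] := eqVneq z p; first by move: Bz; rewrite zp; exact: near_here f0.
have [K HK] := @bounded_near_square B f p r fb.
have K1 : 0 < `|K| + 1 by rewrite ltr_wpDl.
have main n : cabs (f z) <= (`|K| + 1) * (1 / 2) ^+ n.
  apply: (@le_trans _ _ ((`|K| + 1) * (cabs (z - p) / r) ^+ n)).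
    apply: (@schwarz_bound B f p r) => //.
    - by move=> w wQ /(HK w wQ) h; have := ler_norm K; lra.
    - exists 0; apply: filterS f0 => w hw nB; rewrite hw ?mul0r ?cabs0 //.
      by move=> Bw; apply: nB; left.
    - by apply: cabs_square; lra.
  rewrite ler_pM2l // lerXn2r ?nnegrE ?divr_ge0 ?cabs_ge0 ?(ltW r0) //.
  rewrite ler_pdivrMr //; lra.
apply/eqP; rewrite -cabs_eq0; apply/negPn/negP => fz.
have fz0 : 0 < cabs (f z) by rewrite lt_def fz cabs_ge0.
have [N] := @bernoulli_unbounded _ 2 ((`|K| + 1) / cabs (f z)) (ltac:(lra)).
apply/negP; rewrite -leNgt ler_pdivlMr //.
by have := main N; rewrite mul1r exprVn ler_pdivlMr ?exprn_gt0 // mulrC.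
Qed.

End Liouville.

(** * Dominated unordered sums *)

Local Open Scope fset_scope.
Local Open Scope ring_scope.

Section NetSum.
Variables (R : realType) (I : choiceType).
Local Notation C := (cplx R).
Variables (weight : I -> R) (W : R).
Hypothesis wt0 : forall i, 0 < weight i.
Hypothesis wtW : forall J : {fset I}, \sum_(i <- J) weight i <= W.

Definition dominated (u : I -> C) : Prop := exists K : R, forall i, cabs (u i) <= K * weight i.

Definition unordered_sum (T : I -> C) (l : C) : Prop :=
  forall e : R, 0 < e -> exists A0 : {fset I}, forall A : {fset I}, A0 `<=` A ->
    cabs (\sum_(i <- A) T i - l) < e.

(** Sums of weights over finite sets away from [A] are at most [e]. *)
Definition small_tail (A : {fset I}) (e : R) : Prop :=
  forall B : {fset I}, [disjoint A & B] -> \sum_(i <- B) weight i <= e.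

Lemma fset_sum_split (V : nmodType) (A B : {fset I}) (v : I -> V) : A `<=` B ->
  \sum_(i <- B) v i = \sum_(i <- A) v i + \sum_(i <- B `\` A) v i.
Proof.
move=> AB; rewrite (big_fsetID _ (mem A) B); congr (_ + _); apply: eq_fbigl => i.
  rewrite !inE /=; apply/andP/idP => [[]//|iA]; split => //.
  exact: (fsubsetP AB).
by rewrite !inE /= andbC.
Qed.

Lemma nonneg_unordered_sum (v : I -> R) (K : R) : (forall i, 0 <= v i) ->
  (forall J : {fset I}, \sum_(i <- J) v i <= K) ->
  exists l : R, (forall J : {fset I}, \sum_(i <- J) v i <= l) /\
   forall e : R, 0 < e -> exists A0 : {fset I}, forall A : {fset I}, A0 `<=` A ->
    l - e < \sum_(i <- A) v i.
Proof.
move=> v0 vK; pose S := [set x | exists J : {fset I}, x = \sum_(i <- J) v i].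
have hS : has_sup S.
  split; first by exists (\sum_(i <- fset0) v i), fset0.
  by exists K => _ [J ->].
exists (sup S); split.
  by move=> J; apply: sup_upper_bound => //; exists J.
move=> e e0; have [_ [A0 ->] h] := sup_adherent e0 hS; exists A0 => A AA.
apply: lt_le_trans h _; rewrite (fset_sum_split _ AA) lerDl.
by apply: sumr_ge0.
Qed.

Lemma small_tail_ex (e : R) : 0 < e -> exists A, small_tail A e.
Proof.
move=> e0; have [l [lub H]] := nonneg_unordered_sum (fun i => ltW (wt0 i)) wtW.
have [A HA] := H e e0; exists A => B dB.
have := lub (A `|` B); rewrite (fset_sum_split _ (fsubsetUl A B)).
have -> : (A `|` B) `\` A = B.
  apply/fsetP => i; rewrite !inE; case: (boolP (i \in A)) => //= iA.
  by apply/esym/negbTE; move/fdisjointP : dB; apply.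
have := HA A (fsubset_refl A); lra.
Qed.

Lemma small_tail_sub A A' e : A `<=` A' -> small_tail A e -> small_tail A' e.
Proof. by move=> AA h B dB; apply: h; exact: fdisjointWl dB. Qed.

(** Real and imaginary parts are differences of the nonnegative families
    [K * weight + v] and [K * weight], whose unordered sums are suprema. *)
Lemma dominated_unordered_sum u : dominated u -> exists l, unordered_sum u l.
Proof.
move=> [K HK].
have key (v : I -> R) : (forall i, `|v i| <= K * weight i) -> exists l : R,
    forall e : R, 0 < e -> exists A0 : {fset I}, forall A : {fset I}, A0 `<=` A ->
    `|\sum_(i <- A) v i - l| < e.
  move=> Hv.
  have K0 i : 0 <= K * weight i by apply: le_trans (Hv i).
  have KW (J : {fset I}) : \sum_(i <- J) K * weight i <= `|K| * W.
    rewrite -mulr_sumr; apply: (@le_trans _ _ (`|K| * \sum_(i <- J) weight i)).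
      rewrite ler_wpM2r ?ler_norm //; apply: sumr_ge0 => i _; exact: ltW.
    by rewrite ler_wpM2l.
  have v1 i : 0 <= K * weight i + v i by have := Hv i; rewrite ler_norml; lra.
  have [l1 [ub1 H1]] := nonneg_unordered_sum K0 KW.
  have [|l2 [ub2 H2]] := @nonneg_unordered_sum (fun i => K * weight i + v i) (2 * (`|K| * W)) v1.
    move=> J; rewrite big_split /=.
    apply: (@le_trans _ _ (\sum_(i <- J) K * weight i + \sum_(i <- J) K * weight i)).
      rewrite lerD2l; apply: ler_sum => i _; apply: le_trans (Hv i); exact: ler_norm.
    by have := KW J; lra.
  exists (l2 - l1) => e e0.
  have [A1 HA1] := H1 e e0; have [A2 HA2] := H2 e e0.
  exists (A1 `|` A2) => A; rewrite fsubUset => /andP[/HA1 h1 /HA2].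
  rewrite big_split /= => h2.
  have := ub1 A; have := ub2 A; rewrite big_split /= ltr_norml.
  by move=> h3 h4; apply/andP; split; lra.
have [|l1 H1] := key (fun i => complex.Re (u i)).
  by move=> i; apply: le_trans (HK i); exact: cabs_Re.
have [|l2 H2] := key (fun i => complex.Im (u i)).
  by move=> i; apply: le_trans (HK i); exact: cabs_Im.
exists (toC l1 + 'i%C * toC l2) => e e0.
have e2 : 0 < e / 2 by lra.
have [A1 HA1] := H1 _ e2; have [A2 HA2] := H2 _ e2.
exists (A1 `|` A2) => A; rewrite fsubUset => /andP[/HA1 h1 /HA2 h2].
apply: le_lt_trans (cabs_ReIm _) _.
have ReS : complex.Re (\sum_(i <- A) u i) = \sum_(i <- A) complex.Re (u i).
  exact: (big_morph _ (@ReD R) erefl).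
have ImS : complex.Im (\sum_(i <- A) u i) = \sum_(i <- A) complex.Im (u i).
  exact: (big_morph _ (@ImD R) erefl).
rewrite ReD ReN ImD ImN Re_toC Im_toC ReS ImS; lra.
Qed.

Lemma unordered_sumE u l : unordered_sum u l -> summability.sum u = l.
Proof.
move=> H; apply: cvg_lim => //; first exact: summability.totally_filter.
have TF : Filter (@summability.totally I).
  by have [] := summability.totally_filter (I := I).
apply/cvgCP => e e0; have [A0 HA0] := H e e0; exists A0 => // A /= AA.
by rewrite /summability.partial_sum -(big_seq_fsetE _ A xpredT u); exact: HA0.
Qed.


Lemma dominated_sumP u : dominated u -> unordered_sum u (summability.sum u).
Proof. by move=> /dominated_unordered_sum [l hl]; rewrite (unordered_sumE hl). Qed.

Lemma dominated_add u v : dominated u -> dominated v -> dominated (fun i => u i + v i).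
Proof.
move=> [K HK] [L HL]; exists (K + L) => i; apply: (le_trans (cabsD _ _)).
by rewrite mulrDl lerD.
Qed.
Lemma dominated_scale a u : dominated u -> dominated (fun i => a * u i).
Proof.
move=> [K HK]; exists (cabs a * K) => i; rewrite cabsM -mulrA.
by rewrite ler_wpM2l ?cabs_ge0.
Qed.
Lemma dominated_cofinite u : (exists (K : R) (A : {fset I}), forall i, i \notin A ->
   cabs (u i) <= K * weight i) -> dominated u.
Proof.
move=> [K [A HA]]; exists (`|K| + \sum_(j <- A) cabs (u j) / weight j) => i.
have s0 (B : {fset I}) : 0 <= \sum_(j <- B) cabs (u j) / weight j.
  by apply: sumr_ge0 => j _; rewrite divr_ge0 ?cabs_ge0 // ltW.
have [iA|iA] := boolP (i \in A).
  rewrite (big_fsetD1 i iA) /= mulrDl mulrDl divfK ?gt_eqF //.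
  rewrite addrCA lerDl addr_ge0 // mulr_ge0 //; exact: ltW.
apply: (le_trans (HA i iA)); rewrite ler_wpM2r ?(ltW (wt0 i)) //.
by apply: (le_trans (ler_norm K)); rewrite lerDl.
Qed.

Local Notation S := (@summability.sum I _ (C : normedModType C)).

Lemma usum_add u v : dominated u -> dominated v -> S (fun i => u i + v i) = S u + S v.
Proof.
move=> param_u hv; apply: unordered_sumE => e e0; have e2 : 0 < e / 2 by lra.
have [A HA] := dominated_sumP param_u e2; have [B HB] := dominated_sumP hv e2.
exists (A `|` B) => D; rewrite fsubUset => /andP[/HA h1 /HB h2].
rewrite big_split /= opprD addrACA; apply: le_lt_trans (cabsD _ _) _; lra.
Qed.
Lemma usum_scale a u : dominated u -> S (fun i => a * u i) = a * S u.
Proof.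
move=> param_u; apply: unordered_sumE => e e0.
have a1 : 0 < cabs a + 1 by rewrite ltr_wpDl ?cabs_ge0.
have [A HA] := dominated_sumP param_u (divr_gt0 e0 a1).
exists A => D /HA; rewrite ltr_pdivlMr // -mulr_sumr -mulrBr cabsM => h.
apply: le_lt_trans h; rewrite mulrC ler_wpM2l ?cabs_ge0 //; lra.
Qed.
Lemma usum_opp u : dominated u -> S (fun i => - u i) = - S u.
Proof.
move=> param_u; rewrite -mulN1r -usum_scale //; congr (S _).
by apply/funext => i; rewrite mulN1r.
Qed.
Lemma dominated_opp u : dominated u -> dominated (fun i => - u i).
Proof. by move=> [K HK]; exists K => i; rewrite cabsN. Qed.
Lemma usum_reindex (s s' : I -> I) u : cancel s s' -> cancel s' s -> dominated u ->
  S (fun i => u (s i)) = S u.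
Proof.
move=> ss' s's param_u; apply: unordered_sumE => e e0; have [A HA] := dominated_sumP param_u e0.
exists [fset s' i | i in A] => D AD.
have := HA [fset s i | i in D] _; rewrite big_imfset /=; last first.
  by move=> x y _ _; exact: can_inj ss' _ _.
apply; apply/fsubsetP => i iA; apply/imfsetP; exists (s' i); rewrite ?s's //.
by apply: (fsubsetP AD); apply/imfsetP; exists i.
Qed.
Lemma usum_tail u (A : {fset I}) (K e : R) : dominated u -> 0 <= K ->
  (forall i, i \notin A -> cabs (u i) <= K * weight i) -> small_tail A e ->
  cabs (S u - \sum_(i <- A) u i) <= K * e.
Proof.
move=> param_u K0 HK sA; apply/ler_addgt0Pr => d d0.
have [B HB] := dominated_sumP param_u d0; have := HB (A `|` B) (fsubsetUr _ _).
rewrite (fset_sum_split _ (fsubsetUl A B)); set D := _ `\` _.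
have DA i : i \in D -> i \notin A by rewrite inE => /andP[].
have sD : cabs (\sum_(i <- D) u i) <= K * e.
  apply: le_trans (cabs_sum _ _ _) _.
  apply: (@le_trans _ _ (\sum_(i <- D) K * weight i)).
    rewrite big_seq [leRHS]big_seq; apply: ler_sum => i /DA; exact: HK.
  rewrite -mulr_sumr ler_wpM2l //; apply: sA; rewrite fdisjoint_sym.
  by apply/fdisjointP.
set X := \sum_(i <- A) _; set Y := \sum_(i <- D) _ in sD * => h.
have -> : S u - X = - (X + Y - S u) + Y by ring.
by apply: (le_trans (cabsD _ _)); rewrite cabsN; lra.
Qed.

(** Differentiation of a dominated sum.  Finitely many terms, those in [A0], only
    need a derivative at [t0]; for the others the mean value bound controls the
    difference quotients by the weights, so their tail is negligible. *)
Lemma isD_usum (F F' : I -> C -> C) t0 (A0 : {fset I}) (K r : R) : 0 < r ->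
  (forall i, isD (F i) t0 (F' i t0)) ->
  (forall i t, i \notin A0 -> cabs (t - t0) < r -> isD (F i) t (F' i t)) ->
  (forall i t, i \notin A0 -> cabs (t - t0) < r -> cabs (F' i t) <= K * weight i) ->
  dominated (fun i => F i t0) ->
  [/\ dominated (fun i => F' i t0),
      (forall t, cabs (t - t0) < r -> dominated (fun i => F i t)) &
      isD (fun t => S (fun i => F i t)) t0 (S (fun i => F' i t0))].
Proof.
move=> r0 H1 H2 H3 H4.
have inc i t : i \notin A0 -> cabs (t - t0) < r ->
    cabs (F i t - F i t0) <= `|K| * weight i * cabs (t - t0).
  move=> iA tr.
  have seg (x : R) : 0 <= x <= 1 -> cabs (t0 + toC x * (t - t0) - t0) < r.
    move=> /andP[x0 x1]; rewrite addrAC subrr add0r cabsM cabs_toC ger0_norm //.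
    by apply: le_lt_trans tr; rewrite ler_piMl ?cabs_ge0.
  apply: (@mean_value_bound _ _ (F' i)) => x /seg xr; first exact: H2.
  apply: (le_trans (H3 _ _ iA xr)); rewrite ler_wpM2r ?ler_norm //; exact: ltW.
have t0r : cabs (t0 - t0) < r by rewrite subrr cabs0.
have d1 : dominated (fun i => F' i t0).
  by apply: dominated_cofinite; exists K, A0 => i iA; exact: H3.
have d2 t : cabs (t - t0) < r -> dominated (fun i => F i t).
  move=> tr; have -> : (fun i => F i t) = (fun i => F i t0 + (F i t - F i t0)).
    by apply/funext => i; rewrite addrC subrK.
  apply: dominated_add => //; apply: dominated_cofinite; exists (`|K| * r), A0 => i iA.
  apply: (le_trans (inc i t iA tr)); rewrite mulrAC ler_wpM2r ?(ltW (wt0 i)) //.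
  by rewrite ler_wpM2l // ltW.
split => //; apply/isDP => e e0.
have K1 : 0 < 4 * `|K| + 1 by rewrite ltr_wpDl // mulr_ge0.
(* A tail of weight [e / (4 |K| + 1)] contributes at most half of [e |h|]. *)
have [A1 sA1] := small_tail_ex (divr_gt0 e0 K1).
pose A := A0 `|` A1.
have sA := small_tail_sub (fsubsetUr A0 A1) sA1 : small_tail A _.
have AA0 i : i \notin A -> i \notin A0 by rewrite inE negb_or => /andP[].
have hfin : isD (fun t => \sum_(i <- A) F i t) t0 (\sum_(i <- A) F' i t0).
  by apply: isD_sum.
have e2 : 0 < e / 2 by lra.
have [s s0 Hs] := (isDP _ _ _).1 hfin _ e2.
exists (Num.min r s); first by rewrite lt_min r0 s0.
move=> h; rewrite lt_min => /andP[hr hs].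
have thr : cabs (t0 + h - t0) < r by rewrite addrAC subrr add0r.
(* The remainder of the first order expansion, term by term. *)
pose u i := F i (t0 + h) + (- F i t0 + - h * F' i t0).
have du2 : dominated (fun i => - F i t0 + - h * F' i t0).
  by apply: dominated_add; [exact: dominated_opp | exact: dominated_scale].
have du : dominated u by apply: dominated_add => //; exact: d2.
have Su : S u = S (fun i => F i (t0 + h)) - S (fun i => F i t0) - S (fun i => F' i t0) * h.
  rewrite usum_add //; last exact: d2.
  rewrite usum_add //; [|exact: dominated_opp |exact: dominated_scale].
  by rewrite usum_opp // usum_scale //; ring.
rewrite -Su.
have uA : \sum_(i <- A) u i = \sum_(i <- A) F i (t0 + h) - \sum_(i <- A) F i t0
    - (\sum_(i <- A) F' i t0) * h.
  by rewrite /u !big_split /= sumrN -mulr_sumr; ring.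
have h1 := Hs h hs; rewrite -uA in h1.
have tl := @usum_tail u A (2 * `|K| * cabs h) _ du _ _ sA.
have {}tl : cabs (S u - \sum_(i <- A) u i) <= 2 * `|K| * cabs h * (e / (4 * `|K| + 1)).
  apply: tl; first by rewrite !mulr_ge0 ?cabs_ge0.
  move=> i /AA0 iA; have := inc i (t0 + h) iA thr; have := H3 i t0 iA t0r.
  rewrite [t0 + h - t0]addrAC subrr add0r => h3 h4.
  rewrite /u addrA; apply: le_trans (cabsD _ _) _; rewrite cabsM cabsN.
  have : cabs h * cabs (F' i t0) <= cabs h * (`|K| * weight i).
    rewrite ler_wpM2l ?cabs_ge0 //; apply: (le_trans h3).
    by rewrite ler_wpM2r ?ler_norm //; exact: ltW.
  lra.
have : 2 * `|K| * cabs h * (e / (4 * `|K| + 1)) <= e / 2 * cabs h.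
  have -> : 2 * `|K| * cabs h * (e / (4 * `|K| + 1)) = e / 2 * cabs h * (4 * `|K| / (4 * `|K| + 1)).
    by field; rewrite gt_eqF.
  apply: ler_piMr; first by rewrite mulr_ge0 ?cabs_ge0 // ltW.
  by rewrite ler_pdivrMr // mul1r lerDl.
move=> h5; have := cabsD (S u - \sum_(i <- A) u i) (\sum_(i <- A) u i).
rewrite subrK; lra.
Qed.

End NetSum.


(** * Lattice sums with cubic decay *)

Section Lattice.
Variable R : realType.
Local Notation C := (cplx R).
Implicit Types (z w x tau : C) (p : int * int).

(** A norm on the index lattice that is at least 1, so that its inverse powers make
    sense at the origin. *)
Definition height p : R := (1 + absz p.1 + absz p.2)%N%:R.
Definition weight p : R := (height p ^+ 3)^-1.

Lemma height_ge1 p : 1 <= height p.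
Proof. by rewrite /height ler1n. Qed.
Lemma height_gt0 p : 0 < height p.
Proof. by apply: lt_le_trans (height_ge1 p). Qed.
Lemma weight_gt0 p : 0 < weight p.
Proof. by rewrite invr_gt0 exprn_gt0 // height_gt0. Qed.

Lemma sum_inv_cube (s : R) n : 1 <= s ->
  \sum_(0 <= b < n) ((s + b%:R) ^+ 3)^-1 <= 4 / 3 * ((s ^+ 2)^-1 - ((s + n%:R) ^+ 2)^-1).
Proof.
move=> s1; elim: n => [|n IH]; first by rewrite big_geq // addr0 subrr mulr0.
rewrite big_nat_recr //= ; set x := s + n%:R in IH *.
have x1 : 1 <= x by rewrite /x; have := ler0n R n; lra.
have -> : s + n.+1%:R = x + 1 by rewrite /x -natr1 addrA.
have : (x ^+ 3)^-1 <= 4 / 3 * ((x ^+ 2)^-1 - ((x + 1) ^+ 2)^-1).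
  have -> : (x ^+ 2)^-1 - ((x + 1) ^+ 2)^-1 = (x ^+ 3)^-1 * ((2 * x + 1) * x / (x + 1) ^+ 2).
    by field; lra.
  have x3 : 0 < (x ^+ 3)^-1 by rewrite invr_gt0 exprn_gt0 //; lra.
  have h : 1 <= 4 / 3 * ((2 * x + 1) * x / (x + 1) ^+ 2).
    rewrite mulrA ler_pdivlMr; last by rewrite exprn_gt0 //; lra.
    by have : 0 <= (x - 1) * (5 * x + 3); [apply: mulr_ge0; lra | lra].
  by have := ler_wpM2l (ltW x3) h; lra.
lra.
Qed.

Lemma sum_inv_square n : \sum_(0 <= a < n) ((1 + a%:R : R) ^+ 2)^-1 <= 2 * (1 - (1 + n%:R)^-1).
Proof.
elim: n => [|n IH]; first by rewrite big_geq // addr0 invr1 subrr mulr0.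
rewrite big_nat_recr //=; set x := 1 + n%:R in IH *.
have x1 : 1 <= x by rewrite /x; have := ler0n R n; lra.
have -> : 1 + n.+1%:R = x + 1 by rewrite /x -natr1; ring.
have : (x ^+ 2)^-1 <= 2 * (x^-1 - (x + 1)^-1).
  have -> : x^-1 - (x + 1)^-1 = (x ^+ 2)^-1 * (x / (x + 1)) by field; lra.
  have x3 : 0 < (x ^+ 2)^-1 by rewrite invr_gt0 exprn_gt0 //; lra.
  have h : 1 <= 2 * (x / (x + 1)) by rewrite mulrA ler_pdivlMr; lra.
  by have := ler_wpM2l (ltW x3) h; lra.
lra.
Qed.

Lemma double_sum_bound n :
  \sum_(0 <= a < n) \sum_(0 <= b < n) (((1 + a + b)%N%:R : R) ^+ 3)^-1 <= 3.
Proof.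
apply: (@le_trans _ _ (\sum_(0 <= a < n) 4 / 3 * ((1 + a%:R : R) ^+ 2)^-1)).
  apply: ler_sum => a _.
  have s1 : 1 <= 1 + a%:R :> R by have := ler0n R a; lra.
  under eq_bigr => b _ do rewrite !natrD.
  have := sum_inv_cube n s1.
  have : 0 <= ((1 + a%:R + n%:R : R) ^+ 2)^-1 by rewrite invr_ge0 sqr_ge0.
  lra.
rewrite -mulr_sumr; have := sum_inv_square n.
have : 0 <= (1 + n%:R : R)^-1 by rewrite invr_ge0; have := ler0n R n; lra.
lra.
Qed.

Definition signed_pair n (t : ('I_n * bool) * ('I_n * bool)) : int * int :=
  ((if t.1.2 then Posz t.1.1 else - Posz t.1.1), (if t.2.2 then Posz t.2.1 else - Posz t.2.1)).

Lemma height_signed_pair n t : height (@signed_pair n t) = (1 + t.1.1 + t.2.1)%N%:R.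
Proof. by case: t => [[a []] [b []]]; rewrite /height /signed_pair /= ?abszN. Qed.

Lemma weight_box_sum n :
  \sum_(t : ('I_n * bool) * ('I_n * bool)) weight (signed_pair t) <= 12.
Proof.
have -> : \sum_(t : ('I_n * bool) * ('I_n * bool)) weight (signed_pair t) =
  4 * \sum_(0 <= a < n) \sum_(0 <= b < n) (((1 + a + b)%N%:R : R) ^+ 3)^-1.
  pose g (a b : nat) : R := ((1 + a + b)%N%:R ^+ 3)^-1.
  transitivity (\sum_(t : ('I_n * bool) * ('I_n * bool)) g t.1.1 t.2.1).
    by apply: eq_bigr => t _; rewrite /weight height_signed_pair.
  rewrite -(pair_bigA _ (fun x y : 'I_n * bool => g x.1 y.1)) /=.
  rewrite -(pair_bigA _ (fun (a : 'I_n) (s : bool) => \sum_(y : 'I_n * bool) g a y.1)) /=.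
  rewrite mulr_sumr big_mkord; apply: eq_bigr => a _.
  rewrite big_bool /= -(pair_bigA _ (fun (b : 'I_n) (s : bool) => g a b)) /=.
  rewrite mulr_sumr big_mkord -big_split /=; apply: eq_bigr => b _.
  by rewrite !big_bool /= /g; ring.
by have := double_sum_bound n; lra.
Qed.

Lemma signed_pairP (m : int) n : (absz m < n)%N -> exists t : 'I_n * bool,
  (if t.2 then Posz t.1 else - Posz t.1) = m.
Proof.
move=> mn; exists (Ordinal mn, 0 <= m) => /=.
by case: ifP => h; lia.
Qed.

(** Each index is the image of a point of a box of signed pairs, and over the box
    the two nested sums telescope. *)
Lemma weight_sum (J : {fset int * int}) : \sum_(p <- J) weight p <= 12.
Proof.
(* A crude size for a box containing all of [J]. *)
pose n := (\sum_(p <- J) (absz p.1 + absz p.2)).+1.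
have Jn p : p \in J -> (absz p.1 < n)%N /\ (absz p.2 < n)%N.
  by move=> pJ; rewrite /n (big_fsetD1 p pJ) /=; split; lia.
apply: le_trans (weight_box_sum n).
apply: (@le_trans _ _ (\sum_(p <- J) \sum_(t | @signed_pair n t == p) weight (signed_pair t))).
  rewrite big_seq [leRHS]big_seq; apply: ler_sum => p /Jn [/signed_pairP [a ha] /signed_pairP [b hb]].
  have tp : signed_pair (a, b) = p by rewrite /signed_pair /= ha hb; case: (p).
  rewrite (bigD1 (a, b)) /= ?tp // lerDl.
  by apply: sumr_ge0 => t _; exact/ltW/weight_gt0.
under eq_bigr => p _ do rewrite big_mkcond.
rewrite exchange_big /=; apply: ler_sum => t _.
rewrite -big_mkcond /= (eq_bigl (fun p => p == signed_pair t)); last by move=> p; rewrite eq_sym.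
have [tJ|tJ] := boolP (signed_pair t \in J).
  by rewrite -big_filter (filter_pred1_uniq (fset_uniq J) tJ) big_seq1.
rewrite big1_seq ?(ltW (weight_gt0 _)) // => p /andP[/eqP -> h].
by rewrite h in tJ.
Qed.

Definition period tau p : C := p.1%:~R + p.2%:~R * tau.

Lemma near_upper_half_plane tau0 : 0 < complex.Im tau0 -> exists2 r : R, 0 < r &
  forall tau, cabs (tau - tau0) < r -> complex.Im tau0 / 2 <= complex.Im tau /\ cabs tau <= cabs tau0 + r.
Proof.
move=> h; exists (complex.Im tau0 / 2); first lra.
move=> tau ht; have := cabs_Im (tau - tau0); rewrite ImD ImN ler_norml.
have := cabsD (tau - tau0) tau0; rewrite subrK; lra.
Qed.

Lemma Im_period tau p : complex.Im (period tau p) = p.2%:~R * complex.Im tau.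
Proof.
rewrite /period ImD -!(rmorph_int (real_complex R)) /= add0r.
by case: tau => a b /=; rewrite mul0r addr0.
Qed.

(** Nonzero periods are at least as long as their height, up to a constant that
    is locally uniform in [tau]: the imaginary part controls the second index,
    and the triangle inequality then controls the first. *)
Lemma period_lower_bound tau0 : 0 < complex.Im tau0 -> exists kap r : R, [/\ 0 < kap, 0 < r &
  forall tau, cabs (tau - tau0) < r -> 0 < complex.Im tau /\
    forall p, p != (0, 0) -> kap * height p <= cabs (period tau p)].
Proof.
move=> h; have [r r0 Hr] := near_upper_half_plane h.
set y := complex.Im tau0 / 2 in Hr; set T := cabs tau0 + r in Hr.
have y0 : 0 < y by rewrite /y; lra.
have T0 : 0 < T by rewrite /T; have := cabs_ge0 tau0; lra.
(* From [|n| <= L/y] and [|m| <= L + |n| T] for the length [L]; the factor 2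
   absorbs the 1 in the height since [|m| + |n| >= 1]. *)
pose D := 2 * (1 + T / y + 1 / y).
have D0 : 0 < D by rewrite /D; have := divr_gt0 T0 y0; have := divr_gt0 ltr01 y0; lra.
exists D^-1, r; split => //; first by rewrite invr_gt0.
move=> tau /Hr [h1 h2]; split; first lra.
move=> p p0; rewrite ler_pdivrMl //.
have h3 := cabs_Im (period tau p).
rewrite Im_period normrM (ger0_norm (_ : 0 <= complex.Im tau)) in h3; last lra.
have h4 : cabs p.1%:~R <= cabs (period tau p) + cabs (p.2%:~R * tau).
  by rewrite -[p.1%:~R](addrK (p.2%:~R * tau)) cabsB.
rewrite cabsM !cabs_int in h4.
have E m : `|m|%:~R = (absz m)%:R :> R by rewrite -abszE -pmulrn.
rewrite -intr_norm !E in h3 h4.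
set a := (absz p.1)%:R : R in h4; set b := (absz p.2)%:R : R in h3 h4.
set L := cabs _ in h3 h4 *.
have b0 : 0 <= b by [].
have bL : b <= L / y by rewrite ler_pdivlMr //; apply: le_trans h3; rewrite ler_wpM2l.
have bT : b * cabs tau <= L / y * T by apply: ler_pM; rewrite ?cabs_ge0.
have ab1 : 1 <= a + b.
  rewrite -natrD ler1n; case: p p0 {h3 h4 a b b0 bL bT L} => m n /= mn.
  by rewrite addn_gt0 !absz_gt0 -negb_and.
have -> : height p = 1 + a + b by rewrite /height !natrD.
have -> : D * L = 2 * (L + L / y * T + L / y) by rewrite /D; field; rewrite gt_eqF.
lra.
Qed.

Lemma finite_height (X : R) : exists A : {fset int * int}, forall p, height p <= X -> p \in A.
Proof.
pose n := (Num.truncn X).+1.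
exists [fset p | p in [seq @signed_pair n t | t : ('I_n * bool) * ('I_n * bool)]].
move=> p pX; rewrite !inE /=.
have hn : (absz p.1 + absz p.2 < n)%N.
  have : (1 + absz p.1 + absz p.2)%N%:R < n%:R :> R by apply: le_lt_trans pX (truncnS_gt _).
  by rewrite ltr_nat; lia.
have [|a ha] := @signed_pairP p.1 n; first lia.
have [|b hb] := @signed_pairP p.2 n; first lia.
apply/mapP; exists (a, b); first by rewrite mem_enum.
by rewrite /signed_pair /= ha hb; case: (p).
Qed.

(** For all but finitely many periods [w], every [x] with [|x| <= Z] satisfies
    [|x - w| >= kap * height], uniformly for [tau] near [tau0].  This is the
    domination used for every sum below. *)
Lemma far_periods tau0 (Z : R) : 0 < complex.Im tau0 -> exists kap r (A : {fset int * int}),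
  [/\ 0 < kap, 0 < r, (0, 0) \in A & forall tau, cabs (tau - tau0) < r ->
   0 < complex.Im tau /\ forall p x, p \notin A -> cabs x <= Z -> kap * height p <= cabs (x - period tau p)].
Proof.
move=> h; have [k [r [k0 r0 H]]] := period_lower_bound h.
have [A HA] := finite_height (2 * `|Z| / k).
exists (k / 2), r, ((0, 0) |` A); split => //; first lra.
  by rewrite !inE eqxx.
move=> tau /H [h1 h2]; split => // p x; rewrite !inE negb_or => /andP[p0 pA] xZ.
have := h2 p p0; have := cabsBr (period tau p) x; rewrite cabsC.
have : 2 * `|Z| / k < height p by rewrite ltNge; apply: contraNN pA; exact: HA.
rewrite ltr_pdivrMr //; have := ler_norm Z; lra.
Qed.

Definition lattice_sum (Phi : int * int -> C -> C -> C) (x tau : C) : C :=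
  summability.sum (fun p => if p == (0, 0) then 0 : C else Phi p x tau).

(** The terms are [O(height^-3)] whenever [|w|] and [|x - w|] are comparable to
    the height. *)
Definition cubic_decay (Phi : int * int -> C -> C -> C) : Prop :=
  forall kap Z : R, 0 < kap -> exists K : R, forall p x tau, cabs x <= Z ->
   kap * height p <= cabs (period tau p) -> kap * height p <= cabs (x - period tau p) ->
   cabs (Phi p x tau) <= K * weight p.

(** The domain of the sums over nonzero periods; it contains 0, which is what
    makes the expansions at the pole accessible. *)
Definition off_nonzero_periods x tau : Prop := 0 < complex.Im tau /\ forall p, p != (0, 0) -> x != period tau p.

Lemma period_neq0 tau p : 0 < complex.Im tau -> p != (0, 0) -> period tau p != 0.
Proof.
move=> h p0; have [k [r [k0 r0 H]]] := period_lower_bound h.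
have [|_ /(_ p p0)] := H tau; first by rewrite subrr cabs0.
rewrite -cabs_gt0; apply: lt_le_trans; rewrite mulr_gt0 // height_gt0.
Qed.

Lemma lattice_sum_dominated Phi x tau : cubic_decay Phi -> 0 < complex.Im tau ->
  dominated weight (fun p => if p == (0, 0) then 0 : C else Phi p x tau).
Proof.
move=> hb ht; have [k [r [A [k0 r0 A0 H]]]] := far_periods (cabs x) ht.
have [K HK] := hb k (cabs x) k0.
apply: (dominated_cofinite weight_gt0); exists K, A => p pA.
have p0 : p != (0, 0) by apply: contraNneq pA => ->.
rewrite (negbTE p0); have [|_ H'] := H tau; first by rewrite subrr cabs0.
apply: HK => //; last exact: H'.
by have := H' p 0 pA; rewrite cabs0 sub0r cabsN; apply; exact: cabs_ge0.
Qed.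

(** Both kinds of derivative are instances: [b = 1, d = 0] is the derivative in
    [z], and [c = 0, d = 1] the derivative in [tau] along [z = a + b tau]. *)
Lemma isD_lattice_sum_path Phi Psi (a b c d t0 : C) :
  cubic_decay Phi -> cubic_decay Psi ->
  (forall p t, a + b * t != period (c + d * t) p -> period (c + d * t) p != 0 ->
     isD (fun t => Phi p (a + b * t) (c + d * t)) t (Psi p (a + b * t) (c + d * t))) ->
  off_nonzero_periods (a + b * t0) (c + d * t0) ->
  isD (fun t => lattice_sum Phi (a + b * t) (c + d * t)) t0 (lattice_sum Psi (a + b * t0) (c + d * t0)).
Proof.
move=> bPhi bPsi hD [ht hr].
set x0 := a + b * t0 in hr *; set tau0 := c + d * t0 in ht hr *.
have [k [r [A [k0 r0 A0 H]]]] := far_periods (cabs x0 + 1) ht.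
have [K HK] := bPsi k (cabs x0 + 1) k0.
have [r' r'0 Hr'] : exists2 r' : R, 0 < r' & forall t, cabs (t - t0) < r' ->
   cabs (a + b * t - x0) < 1 /\ cabs (c + d * t - tau0) < r.
  have b1 : 0 < cabs b + 1 by rewrite ltr_wpDl ?cabs_ge0.
  have d1 : 0 < cabs d + 1 by rewrite ltr_wpDl ?cabs_ge0.
  exists (Num.min (1 / (cabs b + 1)) (r / (cabs d + 1))).
    by rewrite lt_min !divr_gt0.
  move=> t; rewrite lt_min !ltr_pdivlMr // => /andP[h1 h2].
  have -> : a + b * t - x0 = b * (t - t0) by rewrite /x0; ring.
  have -> : c + d * t - tau0 = d * (t - t0) by rewrite /tau0; ring.
  rewrite !cabsM; split.
    by apply: le_lt_trans h1; rewrite mulrC ler_wpM2l ?cabs_ge0 // lerDl.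
  by apply: le_lt_trans h2; rewrite mulrC ler_wpM2l ?cabs_ge0 // lerDl.
have nA p : p \notin A -> p != (0, 0) by move=> pA; apply: contraNneq pA => ->.
have lbs p t : p \notin A -> cabs (t - t0) < r' ->
   [/\ cabs (a + b * t) <= cabs x0 + 1, k * height p <= cabs (period (c + d * t) p) &
      k * height p <= cabs (a + b * t - period (c + d * t) p)].
  move=> pA /Hr' [h1 /H [_ h2]].
  have xb : cabs (a + b * t) <= cabs x0 + 1.
    by have := cabsD (a + b * t - x0) x0; rewrite subrK; lra.
  split => //; last exact: h2.
  have := h2 p 0 pA; rewrite cabs0 sub0r cabsN; apply.
  by have := cabs_ge0 x0; lra.
have kN p : 0 < k * height p by rewrite mulr_gt0 // height_gt0.
pose F p t := if p == (0, 0) then 0 : C else Phi p (a + b * t) (c + d * t).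
pose F' p t := if p == (0, 0) then 0 : C else Psi p (a + b * t) (c + d * t).
have [] := @isD_usum R _ weight 12 weight_gt0 weight_sum F F' t0 A K r' r'0.
- move=> p; rewrite /F /F'; case: eqP => [_|/eqP p0]; first exact: isD_cst.
  by apply: hD; [exact: hr | exact: period_neq0].
- move=> p t pA tr; rewrite /F /F' (negbTE (nA _ pA)).
  have [_ h1 h2] := lbs p t pA tr.
  apply: hD; first by rewrite -subr_eq0 -cabs_gt0; apply: lt_le_trans h2.
  by rewrite -cabs_gt0; apply: lt_le_trans h1.
- move=> p t pA tr; rewrite /F' (negbTE (nA _ pA)).
  by have [h0 h1 h2] := lbs p t pA tr; exact: HK.
- exact: lattice_sum_dominated.
by [].
Qed.

End Lattice.

(** * The sums behind zeta, wp and their derivatives *)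

Section Terms.
Variable R : realType.
Local Notation C := (cplx R).
Implicit Types (z w x tau a b : C) (p : int * int).

Lemma isD_exprV (f : C -> C) x df k : isD f x df -> f x != 0 ->
  isD (fun x => (f x ^+ k)^-1) x (- k%:R * df * (f x ^+ k.+1)^-1).
Proof.
move=> hf f0; apply: isD_eq (@isD_inv _ (fun x => f x ^+ k) x _ (expf_neq0 k f0) (isD_exp k hf)) _.
case: k => [|k]; first by rewrite !mul0r oppr0 !mul0r.
by rewrite /= !exprS; field; rewrite f0 expf_neq0.
Qed.

Lemma eq_isD (f g : C -> C) x d : f =1 g -> isD f x d -> isD g x d.
Proof. by move=> /funext ->. Qed.

(** The families of terms.  [zeta_term] and [wp_term] give zeta and wp without
    their principal part at 0; [dtau_zeta_term] and [dtau_wp_term] are their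
    derivatives in [tau] at fixed [x], from [d w / d tau = p.2]. *)
Definition zeta_term p x tau : C := (x - period tau p)^-1 + (period tau p)^-1 + x * (period tau p ^+ 2)^-1.
Definition wp_term p x tau : C := ((x - period tau p) ^+ 2)^-1 - (period tau p ^+ 2)^-1.
Definition pow_term k p x tau : C := ((x - period tau p) ^+ k)^-1.
Definition dtau_zeta_term p x tau : C := p.2%:~R *
  (((x - period tau p) ^+ 2)^-1 - (period tau p ^+ 2)^-1 - 2 * x * (period tau p ^+ 3)^-1).
Definition dtau_wp_term p x tau : C := 2 * p.2%:~R *
  (((x - period tau p) ^+ 3)^-1 + (period tau p ^+ 3)^-1).
Definition npow_term k p x tau : C := p.2%:~R * ((x - period tau p) ^+ k)^-1.

Section Bounds.
Variables (kap Z : R) (p : int * int) (x tau : C).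
Hypotheses (k0 : 0 < kap) (xZ : cabs x <= Z)
  (hw : kap * height R p <= cabs (period tau p)) (hx : kap * height R p <= cabs (x - period tau p)).
Let A := (x - period tau p)^-1.
Let B := - (period tau p)^-1.
Let q := (kap * height R p)^-1.

Let N0 : 0 < kap * height R p. Proof. by rewrite mulr_gt0 // height_gt0. Qed.
Let q0 : 0 < q. Proof. by rewrite invr_gt0. Qed.
Let xw0 : x - period tau p != 0. Proof. by rewrite -cabs_gt0; apply: lt_le_trans hx. Qed.
Let w0 : period tau p != 0. Proof. by rewrite -cabs_gt0; apply: lt_le_trans hw. Qed.
Let Aq : cabs A <= q.
Proof. by rewrite cabsV lef_pV2 ?posrE // (lt_le_trans N0). Qed.
Let Bq : cabs B <= q.
Proof. by rewrite cabsN cabsV lef_pV2 ?posrE // (lt_le_trans N0). Qed.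
Let Z0 : 0 <= Z. Proof. by apply: le_trans xZ; exact: cabs_ge0. Qed.

Lemma bound_mul (y y' : C) (m m' : R) : cabs y <= m -> cabs y' <= m' -> cabs (y * y') <= m * m'.
Proof. by move=> h h'; rewrite cabsM; apply: ler_pM => //; exact: cabs_ge0. Qed.
Lemma bound_add (y y' : C) (m m' : R) : cabs y <= m -> cabs y' <= m' -> cabs (y + y') <= m + m'.
Proof. by move=> h h'; apply: le_trans (cabsD _ _) _; exact: lerD. Qed.
Lemma bound_exp (y : C) (m : R) k : cabs y <= m -> cabs (y ^+ k) <= m ^+ k.
Proof. by move=> h; rewrite cabsX lerXn2r ?nnegrE ?cabs_ge0 // (le_trans _ h) ?cabs_ge0. Qed.
Lemma height_index_bound : cabs (p.2%:~R : C) <= height R p.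
Proof. by rewrite cabs_int -abszE -pmulrn ler_nat; lia. Qed.

(** All terms are polynomials in [A = 1/(x - w)] and [B = -1/w], both of size
    [1/height].  The subtracted Taylor coefficients at [x = 0] make [A - B]
    divisible: [A - B = - x A B], which supplies the missing decay. *)
Lemma expr_weight_bound k : (3 <= k)%N -> q ^+ k <= kap^-1 ^+ k * weight R p.
Proof.
move=> k3; rewrite /q invfM exprMn ler_wpM2l ?exprn_ge0 ?invr_ge0 ?(ltW k0) //.
rewrite /weight -exprVn; have N1 := height_ge1 R p.
have Nle : (height R p)^-1 <= 1 by rewrite invf_le1 // height_gt0.
have Nge : 0 <= (height R p)^-1 by rewrite invr_ge0 ltW // height_gt0.
by rewrite ler_wiXn2l.
Qed.

Lemma zeta_term_bound : cabs (zeta_term p x tau) <= Z ^+ 2 * kap^-1 ^+ 3 * weight R p.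
Proof.
have -> : zeta_term p x tau = x ^+ 2 * (A * B ^+ 2) by rewrite /zeta_term /A /B; field; apply/andP.
apply: le_trans (bound_mul (bound_exp 2 xZ) (bound_mul Aq (bound_exp 2 Bq))) _.
by rewrite -exprS -mulrA ler_wpM2l ?exprn_ge0 // expr_weight_bound.
Qed.
Lemma wp_term_bound : cabs (wp_term p x tau) <= Z * 2 * kap^-1 ^+ 3 * weight R p.
Proof.
have -> : wp_term p x tau = - x * (A * B * (A + B)) by rewrite /wp_term /A /B; field; apply/andP.
have xZ' : cabs (- x) <= Z by rewrite cabsN.
apply: le_trans (bound_mul xZ' (bound_mul (bound_mul Aq Bq) (bound_add Aq Bq))) _.
have := @expr_weight_bound 3 isT; have := mulr_ge0 Z0 (exprn_ge0 3 (ltW q0)) => h1 h2.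
have -> : Z * (q * q * (q + q)) = Z * 2 * q ^+ 3 by ring.
by rewrite -[leRHS]mulrA ler_wpM2l // mulr_ge0.
Qed.
Lemma pow_term_bound k : (3 <= k)%N -> cabs (pow_term k p x tau) <= kap^-1 ^+ k * weight R p.
Proof.
move=> k3; have -> : pow_term k p x tau = A ^+ k by rewrite /pow_term exprVn.
by apply: le_trans (bound_exp k Aq) _; exact: expr_weight_bound.
Qed.
Lemma height_expr_weight_bound k : (4 <= k)%N -> height R p * q ^+ k <= kap^-1 ^+ k * weight R p.
Proof.
case: k => // k k3; have -> : height R p * q ^+ k.+1 = kap^-1 * q ^+ k.
  by rewrite exprS mulrA /q; congr (_ * _); field; rewrite !gt_eqF // height_gt0.
by rewrite exprS -mulrA ler_wpM2l ?invr_ge0 ?(ltW k0) // expr_weight_bound.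
Qed.
Lemma npow_term_bound k : (4 <= k)%N -> cabs (npow_term k p x tau) <= kap^-1 ^+ k * weight R p.
Proof.
move=> k3; have -> : npow_term k p x tau = p.2%:~R * A ^+ k by rewrite /npow_term exprVn.
by apply: le_trans (bound_mul height_index_bound (bound_exp k Aq)) _; exact: height_expr_weight_bound.
Qed.
Lemma dtau_zeta_term_bound : cabs (dtau_zeta_term p x tau) <= Z ^+ 2 * 3 * kap^-1 ^+ 4 * weight R p.
Proof.
have -> : dtau_zeta_term p x tau = p.2%:~R * (x ^+ 2 * (A * B ^+ 2 * (A + (B + B)))).
  by rewrite /dtau_zeta_term /A /B; field; apply/andP.
apply: le_trans (bound_mul height_index_bound (bound_mul (bound_exp 2 xZ)
  (bound_mul (bound_mul Aq (bound_exp 2 Bq)) (bound_add Aq (bound_add Bq Bq))))) _.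
have -> : height R p * (Z ^+ 2 * (q * q ^+ 2 * (q + (q + q)))) = Z ^+ 2 * 3 * (height R p * q ^+ 4) by ring.
by rewrite -[leRHS]mulrA ler_wpM2l ?height_expr_weight_bound // mulr_ge0 ?exprn_ge0.
Qed.
Lemma dtau_wp_term_bound : cabs (dtau_wp_term p x tau) <= Z * 6 * kap^-1 ^+ 4 * weight R p.
Proof.
have -> : dtau_wp_term p x tau = p.2%:~R * ((- x + - x) * (A * B * (A ^+ 2 + A * B + B ^+ 2))).
  by rewrite /dtau_wp_term /A /B; field; apply/andP.
have xZ' : cabs (- x) <= Z by rewrite cabsN.
apply: le_trans (bound_mul height_index_bound (bound_mul (bound_add xZ' xZ')
  (bound_mul (bound_mul Aq Bq) (bound_add (bound_add (bound_exp 2 Aq) (bound_mul Aq Bq)) (bound_exp 2 Bq))))) _.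
have -> : height R p * ((Z + Z) * (q * q * (q ^+ 2 + q * q + q ^+ 2))) = Z * 6 * (height R p * q ^+ 4) by ring.
by rewrite -[leRHS]mulrA ler_wpM2l ?height_expr_weight_bound // mulr_ge0.
Qed.
End Bounds.

Lemma cubic_decay_zeta_term : cubic_decay zeta_term. Proof. by move=> k Z k0; eexists; move=> p x tau h1 h2 h3; eapply zeta_term_bound; eassumption. Qed.
Lemma cubic_decay_wp_term : cubic_decay wp_term. Proof. by move=> k Z k0; eexists; move=> p x tau h1 h2 h3; eapply wp_term_bound; eassumption. Qed.
Lemma cubic_decay_dtau_zeta_term : cubic_decay dtau_zeta_term. Proof. by move=> k Z k0; eexists; move=> p x tau h1 h2 h3; eapply dtau_zeta_term_bound; eassumption. Qed.
Lemma cubic_decay_dtau_wp_term : cubic_decay dtau_wp_term. Proof. by move=> k Z k0; eexists; move=> p x tau h1 h2 h3; eapply dtau_wp_term_bound; eassumption. Qed.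
Lemma cubic_decay_pow_term k : (3 <= k)%N -> cubic_decay (pow_term k).
Proof. by move=> k3 kap Z k0; eexists; move=> p x tau h1 h2 h3; eapply pow_term_bound; eassumption. Qed.
Lemma cubic_decay_npow_term k : (4 <= k)%N -> cubic_decay (npow_term k).
Proof. by move=> k3 kap Z k0; eexists; move=> p x tau h1 h2 h3; eapply npow_term_bound; eassumption. Qed.

Implicit Types Phi Psi : int * int -> C -> C -> C.
Lemma cubic_decay_add Phi Psi : cubic_decay Phi -> cubic_decay Psi -> cubic_decay (fun p x tau => Phi p x tau + Psi p x tau).
Proof.
move=> h1 h2 k Z k0; have [K HK] := h1 k Z k0; have [L HL] := h2 k Z k0.
exists (K + L) => p x tau a b c; apply: le_trans (cabsD _ _) _.
by rewrite mulrDl lerD ?HK ?HL.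
Qed.
Lemma cubic_decay_scale a Phi : cubic_decay Phi -> cubic_decay (fun p x tau => a * Phi p x tau).
Proof.
move=> h1 k Z k0; have [K HK] := h1 k Z k0.
by exists (cabs a * K) => p x tau ? ? ?; rewrite cabsM -mulrA ler_wpM2l ?cabs_ge0 ?HK.
Qed.

Let wt0 := @weight_gt0 R.
Let wtW := @weight_sum R.

Lemma lattice_sum_add Phi Psi x tau : cubic_decay Phi -> cubic_decay Psi -> 0 < complex.Im tau ->
  lattice_sum (fun p x tau => Phi p x tau + Psi p x tau) x tau = lattice_sum Phi x tau + lattice_sum Psi x tau.
Proof.
move=> h1 h2 ht; rewrite /lattice_sum -(usum_add wt0 wtW (lattice_sum_dominated x h1 ht) (lattice_sum_dominated x h2 ht)).
by congr (summability.sum _); apply/funext => p; case: ifP => //; rewrite addr0.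
Qed.
Lemma lattice_sum_scale a Phi x tau : cubic_decay Phi -> 0 < complex.Im tau ->
  lattice_sum (fun p x tau => a * Phi p x tau) x tau = a * lattice_sum Phi x tau.
Proof.
move=> h1 ht; rewrite /lattice_sum -(usum_scale wt0 wtW a (lattice_sum_dominated x h1 ht)).
by congr (summability.sum _); apply/funext => p; case: ifP => //; rewrite mulr0.
Qed.

Lemma isD_lattice_sum_z Phi Psi a x tau : cubic_decay Phi -> cubic_decay Psi ->
  (forall p x tau, x != period tau p -> period tau p != 0 ->
     isD (fun x => Phi p x tau) x (a * Psi p x tau)) ->
  off_nonzero_periods x tau -> isD (fun x => lattice_sum Phi x tau) x (a * lattice_sum Psi x tau).
Proof.
move=> h1 h2 hD hr; have ht := hr.1.
have e1 t : 0 + 1 * t = t :> C by rewrite add0r mul1r.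
have e2 t : tau + 0 * t = tau :> C by rewrite mul0r addr0.
have := @isD_lattice_sum_path R Phi (fun p x tau => a * Psi p x tau) 0 1 tau 0 x h1 (cubic_decay_scale a h2).
rewrite e1 e2 => H; rewrite -lattice_sum_scale //.
apply: eq_isD (H _ hr); first by move=> t; rewrite e1 e2.
move=> p t; rewrite e1 e2 => ha hb; apply: eq_isD (hD p t tau ha hb) => y.
by rewrite e1 e2.
Qed.

Lemma isD_lattice_sum_tau Phi Psi1 Psi2 c a b tau : cubic_decay Phi -> cubic_decay Psi1 -> cubic_decay Psi2 ->
  (forall p tau, a + b * tau != period tau p -> period tau p != 0 ->
     isD (fun tau => Phi p (a + b * tau) tau) tau
      (Psi1 p (a + b * tau) tau + c * Psi2 p (a + b * tau) tau)) ->
  off_nonzero_periods (a + b * tau) tau ->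
  isD (fun tau => lattice_sum Phi (a + b * tau) tau) tau
    (lattice_sum Psi1 (a + b * tau) tau + c * lattice_sum Psi2 (a + b * tau) tau).
Proof.
move=> h1 h2 h3 hD hr; have ht := hr.1.
have e1 t : 0 + 1 * t = t :> C by rewrite add0r mul1r.
have := @isD_lattice_sum_path R Phi (fun p x tau => Psi1 p x tau + c * Psi2 p x tau) a b 0 1 tau h1
   (cubic_decay_add h2 (cubic_decay_scale c h3)).
rewrite e1 => H; rewrite -lattice_sum_scale // -lattice_sum_add //; last exact: cubic_decay_scale.
apply: eq_isD (H _ hr); first by move=> t; rewrite e1.
move=> p t; rewrite e1 => ha hb; apply: eq_isD (hD p t ha hb) => y.
by rewrite e1.
Qed.

Lemma isD_sub_period p x tau : isD (fun x => x - period tau p) x 1.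
Proof. by apply: isD_eq (isD_sub (isD_id _) (isD_cst _ _)) _; rewrite subr0. Qed.
Lemma isD_period p tau : isD (fun tau => period tau p) tau p.2%:~R.
Proof.
apply: isD_eq (isD_add (isD_cst _ _) (isD_mul (isD_cst _ _) (isD_id _))) _.
by rewrite mul0r !add0r mulr1.
Qed.
Lemma isD_path_sub_period p a b tau : isD (fun tau => a + b * tau - period tau p) tau (b - p.2%:~R).
Proof.
apply: isD_eq (isD_sub (isD_add (isD_cst _ _) (isD_mul (isD_cst _ _) (isD_id _))) (isD_period _ _)) _.
by rewrite mul0r !add0r mulr1.
Qed.


Lemma isD_zeta_sum x tau : off_nonzero_periods x tau -> isD (fun x => lattice_sum zeta_term x tau) x (- lattice_sum wp_term x tau).
Proof.
move=> hr; rewrite -mulN1r; apply: isD_lattice_sum_z hr; [exact: cubic_decay_zeta_term | exact: cubic_decay_wp_term |].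
move=> p y t hy hw; have yw : y - period t p != 0 by rewrite subr_eq0.
apply: isD_eq (isD_add (isD_add (isD_exprV 1 (isD_sub_period p y t) yw) (isD_cst _ _))
   (isD_mul (isD_id _) (isD_cst _ _))) _.
by rewrite /wp_term; ring.
Qed.
Lemma isD_wp_sum x tau : off_nonzero_periods x tau -> isD (fun x => lattice_sum wp_term x tau) x (- 2 * lattice_sum (pow_term 3) x tau).
Proof.
move=> hr; apply: isD_lattice_sum_z hr; [exact: cubic_decay_wp_term | exact: cubic_decay_pow_term |].
move=> p y t hy hw; have yw : y - period t p != 0 by rewrite subr_eq0.
apply: isD_eq (isD_sub (isD_exprV 2 (isD_sub_period p y t) yw) (isD_cst _ _)) _.
by rewrite /pow_term; ring.
Qed.
Lemma isD_pow_sum k x tau : (3 <= k)%N -> off_nonzero_periods x tau ->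
  isD (fun x => lattice_sum (pow_term k) x tau) x (- k%:R * lattice_sum (pow_term k.+1) x tau).
Proof.
move=> k3 hr; apply: isD_lattice_sum_z hr; [exact: cubic_decay_pow_term | by apply: cubic_decay_pow_term; lia |].
move=> p y t hy hw; have yw : y - period t p != 0 by rewrite subr_eq0.
by apply: isD_eq (isD_exprV k (isD_sub_period p y t) yw) _; rewrite mulr1.
Qed.
Lemma isD_dtau_zeta_sum x tau : off_nonzero_periods x tau -> isD (fun x => lattice_sum dtau_zeta_term x tau) x (- lattice_sum dtau_wp_term x tau).
Proof.
move=> hr; rewrite -mulN1r; apply: isD_lattice_sum_z hr; [exact: cubic_decay_dtau_zeta_term | exact: cubic_decay_dtau_wp_term |].
move=> p y t hy hw; have yw : y - period t p != 0 by rewrite subr_eq0.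
apply: isD_eq (isD_mul (isD_cst _ _) (isD_sub (isD_sub (isD_exprV 2 (isD_sub_period p y t) yw) (isD_cst _ _))
   (isD_mul (isD_mul (isD_cst _ _) (isD_id _)) (isD_cst _ _)))) _.
by rewrite /dtau_wp_term; ring.
Qed.
Lemma isD_dtau_wp_sum x tau : off_nonzero_periods x tau -> isD (fun x => lattice_sum dtau_wp_term x tau) x (- 6 * lattice_sum (npow_term 4) x tau).
Proof.
move=> hr; apply: isD_lattice_sum_z hr; [exact: cubic_decay_dtau_wp_term | exact: cubic_decay_npow_term |].
move=> p y t hy hw; have yw : y - period t p != 0 by rewrite subr_eq0.
apply: isD_eq (isD_mul (isD_cst _ _) (isD_add (isD_exprV 3 (isD_sub_period p y t) yw) (isD_cst _ _))) _.
by rewrite /npow_term; ring.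
Qed.
Lemma isD_npow_sum k x tau : (4 <= k)%N -> off_nonzero_periods x tau ->
  isD (fun x => lattice_sum (npow_term k) x tau) x (- k%:R * lattice_sum (npow_term k.+1) x tau).
Proof.
move=> k3 hr; apply: isD_lattice_sum_z hr; [exact: cubic_decay_npow_term | by apply: cubic_decay_npow_term; lia |].
move=> p y t hy hw; have yw : y - period t p != 0 by rewrite subr_eq0.
apply: isD_eq (isD_mul (isD_cst _ _) (isD_exprV k (isD_sub_period p y t) yw)) _.
by rewrite /npow_term; ring.
Qed.

Lemma isD_zeta_sum_path a b tau : off_nonzero_periods (a + b * tau) tau ->
  isD (fun tau => lattice_sum zeta_term (a + b * tau) tau) tau
   (lattice_sum dtau_zeta_term (a + b * tau) tau + - b * lattice_sum wp_term (a + b * tau) tau).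
Proof.
move=> hr; apply: isD_lattice_sum_tau hr; [exact: cubic_decay_zeta_term | exact: cubic_decay_dtau_zeta_term | exact: cubic_decay_wp_term |].
move=> p t hy hw; have yw : a + b * t - period t p != 0 by rewrite subr_eq0.
apply: isD_eq (isD_add (isD_add (isD_exprV 1 (isD_path_sub_period p a b t) yw) (isD_exprV 1 (isD_period p t) hw))
   (isD_mul (isD_add (isD_cst _ _) (isD_mul (isD_cst _ _) (isD_id _))) (isD_exprV 2 (isD_period p t) hw))) _.
by rewrite /dtau_zeta_term /wp_term; ring.
Qed.
Lemma isD_wp_sum_path a b tau : off_nonzero_periods (a + b * tau) tau ->
  isD (fun tau => lattice_sum wp_term (a + b * tau) tau) tau
   (lattice_sum dtau_wp_term (a + b * tau) tau + - 2 * b * lattice_sum (pow_term 3) (a + b * tau) tau).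
Proof.
move=> hr; apply: isD_lattice_sum_tau hr; [exact: cubic_decay_wp_term | exact: cubic_decay_dtau_wp_term | exact: cubic_decay_pow_term |].
move=> p t hy hw; have yw : a + b * t - period t p != 0 by rewrite subr_eq0.
apply: isD_eq (isD_sub (isD_exprV 2 (isD_path_sub_period p a b t) yw) (isD_exprV 2 (isD_period p t) hw)) _.
by rewrite /dtau_wp_term /pow_term; ring.
Qed.

Definition opp_index p : int * int := (- p.1, - p.2).
Definition sub_index (q p : int * int) : int * int := (p.1 - q.1, p.2 - q.2).

Lemma period_neg p tau : period tau (opp_index p) = - period tau p.
Proof. by rewrite /period /= !rmorphN /=; ring. Qed.
Lemma period_shift q p tau : period tau (sub_index q p) = period tau p - period tau q.
Proof. by rewrite /period /= !rmorphB /=; ring. Qed.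

Lemma lattice_sum_neg Phi c x tau : cubic_decay Phi -> 0 < complex.Im tau ->
  (forall p, Phi (opp_index p) (- x) tau = c * Phi p x tau) ->
  lattice_sum Phi (- x) tau = c * lattice_sum Phi x tau.
Proof.
move=> h1 ht hP; rewrite -lattice_sum_scale // /lattice_sum.
have nn : cancel opp_index opp_index by move=> [m n]; rewrite /opp_index /= !opprK.
rewrite -(usum_reindex wt0 wtW nn nn (lattice_sum_dominated (- x) h1 ht)).
congr (summability.sum _); apply/funext => p.
by rewrite hP /opp_index !xpair_eqE /= !oppr_eq0; case: ifP.
Qed.

Lemma zeta_sum_odd x tau : 0 < complex.Im tau -> lattice_sum zeta_term (- x) tau = - lattice_sum zeta_term x tau.
Proof.
move=> ht; rewrite -[RHS]mulN1r; apply: (lattice_sum_neg (cubic_decay_zeta_term)) => //.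
by move=> p; rewrite /zeta_term period_neg -opprD sqrrN !invrN; ring.
Qed.
Lemma wp_sum_even x tau : 0 < complex.Im tau -> lattice_sum wp_term (- x) tau = lattice_sum wp_term x tau.
Proof.
move=> ht; rewrite -[RHS]mul1r; apply: (lattice_sum_neg (cubic_decay_wp_term)) => //.
by move=> p; rewrite /wp_term period_neg -opprD !sqrrN; ring.
Qed.
Lemma cubeN x : (- x) ^+ 3 = - x ^+ 3. Proof. by ring. Qed.
Lemma cube_sum_odd x tau : 0 < complex.Im tau -> lattice_sum (pow_term 3) (- x) tau = - lattice_sum (pow_term 3) x tau.
Proof.
move=> ht; rewrite -[RHS]mulN1r; apply: (lattice_sum_neg (cubic_decay_pow_term (k := 3) isT)) => //.
by move=> p; rewrite /pow_term period_neg -opprD cubeN invrN; ring.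
Qed.
Lemma dtau_zeta_sum_odd x tau : 0 < complex.Im tau -> lattice_sum dtau_zeta_term (- x) tau = - lattice_sum dtau_zeta_term x tau.
Proof.
move=> ht; rewrite -[RHS]mulN1r; apply: (lattice_sum_neg (cubic_decay_dtau_zeta_term)) => //.
by move=> p; rewrite /dtau_zeta_term period_neg -opprD !sqrrN cubeN invrN /= rmorphN /=; ring.
Qed.

Lemma lattice_sum_zero Phi tau : (forall p, Phi p 0 tau = 0) -> lattice_sum Phi 0 tau = 0.
Proof.
move=> h; apply: unordered_sumE => e e0; exists fset0 => A _.
by rewrite big1 ?subr0 ?cabs0 // => p _; case: ifP.
Qed.
Lemma zeta_sum0 tau : lattice_sum zeta_term 0 tau = 0.
Proof. by apply: lattice_sum_zero => p; rewrite /zeta_term sub0r invrN mul0r addr0 addNr. Qed.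
Lemma wp_sum0 tau : lattice_sum wp_term 0 tau = 0.
Proof. by apply: lattice_sum_zero => p; rewrite /wp_term sub0r sqrrN subrr. Qed.

(** For exponents at least 3 the full sum over the lattice converges absolutely,
    principal part included, so that translations merely permute its terms. *)
Lemma pow_sum_full k x tau : (3 <= k)%N -> 0 < complex.Im tau ->
  dominated (@weight R) (fun p => pow_term k p x tau) /\
  (x ^+ k)^-1 + lattice_sum (pow_term k) x tau = summability.sum (fun p => pow_term k p x tau).
Proof.
move=> k3 ht.
(* The term of index 0 as a family of its own. *)
pose d p : C := if p == (0, 0) then (x ^+ k)^-1 else 0.
have Hd : dominated (@weight R) d.
  apply: (dominated_cofinite wt0); exists 0, [fset (0, 0)]%fset => p; rewrite !inE /d => /negbTE ->.
  by rewrite cabs0 mul0r.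
have Hs := lattice_sum_dominated x (cubic_decay_pow_term k3) ht.
have E : (fun p => pow_term k p x tau) = (fun p => d p + if p == (0, 0) then 0 else pow_term k p x tau).
  apply/funext => p; rewrite /d; case: eqP => [->|_]; last by rewrite add0r.
  by rewrite /pow_term /period /= mul0r !addr0 subr0.
rewrite E; split; first exact: dominated_add.
rewrite (usum_add wt0 wtW Hd Hs); congr (_ + _).
apply/esym/unordered_sumE => e e0; exists [fset (0, 0)]%fset => A; rewrite fsub1set => hA.
rewrite (big_fsetD1 _ hA) /= big1_fset /d ?eqxx ?addr0 ?subrr ?cabs0 //.
by move=> p; rewrite !inE => /andP[/negbTE ->].
Qed.

Lemma pow_sum_period k x tau q : (3 <= k)%N -> 0 < complex.Im tau ->
  ((x + period tau q) ^+ k)^-1 + lattice_sum (pow_term k) (x + period tau q) tau = (x ^+ k)^-1 + lattice_sum (pow_term k) x tau.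
Proof.
move=> k3 ht; have [h1 ->] := pow_sum_full (x + period tau q) k3 ht.
have [h2 ->] := pow_sum_full x k3 ht.
have c1 : cancel (sub_index q) (sub_index (opp_index q)).
  by move=> [m n]; rewrite /sub_index /= !opprK !subrK.
have c2 : cancel (sub_index (opp_index q)) (sub_index q).
  by move=> [m n]; rewrite /sub_index /= !opprK !addrK.
rewrite -(usum_reindex wt0 wtW c1 c2 h2); congr (summability.sum _); apply/funext => p.
by rewrite /pow_term period_shift; congr (_ ^-1); congr (_ ^+ _); ring.
Qed.

End Terms.

(** * Geometry of the lattice and elliptic functions *)

Section LatticeGeom.
Variable R : realType.
Local Notation C := (cplx R).
Implicit Types (z w x tau a b : C) (p q : int * int).

Lemma latticeP tau z : lattice tau z <-> exists p, z = period tau p.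
Proof.
split=> [[m [n ->]]|[[m n] ->]]; first by exists (m, n).
by exists m, n.
Qed.

Lemma off_lattice_neq tau z p : ~ lattice tau z -> z != period tau p.
Proof. by move=> h; apply/eqP => E; apply: h; apply/latticeP; exists p. Qed.

Lemma lattice0 tau : lattice tau 0.
Proof. by apply/latticeP; exists (0, 0); rewrite /period /= mul0r addr0. Qed.

Lemma off_lattice_neq0 tau z : ~ lattice tau z -> z != 0.
Proof. by move=> h; apply/eqP => E; apply: h; rewrite E; exact: lattice0. Qed.

Lemma lattice_off_nonzero_periods tau z : 0 < complex.Im tau -> ~ lattice tau z -> off_nonzero_periods z tau.
Proof. by move=> ht h; split => // p _; exact: off_lattice_neq. Qed.

Lemma off_nonzero_periods0 tau : 0 < complex.Im tau -> off_nonzero_periods 0 tau.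
Proof. by move=> ht; split => // p p0; rewrite eq_sym period_neq0. Qed.

Lemma off_nonzero_periods_lattice tau z : off_nonzero_periods z tau -> z != 0 -> ~ lattice tau z.
Proof.
move=> [ht h] z0 /latticeP [p zp]; have [p0|p0] := eqVneq p (0, 0).
  by move: z0; rewrite zp p0 /period /= mul0r addr0 eqxx.
by have := h p p0; rewrite zp eqxx.
Qed.

Lemma lattice_shift tau z q : lattice tau (z + period tau q) <-> lattice tau z.
Proof.
rewrite !latticeP; split=> [[p hp]|[p ->]].
  by exists (p.1 - q.1, p.2 - q.2); rewrite (period_shift q p) -hp addrK.
exists (p.1 + q.1, p.2 + q.2); rewrite /period /= !rmorphD /=; ring.
Qed.

Lemma lattice_opp tau z : lattice tau (- z) <-> lattice tau z.
Proof.
rewrite !latticeP; split=> -[p hp]; exists (opp_index p); rewrite period_neg.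
  by rewrite -hp opprK.
by rewrite hp.
Qed.

(** Only finitely many periods come close to the path; each of them is avoided on
    a neighbourhood by continuity. *)
Lemma off_nonzero_periods_path (a b c d t0 : C) : off_nonzero_periods (a + b * t0) (c + d * t0) ->
  \forall t \near t0, off_nonzero_periods (a + b * t) (c + d * t).
Proof.
move=> [ht hr]; set x0 := a + b * t0 in hr; set tau0 := c + d * t0 in ht hr.
have [k [r [A [k0 r0 A0 H]]]] := far_periods (cabs x0 + 1) ht.
have hfin : \forall t \near t0, forall p, p \in enum_fset A -> p != (0, 0) ->
    a + b * t != period (c + d * t) p.
  elim: (enum_fset A) => [|p s IH]; first by apply: near_all.
  have hp : \forall t \near t0, p != (0, 0) -> a + b * t != period (c + d * t) p.
    have [p0|p0] := eqVneq p (0, 0); first by apply: near_all.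
    have D : isD (fun t => a + b * t - period (c + d * t) p) t0 (0 + (0 * t0 + b * 1) - (0 + (0 * tau0 + p.2%:~R * (0 + (0 * t0 + d * 1))))).
      apply: isD_sub.
        by apply: isD_add (isD_cst _ _) (isD_mul (isD_cst _ _) (isD_id _)).
      apply: isD_add (isD_cst _ _) (isD_mul (isD_cst _ _) _).
      by apply: isD_add (isD_cst _ _) (isD_mul (isD_cst _ _) (isD_id _)).
    have := isD_neq0 D; rewrite subr_eq0 => /(_ (hr p p0)).
    by apply: filterS => t; rewrite subr_eq0.
  apply: filterS2 hp IH => t h1 h2 q; rewrite inE => /orP[/eqP ->//|]; exact: h2.
have hx : \forall t \near t0, cabs (a + b * t) <= cabs x0 + 1.
  have D : isD (fun t => a + b * t) t0 (0 + (0 * t0 + b * 1)).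
    by apply: isD_add (isD_cst _ _) (isD_mul (isD_cst _ _) (isD_id _)).
  apply: filterS (isD_continuous D ltr01) => t h.
  by have := cabsD (a + b * t - x0) x0; rewrite subrK /x0; lra.
have htau : \forall t \near t0, cabs (c + d * t - tau0) < r.
  have D : isD (fun t => c + d * t) t0 (0 + (0 * t0 + d * 1)).
    by apply: isD_add (isD_cst _ _) (isD_mul (isD_cst _ _) (isD_id _)).
  by apply: filterS (isD_continuous D r0).
apply: filterS3 hfin hx htau => t h1 h2 /H [h3 h4]; split => // p p0.
have [pA|pA] := boolP (p \in A); first exact: h1.
rewrite -subr_eq0 -cabs_gt0; apply: lt_le_trans (h4 p _ pA h2).
by rewrite mulr_gt0 // height_gt0.
Qed.

Lemma off_lattice_path (a b c d t0 : C) : 0 < complex.Im (c + d * t0) ->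
  ~ lattice (c + d * t0) (a + b * t0) ->
  \forall t \near t0, 0 < complex.Im (c + d * t) /\ ~ lattice (c + d * t) (a + b * t).
Proof.
move=> ht hn; have h1 := off_nonzero_periods_path (lattice_off_nonzero_periods ht hn).
have D : isD (fun t => a + b * t) t0 (0 + (0 * t0 + b * 1)).
  by apply: isD_add (isD_cst _ _) (isD_mul (isD_cst _ _) (isD_id _)).
have h2 := isD_neq0 D (off_lattice_neq0 hn).
by apply: filterS2 h1 h2 => t hr h0; split; [case: hr | exact: off_nonzero_periods_lattice].
Qed.

Lemma off_lattice_near tau z : 0 < complex.Im tau -> ~ lattice tau z ->
  \forall w \near z, ~ lattice tau w.
Proof.
move=> ht hn; have := @off_lattice_path 0 1 tau 0 z; rewrite mul0r addr0 add0r mul1r.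
move=> /(_ ht hn); apply: filterS => w; rewrite mul0r addr0 add0r mul1r; by case.
Qed.

Lemma off_lattice_near_tau a b tau : 0 < complex.Im tau -> ~ lattice tau (a + b * tau) ->
  \forall t \near tau, 0 < complex.Im t /\ ~ lattice t (a + b * t).
Proof.
move=> ht hn; have := @off_lattice_path a b 0 1 tau; rewrite add0r mul1r.
move=> /(_ ht hn); apply: filterS => w; by rewrite add0r mul1r.
Qed.

Lemma off_nonzero_periods_near tau z : off_nonzero_periods z tau -> \forall w \near z, off_nonzero_periods w tau.
Proof.
move=> hr; have := @off_nonzero_periods_path 0 1 tau 0 z; rewrite mul0r addr0 add0r mul1r.
by move=> /(_ hr); apply: filterS => w; rewrite mul0r addr0 add0r mul1r.
Qed.

Lemma locally_finite_lattice tau : 0 < complex.Im tau -> locally_finite (lattice tau).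
Proof.
move=> ht p r; have [k [r' [k0 r0 H]]] := period_lower_bound ht.
have [|_ {}H] := H tau; first by rewrite subrr cabs0.
have [A HA] := finite_height ((cabs p + 2 * `|r|) / k).
exists (0 :: [seq period tau q | q <- enum_fset A]) => z zQ /latticeP [q zq].
have [q0|q0] := eqVneq q (0, 0).
  by rewrite zq q0 /period /= mul0r addr0 inE eqxx.
rewrite inE zq map_f ?orbT //; apply: HA.
rewrite ler_pdivlMr // mulrC; apply: le_trans (H q q0) _; rewrite -zq.
have := square_cabs zQ; have := cabsD (z - p) p; rewrite subrK.
have := ler_norm r; lra.
Qed.

Lemma lattice_coordinates tau z : 0 < complex.Im tau -> exists a b : R, z = toC a + toC b * tau.
Proof.
move=> ht; exists (complex.Re z - complex.Im z / complex.Im tau * complex.Re tau), (complex.Im z / complex.Im tau).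
case: tau ht => u v /= v0; case: z => x y; apply/eqP; rewrite eq_complex /=; apply/andP.
by split; apply/eqP; field; rewrite gt_eqF.
Qed.

Lemma coordinates_off_lattice tau (a b : R) : 0 < complex.Im tau ->
  (forall n : int, a != n%:~R) \/ (forall n : int, b != n%:~R) ->
  ~ lattice tau (toC a + toC b * tau).
Proof.
move=> ht H [m [n]]; rewrite -!(rmorph_int (real_complex R)).
case: tau ht => u v /= v0 /eqP; rewrite eq_complex /= => /andP[/eqP h1 /eqP h2].
have bn : b = n%:~R.
  apply: (mulIf (_ : v != 0)); first by rewrite gt_eqF.
  by move: h2; rewrite !mul0r !addr0 !add0r.
have am : a = m%:~R by move: h1; rewrite bn; lra.
by case: H => [/(_ m)|/(_ n)]; rewrite ?am ?bn eqxx.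
Qed.

Lemma off_lattice_coordinates tau (a b : R) : ~ lattice tau (toC a + toC b * tau) ->
  (forall n : int, a != n%:~R) \/ (forall n : int, b != n%:~R).
Proof.
move=> H; have [h|h] := pselect (forall n : int, a != n%:~R); first by left.
right => n; apply/eqP => bn; apply: h => m; apply/eqP => am; apply: H.
by exists m, n; rewrite am bn -!(rmorph_int (real_complex R)).
Qed.

Lemma half_not_int (n : int) : (2^-1 : R) != n%:~R.
Proof.
apply/eqP => h; have : (1 : R) = (2 * n)%:~R by rewrite rmorphM /= -h divff.
rewrite -[1]/(1%:~R) => /intr_inj; lia.
Qed.

(** The complement of the lattice is connected.  In coordinates [z = a + b tau] a
    point with [b] not an integer moves horizontally to [a = 1/2] and then along
    [a = 1/2], which avoids the lattice; if [a] is not an integer the roles are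
    exchanged. *)
Lemma zero_derivative_constant tau (f : C -> C) : 0 < complex.Im tau ->
  (forall z, ~ lattice tau z -> isD f z 0) ->
  forall z w, ~ lattice tau z -> ~ lattice tau w -> f z = f w.
Proof.
move=> ht hD.
have seg a b : (forall t : R, 0 <= t <= 1 -> ~ lattice tau (a + toC t * (b - a))) -> f b = f a.
  move=> h; apply/eqP; rewrite -subr_eq0 -cabs_eq0 eq_le cabs_ge0 andbT.
  rewrite -[X in _ <= X](mul0r (cabs (b - a))).
  apply: (@mean_value_bound _ f (fun=> 0)) => t /h; first exact: hD.
  by rewrite cabs0.
have main z : ~ lattice tau z -> f z = f (toC 2^-1 + toC 2^-1 * tau).
  have [a [b ->]] := lattice_coordinates z ht => /off_lattice_coordinates [ha|hb].
    rewrite -[LHS](seg (toC a + toC b * tau) (toC a + toC 2^-1 * tau)).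
      apply/esym/seg => t _.
      have -> : toC a + toC 2^-1 * tau + toC t * (toC 2^-1 + toC 2^-1 * tau - (toC a + toC 2^-1 * tau))
         = toC (a + t * (2^-1 - a)) + toC 2^-1 * tau.
        by rewrite !(toCD, toCM, toCN); ring.
      by apply: coordinates_off_lattice => //; right; exact: half_not_int.
    move=> t _.
    have -> : toC a + toC b * tau + toC t * (toC a + toC 2^-1 * tau - (toC a + toC b * tau))
       = toC a + toC (b + t * (2^-1 - b)) * tau.
      by rewrite !(toCD, toCM, toCN); ring.
    by apply: coordinates_off_lattice => //; left.
  rewrite -[LHS](seg (toC a + toC b * tau) (toC 2^-1 + toC b * tau)).
    apply/esym/seg => t _.
    have -> : toC 2^-1 + toC b * tau + toC t * (toC 2^-1 + toC 2^-1 * tau - (toC 2^-1 + toC b * tau))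
       = toC 2^-1 + toC (b + t * (2^-1 - b)) * tau.
      by rewrite !(toCD, toCM, toCN); ring.
    by apply: coordinates_off_lattice => //; left; exact: half_not_int.
  move=> t _.
  have -> : toC a + toC b * tau + toC t * (toC 2^-1 + toC b * tau - (toC a + toC b * tau))
     = toC (a + t * (2^-1 - a)) + toC b * tau.
    by rewrite !(toCD, toCM, toCN); ring.
  by apply: coordinates_off_lattice => //; right.
by move=> z w /main -> /main ->.
Qed.

Definition doubly_periodic tau (B : set C) (f : C -> C) : Prop :=
  forall x, ~ B x -> f (x + 1) = f x /\ f (x + tau) = f x.

Lemma doubly_periodic_period tau (B : set C) f : (forall q x, B (x + period tau q) <-> B x) ->
  doubly_periodic tau B f -> forall q x, ~ B x -> f (x + period tau q) = f x.
Proof.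
move=> hB hp.
have l1 (n : nat) x : ~ B x -> f (x + period tau (Posz n, 0)) = f x.
  elim: n x => [|n IH] x hx; first by rewrite /period /= mul0r !addr0.
  have -> : x + period tau (Posz n.+1, 0) = x + period tau (Posz n, 0) + 1.
    by rewrite /period /= intS rmorphD /=; ring.
  by rewrite (hp _ _).1 ?IH // hB.
have l2 (n : nat) x : ~ B x -> f (x + period tau (0, Posz n)) = f x.
  elim: n x => [|n IH] x hx; first by rewrite /period /= mul0r !addr0.
  have -> : x + period tau (0, Posz n.+1) = x + period tau (0, Posz n) + tau.
    by rewrite /period /= intS rmorphD /=; ring.
  by rewrite (hp _ _).2 ?IH // hB.
have neg q : (forall x, ~ B x -> f (x + period tau q) = f x) ->
    forall x, ~ B x -> f (x + period tau (opp_index q)) = f x.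
  move=> h x hx; rewrite -(h (x + period tau (opp_index q))); last by rewrite hB.
  by rewrite period_neg subrK.
have l1z (m : int) x : ~ B x -> f (x + period tau (m, 0)) = f x.
  case: m => n; first exact: l1.
  by rewrite NegzE; have := neg (Posz n.+1, 0) (l1 n.+1) x; rewrite /opp_index /= oppr0.
have l2z (m : int) x : ~ B x -> f (x + period tau (0, m)) = f x.
  case: m => n; first exact: l2.
  by rewrite NegzE; have := neg (0, Posz n.+1) (l2 n.+1) x; rewrite /opp_index /= oppr0.
move=> [m n] x hx; have -> : x + period tau (m, n) = x + period tau (m, 0) + period tau (0, n).
  by rewrite /period /=; ring.
by rewrite l2z ?l1z // hB.
Qed.

Lemma reduce_mod_lattice tau z : 0 < complex.Im tau -> exists q, cabs (z - period tau q) <= 1 + cabs tau.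
Proof.
move=> ht; have [a [b ->]] := lattice_coordinates z ht.
exists (Num.floor a, Num.floor b); rewrite /period /= -!(rmorph_int (real_complex R)).
have -> : toC a + toC b * tau - (toC (Num.floor a)%:~R + toC (Num.floor b)%:~R * tau)
  = toC (a - (Num.floor a)%:~R) + toC (b - (Num.floor b)%:~R) * tau.
  by rewrite !(toCD, toCN); ring.
have fl (c : R) : `|c - (Num.floor c)%:~R| <= 1.
  have := floor_itv c; rewrite rmorphD /= => /andP[h1 h2].
  by rewrite ler_norml; lra.
apply: le_trans (cabsD _ _) _; rewrite cabsM !cabs_toC lerD //.
by rewrite ler_piMl ?cabs_ge0.
Qed.

(** By periodicity the values off [B] are those on one compact square, where local
    boundedness becomes boundedness. *)
Lemma bounded_elliptic_constant tau (B : set C) f : 0 < complex.Im tau -> locally_finite B ->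
  (forall q x, B (x + period tau q) <-> B x) -> doubly_periodic tau B f ->
  (forall z, ~ B z -> derivable2 f z) -> (forall z, B z -> bounded_near B f z) ->
  forall z w, ~ B z -> ~ B w -> f z = f w.
Proof.
move=> ht lf hB hp hC hb.
have hb' z : bounded_near B f z.
  have [Bz|Bz] := pselect (B z); first exact: hb.
  exists (cabs (f z) + 1); apply: filterS (derivable2_continuous_at (hC z Bz) ltr01) => w h _.
  by have := cabsD (f w - f z) (f z); rewrite subrK; lra.
have [K HK] := @bounded_near_square R B f 0 (1 + cabs tau) (fun z _ => hb' z).
apply: (liouville (K := K) lf) => // z Bz.
have [q hq] := reduce_mod_lattice z ht.
have E : z = (z - period tau q) + period tau q by rewrite subrK.
have Bz' : ~ B (z - period tau q) by move: Bz; rewrite {1}E hB.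
rewrite E (doubly_periodic_period hB hp) //; apply: HK => //.
by apply: cabs_square; rewrite subr0.
Qed.

(** Bounded on a punctured neighbourhood of 0. *)
Definition bounded0 (f : C -> C) : Prop := exists K : R, \forall x \near (0 : C), x != 0 -> cabs (f x) <= K.

Lemma bounded0_cst a : bounded0 (fun=> a).
Proof. by exists (cabs a); apply: near_all. Qed.
Lemma bounded0_add f g : bounded0 f -> bounded0 g -> bounded0 (fun x => f x + g x).
Proof.
move=> [K hK] [L hL]; exists (K + L); apply: filterS2 hK hL => x h1 h2 x0.
by apply: le_trans (cabsD _ _) _; rewrite lerD ?h1 ?h2.
Qed.
Lemma bounded0_mul f g : bounded0 f -> bounded0 g -> bounded0 (fun x => f x * g x).
Proof.
move=> [K hK] [L hL]; exists (K * L); apply: filterS2 hK hL => x h1 h2 x0.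
by rewrite cabsM; apply: ler_pM; rewrite ?cabs_ge0 ?h1 ?h2.
Qed.
Lemma bounded0_opp f : bounded0 f -> bounded0 (fun x => - f x).
Proof. by move=> [K hK]; exists K; apply: filterS hK => x; rewrite cabsN. Qed.
Lemma bounded0_sub f g : bounded0 f -> bounded0 g -> bounded0 (fun x => f x - g x).
Proof. by move=> h1 h2; apply: bounded0_add => //; exact: bounded0_opp. Qed.
Lemma bounded0_exp f n : bounded0 f -> bounded0 (fun x => f x ^+ n).
Proof.
move=> [K hK]; exists (K ^+ n); apply: filterS hK => x h x0.
by rewrite cabsX lerXn2r ?nnegrE ?cabs_ge0 ?(le_trans (cabs_ge0 _) (h x0)) ?h.
Qed.
Lemma isD_bounded0 f d : isD f 0 d -> bounded0 f.
Proof.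
move=> h; exists (cabs (f 0) + 1); apply: filterS (isD_continuous h ltr01) => w hw _.
by have := cabsD (f w - f 0) (f 0); rewrite subrK; lra.
Qed.
Lemma bounded0_id : bounded0 (fun x => x).
Proof. exact: isD_bounded0 (isD_id 0). Qed.
Lemma near_eq_bounded0 f g : bounded0 f -> (\forall x \near (0 : C), x != 0 -> g x = f x) -> bounded0 g.
Proof.
move=> [K hK] h; exists K; apply: filterS2 hK h => x h1 h2 x0; by rewrite h2 // h1.
Qed.

Lemma bounded0_div f d : f 0 = 0 -> isD f 0 d -> bounded0 (fun x => f x / x ^+ 1).
Proof.
move=> f0 /isDP /(_ 1 ltr01) [r r0 Hr].
exists (1 + cabs d); apply/nearCP; exists r => // x; rewrite subr0 => xr x0.
have := Hr x xr; rewrite add0r f0 subr0 mul1r => hx.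
rewrite expr1 cabs_div ler_pdivrMr ?cabs_gt0 // mulrDl mul1r -cabsM.
by have := cabsD (f x - d * x) (d * x); rewrite subrK; lra.
Qed.

(** Integration raises the order of vanishing at 0 by one. *)
Lemma bounded0_primitive f f' n : f 0 = 0 -> (\forall x \near (0 : C), isD f x (f' x)) -> f' 0 = 0 ->
  bounded0 (fun x => f' x / x ^+ n) -> bounded0 (fun x => f x / x ^+ n.+1).
Proof.
move=> f0 hD f'0 [K hK].
have [r r0 Hr] := (nearCP _ _).1 hD; have [s s0 Hs] := (nearCP _ _).1 hK.
exists `|K|; apply/nearCP; exists (Num.min r s); first by rewrite lt_min r0 s0.
move=> x; rewrite lt_min subr0 => /andP[xr xs] x0.
have x0' : 0 < cabs x by rewrite cabs_gt0.
have seg (t : R) : 0 <= t <= 1 -> cabs (0 + toC t * (x - 0)) <= cabs x.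
  move=> /andP[t0 zeta_term]; rewrite add0r subr0 cabsM cabs_toC ger0_norm //.
  by rewrite ler_piMl ?cabs_ge0.
have := @mean_value_bound _ f f' 0 x (`|K| * cabs x ^+ n); rewrite f0 !subr0 => H.
rewrite cabs_div cabsX ler_pdivrMr ?exprn_gt0 // exprSr mulrA; apply: H.
  by move=> t /seg; rewrite subr0 => h; apply: Hr; rewrite subr0; apply: le_lt_trans xr.
move=> t /seg; rewrite subr0; set y := 0 + _ => h.
have [->|y0] := eqVneq y 0; first by rewrite f'0 cabs0 mulr_ge0 // exprn_ge0 ?cabs_ge0.
have := Hs y; rewrite subr0 => /(_ (le_lt_trans h xs) y0).
rewrite cabs_div cabsX ler_pdivrMr ?exprn_gt0 ?cabs_gt0 // => /le_trans; apply.
apply: (@le_trans _ _ (`|K| * cabs y ^+ n)).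
  by rewrite ler_wpM2r ?exprn_ge0 ?cabs_ge0 ?ler_norm.
by rewrite ler_wpM2l // lerXn2r ?nnegrE ?cabs_ge0.
Qed.

End LatticeGeom.

(** * Weierstrass functions at a fixed lattice *)

Section Functions.
Variable R : realType.
Local Notation C := (cplx R).
Implicit Types (x z w tau a b : C) (q : int * int).

Definition zeta_series tau x : C := x^-1 + lattice_sum (@zeta_term R) x tau.
Definition wp_series tau x : C := (x ^+ 2)^-1 + lattice_sum (@wp_term R) x tau.
(** Up to the sign and the factorial, a derivative of wp. *)
Definition pow_series k tau x : C := (x ^+ k)^-1 + lattice_sum (@pow_term R k) x tau.
Definition wp1 tau x : C := - 2 * pow_series 3 tau x.
Definition wp2 tau x : C := 6 * pow_series 4 tau x.
Definition wp3 tau x : C := - 24 * pow_series 5 tau x.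
Definition wp4 tau x : C := 120 * pow_series 6 tau x.

Lemma wp_seriesE tau x : wp_series tau x = wp tau x. Proof. by []. Qed.

Section FixedTau.
Variable tau : C.
Hypothesis ht : 0 < complex.Im tau.
Local Notation nl x := (~ lattice tau x).
Local Notation T1 x := (lattice_sum (@zeta_term R) x tau).
Local Notation T2 x := (lattice_sum (@wp_term R) x tau).
Local Notation S k x := (lattice_sum (@pow_term R k) x tau).
Local Notation U1 x := (lattice_sum (@dtau_zeta_term R) x tau).
Local Notation U2 x := (lattice_sum (@dtau_wp_term R) x tau).
Local Notation V k x := (lattice_sum (@npow_term R k) x tau).

Lemma isD_zeta_series x : nl x -> isD (zeta_series tau) x (- wp_series tau x).
Proof.
move=> hx; apply: isD_eq (isD_add (isD_exprV 1 (isD_id x) (off_lattice_neq0 hx)) (isD_zeta_sum (lattice_off_nonzero_periods ht hx))) _.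
by rewrite /wp_series; ring.
Qed.
Lemma isD_wp_series x : nl x -> isD (wp_series tau) x (wp1 tau x).
Proof.
move=> hx; apply: isD_eq (isD_add (isD_exprV 2 (isD_id x) (off_lattice_neq0 hx)) (isD_wp_sum (lattice_off_nonzero_periods ht hx))) _.
by rewrite /wp1 /pow_series; ring.
Qed.
Lemma isD_pow_series k x : (3 <= k)%N -> nl x -> isD (pow_series k tau) x (- k%:R * pow_series k.+1 tau x).
Proof.
move=> k3 hx; apply: isD_eq (isD_add (isD_exprV k (isD_id x) (off_lattice_neq0 hx)) (isD_pow_sum k3 (lattice_off_nonzero_periods ht hx))) _.
by rewrite /pow_series; ring.
Qed.
Lemma isD_wp1 x : nl x -> isD (wp1 tau) x (wp2 tau x).
Proof.
move=> hx; apply: isD_eq (isD_mul (isD_cst _ _) (@isD_pow_series 3 x isT hx)) _.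
by rewrite /wp2; ring.
Qed.
Lemma isD_wp2 x : nl x -> isD (wp2 tau) x (wp3 tau x).
Proof.
move=> hx; apply: isD_eq (isD_mul (isD_cst _ _) (@isD_pow_series 4 x isT hx)) _.
by rewrite /wp3; ring.
Qed.
Lemma isD_wp3 x : nl x -> isD (wp3 tau) x (wp4 tau x).
Proof.
move=> hx; apply: isD_eq (isD_mul (isD_cst _ _) (@isD_pow_series 5 x isT hx)) _.
by rewrite /wp4; ring.
Qed.

Lemma derivable2_of_isD (f f' f'' : C -> C) x : (forall x, nl x -> isD f x (f' x)) ->
  (forall x, nl x -> isD f' x (f'' x)) -> nl x -> derivable2 f x.
Proof.
move=> h1 h2 hx; exists f'; split; last by exists (f'' x); exact: h2.
by apply: filterS (off_lattice_near ht hx) => y; exact: h1.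
Qed.
Lemma derivable2_wp_series x : nl x -> derivable2 (wp_series tau) x.
Proof. exact: derivable2_of_isD isD_wp_series isD_wp1. Qed.
Lemma derivable2_wp1 x : nl x -> derivable2 (wp1 tau) x.
Proof. exact: derivable2_of_isD isD_wp1 isD_wp2. Qed.
Lemma derivable2_wp2 x : nl x -> derivable2 (wp2 tau) x.
Proof. exact: derivable2_of_isD isD_wp2 isD_wp3. Qed.
Lemma derivable2_zeta_series x : nl x -> derivable2 (zeta_series tau) x.
Proof.
apply: (@derivable2_of_isD _ (fun x => - wp_series tau x) (fun x => - wp1 tau x)); first exact: isD_zeta_series.
by move=> y hy; apply: isD_opp; exact: isD_wp_series.
Qed.
Lemma derivable2_dtau_wp_sum x : nl x -> derivable2 (fun x => U2 x) x.
Proof.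
apply: (@derivable2_of_isD _ (fun x => - 6 * V 4 x) (fun x => - 6 * (- 4 * V 5 x))).
  by move=> y /(lattice_off_nonzero_periods ht); exact: isD_dtau_wp_sum.
move=> y /(lattice_off_nonzero_periods ht) hy; apply: isD_eq (isD_mul (isD_cst _ _) (@isD_npow_sum R 4 y tau isT hy)) _.
by ring.
Qed.

Lemma zeta_series_odd x : zeta_series tau (- x) = - zeta_series tau x.
Proof. by rewrite /zeta_series zeta_sum_odd // invrN opprD. Qed.
Lemma wp_series_even x : wp_series tau (- x) = wp_series tau x.
Proof. by rewrite /wp_series wp_sum_even // sqrrN. Qed.
Lemma wp1_odd x : wp1 tau (- x) = - wp1 tau x.
Proof. by rewrite /wp1 /pow_series cube_sum_odd // cubeN invrN; ring. Qed.

Lemma half1_off_lattice : nl (1 / 2).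
Proof.
have := @coordinates_off_lattice R tau 2^-1 0 ht (or_introl (@half_not_int R)).
by rewrite rmorph0 mul0r addr0 toCV rmorph_nat mul1r.
Qed.
Lemma half2_off_lattice : nl (tau / 2).
Proof.
have := @coordinates_off_lattice R tau 0 2^-1 ht (or_intror (@half_not_int R)).
by rewrite rmorph0 add0r toCV rmorph_nat mulrC.
Qed.
Lemma half3_off_lattice : nl ((1 + tau) / 2).
Proof.
have := @coordinates_off_lattice R tau 2^-1 2^-1 ht (or_intror (@half_not_int R)).
by rewrite toCV rmorph_nat mulrDl mul1r [tau / 2]mulrC.
Qed.
Lemma period10 : period tau (1, 0) = 1.
Proof. by rewrite /period /= mul0r addr0. Qed.
Lemma period01 : period tau (0, 1) = tau.
Proof. by rewrite /period /= mul1r add0r. Qed.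
Lemma off_lattice_add1 x : nl (x + 1) <-> nl x.
Proof. by have := lattice_shift tau x (1, 0); rewrite period10 => ->. Qed.
Lemma off_lattice_addtau x : nl (x + tau) <-> nl x.
Proof. by have := lattice_shift tau x (0, 1); rewrite period01 => ->. Qed.

Lemma pow_series_period k x q : (3 <= k)%N -> pow_series k tau (x + period tau q) = pow_series k tau x.
Proof. by move=> k3; exact: pow_sum_period. Qed.
Lemma wp1_period x q : wp1 tau (x + period tau q) = wp1 tau x.
Proof. by rewrite /wp1 pow_series_period. Qed.
Lemma wp2_period x q : wp2 tau (x + period tau q) = wp2 tau x.
Proof. by rewrite /wp2 pow_series_period. Qed.

(** The difference [wp(x + w) - wp(x)] is constant because [wp'] is periodic; at
    [x = - w/2] it vanishes by parity. *)
Lemma wp_series_half_period q x : nl (period tau q / 2) -> nl x -> wp_series tau (x + period tau q) = wp_series tau x.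
Proof.
move=> hq hx; pose f x := wp_series tau (x + period tau q) - wp_series tau x.
have := @zero_derivative_constant R tau f ht _ x (- (period tau q / 2)) hx.
have -> : f (- (period tau q / 2)) = 0.
  rewrite /f wp_series_even (_ : - _ + _ = period tau q / 2) ?subrr //.
  by field.
move=> H; apply/eqP; rewrite -subr_eq0; apply/eqP/H; last by rewrite lattice_opp.
move=> z hz; apply: isD_eq (isD_sub (isD_shift (isD_wp_series _)) (isD_wp_series hz)) _.
  by rewrite lattice_shift.
by rewrite wp1_period subrr.
Qed.
Lemma wp_series_doubly_periodic : doubly_periodic tau (lattice tau) (wp_series tau).
Proof.
move=> x hx; split.
  by have := @wp_series_half_period (1, 0) x; rewrite period10; apply => //; exact: half1_off_lattice.
by have := @wp_series_half_period (0, 1) x; rewrite period01; apply => //; exact: half2_off_lattice.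
Qed.
Lemma lattice_add_period q x : lattice tau (x + period tau q) <-> lattice tau x.
Proof. exact: lattice_shift. Qed.
Lemma wp_series_period q x : nl x -> wp_series tau (x + period tau q) = wp_series tau x.
Proof. exact: (doubly_periodic_period lattice_add_period wp_series_doubly_periodic). Qed.

Lemma zeta_series_quasi_period q : exists eta : C, forall x, nl x -> zeta_series tau (x + period tau q) - zeta_series tau x = eta.
Proof.
exists (zeta_series tau (1 / 2 + period tau q) - zeta_series tau (1 / 2)) => x hx.
apply: (@zero_derivative_constant R tau (fun x => zeta_series tau (x + period tau q) - zeta_series tau x) ht _ x _ hx half1_off_lattice).
move=> z hz; apply: isD_eq (isD_sub (isD_shift (isD_zeta_series _)) (isD_zeta_series hz)) _.
  by rewrite lattice_shift.
by rewrite wp_series_period // opprK addNr.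
Qed.

Lemma off_lattice_punctured0 : \forall x \near (0 : C), x != 0 -> nl x.
Proof.
apply: filterS (off_nonzero_periods_near (off_nonzero_periods0 ht)) => x hx x0; exact: off_nonzero_periods_lattice hx x0.
Qed.

Lemma pow_sum_bounded0 k : (3 <= k)%N -> bounded0 (fun x => S k x).
Proof. by move=> k3; exact: isD_bounded0 (isD_pow_sum k3 (off_nonzero_periods0 ht)). Qed.
Lemma dtau_wp_sum_bounded0 : bounded0 (fun x => U2 x).
Proof. exact: isD_bounded0 (isD_dtau_wp_sum (off_nonzero_periods0 ht)). Qed.
Lemma cube_sum0 : S 3 0 = 0.
Proof.
have := @cube_sum_odd R 0 tau ht; rewrite oppr0 => /eqP; rewrite -addr_eq0 -mulr2n mulrn_eq0 /=.
by move/eqP.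
Qed.
Lemma cube_sum_bounded0 : bounded0 (fun x => S 3 x / x ^+ 1).
Proof. exact: bounded0_div cube_sum0 (@isD_pow_sum R 3 0 tau isT (off_nonzero_periods0 ht)). Qed.
Lemma wp_sum_bounded0 : bounded0 (fun x => T2 x / x ^+ 2).
Proof.
apply: (@bounded0_primitive R (fun x => T2 x) (fun x => - 2 * S 3 x) 1).
- exact: wp_sum0.
- by apply: filterS (off_nonzero_periods_near (off_nonzero_periods0 ht)) => x; exact: isD_wp_sum.
- by rewrite cube_sum0 mulr0.
apply: near_eq_bounded0 (bounded0_mul (bounded0_cst (-2)) cube_sum_bounded0) _.
by apply: near_all => x _; rewrite mulrA.
Qed.
Lemma zeta_sum_bounded0 : bounded0 (fun x => T1 x / x ^+ 3).
Proof.
apply: (@bounded0_primitive R (fun x => T1 x) (fun x => - T2 x) 2).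
- exact: zeta_sum0.
- by apply: filterS (off_nonzero_periods_near (off_nonzero_periods0 ht)) => x; exact: isD_zeta_sum.
- by rewrite wp_sum0 oppr0.
apply: near_eq_bounded0 (bounded0_opp wp_sum_bounded0) _.
by apply: near_all => x _; rewrite mulNr.
Qed.

Lemma bounded_near_period f : (forall q x, nl x -> f (x + period tau q) = f x) -> bounded0 f ->
  forall z, lattice tau z -> bounded_near (lattice tau) f z.
Proof.
move=> hp [K hK] z /latticeP [q zq]; exists K.
have := @near_shift R z (- z) (fun x => x != 0 -> cabs (f x) <= K).
rewrite subrr => /(_ hK); apply: filterS => w hw nw.
have nw' : nl (w - z) by move=> h; apply: nw; rewrite -[w](subrK z) zq lattice_shift -zq.
have := hw (off_lattice_neq0 nw'); rewrite -(hp q) // -zq subrK //.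
Qed.

Lemma elliptic_bounded_near0 f : doubly_periodic tau (lattice tau) f -> (forall z, nl z -> derivable2 f z) -> bounded0 f ->
  exists c, forall z, nl z -> f z = c.
Proof.
move=> hp hC hb; exists (f (1 / 2)) => z hz.
apply: (bounded_elliptic_constant ht (locally_finite_lattice ht) lattice_add_period hp hC _ hz half1_off_lattice).
by apply: bounded_near_period => //; exact: (doubly_periodic_period lattice_add_period hp).
Qed.

Lemma wp1_doubly_periodic x : wp1 tau (x + 1) = wp1 tau x /\ wp1 tau (x + tau) = wp1 tau x.
Proof. by split; [have := wp1_period x (1, 0) | have := wp1_period x (0, 1)]; rewrite ?period10 ?period01. Qed.
Lemma wp2_doubly_periodic x : wp2 tau (x + 1) = wp2 tau x /\ wp2 tau (x + tau) = wp2 tau x.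
Proof. by split; [have := wp2_period x (1, 0) | have := wp2_period x (0, 1)]; rewrite ?period10 ?period01. Qed.

(** With [b = T2/x^2] bounded, [wp = x^-2 + x^2 b] and [wp'' = 6 x^-4 + O(1)]; the
    terms in [x^-4] cancel and no term in [x^-2] appears. *)
Lemma wp2_ode : exists A : C, forall x, nl x -> wp2 tau x = 6 * wp_series tau x ^+ 2 - A.
Proof.
pose f x := wp2 tau x - 6 * wp_series tau x ^+ 2.
have [||| c hc] := @elliptic_bounded_near0 f.
- move=> x hx; have [p1 p2] := wp_series_doubly_periodic hx; have [q1 q2] := wp2_doubly_periodic x.
  by rewrite /f p1 p2 q1 q2.
- move=> z hz; apply: derivable2_sub; first exact: derivable2_wp2.
  by apply: derivable2_mul (derivable2_cst _ _) (derivable2_exp _ (derivable2_wp_series hz)).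
- have hb := bounded0_sub (bounded0_sub (bounded0_mul (bounded0_cst 6) (@pow_sum_bounded0 4 isT)) (bounded0_mul (bounded0_cst 12) wp_sum_bounded0))
    (bounded0_mul (bounded0_cst 6) (bounded0_exp 2 (bounded0_mul (bounded0_id R) (bounded0_mul (bounded0_id R) wp_sum_bounded0)))).
  apply: near_eq_bounded0 hb _; apply: near_all => x x0.
  by rewrite /f /wp2 /pow_series /wp_series; field.
by exists (- c) => x hx; rewrite opprK -(hc x hx) /f; ring.
Qed.

Lemma wp1_ode A : (forall x, nl x -> wp2 tau x = 6 * wp_series tau x ^+ 2 - A) ->
  exists B : C, forall x, nl x -> wp1 tau x ^+ 2 = 4 * wp_series tau x ^+ 3 - 2 * A * wp_series tau x - B.
Proof.
move=> hA; pose f x := wp1 tau x ^+ 2 - (4 * wp_series tau x ^+ 3 - 2 * A * wp_series tau x).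
exists (- f (1 / 2)) => x hx.
suff -> : f (1 / 2) = f x by rewrite /f; ring.
apply: (zero_derivative_constant ht _ half1_off_lattice hx) => z hz.
apply: isD_eq (isD_sub (isD_exp 2 (isD_wp1 hz)) (isD_sub (isD_mul (isD_cst _ _) (isD_exp 3 (isD_wp_series hz)))
  (isD_mul (isD_cst _ _) (isD_wp_series hz)))) _.
by rewrite /= hA //; ring.
Qed.

Lemma wp1_half_period x q : x + x = period tau q -> wp1 tau x = 0.
Proof.
move=> h; have := wp1_period (- x) q; rewrite -h addKr wp1_odd => /eqP.
rewrite -addr_eq0 -mulr2n mulrn_eq0 /=; by move/eqP.
Qed.

End FixedTau.
End Functions.

(** * The half-period values are distinct *)

Section Distinct.
Variable R : realType.
Local Notation C := (cplx R).
Implicit Types (x z w a b h e : C) (q : int * int).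
Variable tau : C.
Hypothesis ht : 0 < complex.Im tau.
Local Notation nl x := (~ lattice tau x).

Lemma wp_neq_near0 e : \forall x \near (0 : C), x != 0 -> nl x /\ wp_series tau x != e.
Proof.
pose g x := 1 + x ^+ 2 * (lattice_sum (@wp_term R) x tau - e).
have D : isD g 0 (0 + (2%:R * 0 ^+ 1 * 1 * (lattice_sum (@wp_term R) 0 tau - e) + 0 ^+ 2 * (- 2 * lattice_sum (@pow_term R 3) 0 tau - 0))).
  apply: isD_add (isD_cst _ _) (isD_mul (isD_exp 2 (isD_id _)) (isD_sub (isD_wp_sum (off_nonzero_periods0 ht)) (isD_cst _ _))).
have g0 : g 0 != 0 by rewrite /g expr0n /= mul0r addr0 oner_eq0.
apply: filterS2 (isD_neq0 D g0) (off_lattice_punctured0 ht) => x gx nx x0; split; first exact: nx.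
apply: contraNneq gx => E; rewrite /g; apply/eqP.
have -> : lattice_sum (@wp_term R) x tau - e = - (x ^+ 2)^-1 by rewrite -E /wp_series; ring.
by field.
Qed.

Lemma double_pole_bounded0 e : bounded0 (fun x => x ^+ 2 * (wp_series tau x - e)).
Proof.
have hb := bounded0_add (bounded0_cst 1) (bounded0_mul (bounded0_exp 2 (bounded0_id R)) (bounded0_sub (bounded0_mul (bounded0_exp 2 (bounded0_id R)) (wp_sum_bounded0 ht)) (bounded0_cst e))).
by apply: near_eq_bounded0 hb _; apply: near_all => x x0; rewrite /wp_series; field.
Qed.

Lemma locally_finite_shift (B : set C) h : locally_finite B -> locally_finite [set x | B (x + h)].
Proof.
move=> lf p r; have [L HL] := lf (p + h) r.
exists [seq y - h | y <- L] => z [z1 z2] Bz; rewrite -[z](addrK h); apply: map_f; apply: HL => //.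
by rewrite /in_square opprD addrACA subrr addr0; split.
Qed.
Lemma locally_finiteU (B B' : set C) : locally_finite B -> locally_finite B' -> locally_finite [set x | B x \/ B' x].
Proof.
move=> lf lf' p r; have [L HL] := lf p r; have [L' HL'] := lf' p r.
exists (L ++ L') => z zQ [Bz|Bz]; rewrite mem_cat; first by rewrite HL.
by rewrite HL' // orbT.
Qed.

(** Multiplying [wp(x + h) - e] by [(x - q)^2] for the poles [q] in a large square
    makes it bounded there, so the identity theorem propagates its vanishing to
    points close to a pole of wp, where wp differs from [e]. *)
Lemma wp_not_locally_constant h e : ~ \forall x \near (0 : C), x != 0 -> wp_series tau (x + h) = e.
Proof.
move=> he.
(* A point near the pole at 0 where wp differs from [e]; the contradiction is
   found at [z0 = x0 - h]. *)
have [x0 x0h [nx Px]] : exists2 x0 : C, x0 != 0 & nl x0 /\ wp_series tau x0 != e.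
  have [d d0 Hd] := (nearCP _ _).1 (wp_neq_near0 e).
  have x0 : toC (d / 2) != 0 :> C by rewrite -cabs_gt0 cabs_toC ger0_norm; lra.
  exists (toC (d / 2)) => //; apply: Hd => //.
  by rewrite subr0 cabs_toC ger0_norm; lra.
pose B : set C := [set x | lattice tau (x + h)].
have lf : locally_finite B by apply: locally_finite_shift; exact: locally_finite_lattice.
pose z0 := x0 - h; pose r := 2 * cabs z0 + 1.
have r0 : 0 < r by rewrite /r; have := cabs_ge0 z0; lra.
have [L0 HL0] := lf 0 r.
pose L := [seq q <- L0 | `[< B q >]].
pose f x := (wp_series tau (x + h) - e) * \prod_(q <- L) (x - q) ^+ 2.
have pC z : derivable2 (fun x => \prod_(q <- L) (x - q) ^+ 2) z.
  by apply: derivable2_prod => q; apply: derivable2_exp; apply: derivable2_sub; [exact: derivable2_id|exact: derivable2_cst].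
have fC z : ~ B z -> derivable2 f z.
  move=> Bz; apply: derivable2_mul => //; apply: derivable2_sub (derivable2_cst _ _).
  by apply: derivable2_shift; exact: derivable2_wp_series.
have fb z : in_square 0 r z -> bounded_near B f z.
  move=> zQ; have [Bz|Bz] := pselect (B z); last first.
    exists (cabs (f z) + 1); apply: filterS (derivable2_continuous_at (fC z Bz) ltr01) => w hw _.
    by have := cabsD (f w - f z) (f z); rewrite subrK; lra.
  have zL : z \in L by rewrite mem_filter HL0 // andbT; apply/asboolP.
  have /latticeP [q zq] : lattice tau (z + h) by [].
  have [K hK] := double_pole_bounded0 e.
  have hK' := @near_shift R z (- z) (fun x => x != 0 -> cabs (x ^+ 2 * (wp_series tau x - e)) <= K).
  rewrite subrr in hK'; have {hK'}hK := hK' hK.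
  pose G x := \prod_(q <- rem z L) (x - q) ^+ 2.
  have GC : derivable2 G z.
    by apply: derivable2_prod => ?; apply: derivable2_exp; apply: derivable2_sub; [exact: derivable2_id|exact: derivable2_cst].
  exists (K * (cabs (G z) + 1)).
  apply: filterS2 hK (derivable2_continuous_at GC ltr01) => w h1 h2 Bw.
  have wh : w + h = (w - z) + period tau q by rewrite -zq; ring.
  have nwz : nl (w - z) by move=> hh; apply: Bw; rewrite /B /= wh lattice_shift.
  have := h1 (off_lattice_neq0 nwz) => h3.
  have -> : f w = (w - z) ^+ 2 * (wp_series tau (w - z) - e) * G w.
    rewrite /f wh wp_series_period // (big_rem z) //= /G; ring.
  rewrite cabsM; apply: ler_pM; rewrite ?cabs_ge0 //.
  by have := cabsD (G w - G z) (G z); rewrite subrK; lra.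
have f0 : \forall w \near (0 : C), ~ B w -> f w = 0.
  have [B0|B0] := pselect (B 0).
    apply: filterS he => w hw Bw; rewrite /f hw ?subrr ?mul0r //.
    by apply: contra_notN Bw => /eqP ->.
  have E0 : wp_series tau (0 + h) = e.
    have D : exists d, isD (fun x => wp_series tau (x + h) - e) 0 d.
      by eexists; apply: isD_sub (isD_cst _ _); apply: isD_shift; exact: isD_wp_series.
    have [d {}D] := D; apply/eqP/negPn/negP => ne.
    have := isD_neq0 D; rewrite subr_eq0 => /(_ ne) ne'.
    have [s s0 Hs] := (nearCP _ _).1 (filterI he ne').
    have st : toC (s / 2) != 0 :> C by rewrite -cabs_gt0 cabs_toC ger0_norm; lra.
    have [|h1 /eqP h2] := Hs (toC (s / 2)); first by rewrite subr0 cabs_toC ger0_norm; lra.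
    by apply: h2; rewrite h1 // subrr.
  apply: filterS he => w hw Bw; rewrite /f.
  by have [->|w0] := eqVneq w 0; [rewrite E0 subrr mul0r | rewrite hw // subrr mul0r].
have nB : ~ B z0 by rewrite /B /= /z0 subrK.
have := @identity_theorem R B f 0 r lf r0 fC fb f0 z0 _ nB.
rewrite subr0 => /(_ _) H; have {H} : f z0 = 0 by apply: H; rewrite /r; lra.
move/eqP; rewrite /f /z0 subrK mulf_eq0 subr_eq0 (negbTE Px) /=.
apply/negP; rewrite prodf_seq_neq0; apply/allP => q.
rewrite mem_filter => /andP[/asboolP Bq _] /=; rewrite expf_neq0 // subr_eq0.
by apply/eqP => E; apply: nB; rewrite /z0 E.
Qed.

(** If [wp h = wp h' = e], consider [F x = (wp(x + h) - e)(wp x - e)].  At 0 the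
    double pole of the second factor meets a double zero of the first, as
    [wp'(h) = 0]; [F] is also invariant under [x |-> x + h], so it is bounded
    near all its singular points, hence constant.  The constant is 0, its value
    at [h'].  Close to 0 the second factor is not 0, so [wp] would equal [e]
    near [h]. *)
Lemma wp_half_periods_neq h h' q : h + h = period tau q -> nl h -> nl h' -> nl (h' + h) ->
  wp_series tau h != wp_series tau h'.
Proof.
move=> hq nh nh' nhh; apply/eqP => E; set e := wp_series tau h in E.
pose B : set C := [set x | lattice tau x \/ lattice tau (x + h)].
pose F x := (wp_series tau (x + h) - e) * (wp_series tau x - e).
have Bq p x : B (x + period tau p) <-> B x.
  by rewrite /B /= addrAC !lattice_shift.
have Bh x : B (x + h) <-> B x.
  rewrite /B /= -addrA hq lattice_shift; tauto.
have Fp p x : ~ B x -> F (x + period tau p) = F x.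
  move=> nB; rewrite /F [x + _ + h]addrAC !wp_series_period // => hx; apply: nB; by [left|right].
have Fh x : ~ B x -> F (x + h) = F x.
  move=> nB; have nx : nl x by move=> hx; apply: nB; left.
  have E0 : wp_series tau (x + h + h) = wp_series tau x by rewrite -addrA hq; exact: wp_series_period.
  by rewrite /F E0 mulrC.
have FC z : ~ B z -> derivable2 F z.
  move=> nB; apply: derivable2_mul; apply: derivable2_sub (derivable2_cst _ _).
    by apply: derivable2_shift; apply: derivable2_wp_series => // hx; apply: nB; right.
  by apply: derivable2_wp_series => // hx; apply: nB; left.
have nlh : \forall x \near (0 : C), nl (x + h).
  have := @near_shift R 0 h (fun w => nl w); rewrite add0r; apply.
  exact: off_lattice_near.
have gb : bounded0 (fun x => (wp_series tau (x + h) - e) / x ^+ 2).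
  apply: (@bounded0_primitive R (fun x => wp_series tau (x + h) - e) (fun x => wp1 tau (x + h)) 1).
  - by rewrite add0r subrr.
  - apply: filterS nlh => x hx; rewrite -[wp1 _ _]subr0; apply: isD_sub (isD_cst _ _).
    by apply: isD_shift; exact: isD_wp_series.
  - by rewrite add0r (wp1_half_period ht hq).
  apply: (@bounded0_div R (fun x => wp1 tau (x + h)) (wp2 tau (0 + h))).
    by rewrite add0r (wp1_half_period ht hq).
  by apply: isD_shift; apply: isD_wp1 => //; rewrite add0r.
have Fb : bounded0 F.
  apply: near_eq_bounded0 (bounded0_mul gb (double_pole_bounded0 e)) _; apply: near_all => x x0.
  by rewrite /F; field.
have Fl z : lattice tau z -> bounded_near B F z.
  move=> /latticeP [p zp]; have [K hK] := Fb; exists K.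
  have := @near_shift R z (- z) (fun x => x != 0 -> cabs (F x) <= K).
  rewrite subrr => /(_ hK); apply: filterS => w hw nw.
  have nw' : ~ B (w - z) by move=> hB; apply: nw; rewrite -[w](subrK z) zp Bq -zp.
  have wz : w - z != 0 by apply/eqP => E0; apply: nw'; rewrite E0; left; exact: lattice0.
  by have := hw wz; rewrite -(Fp p) // -zp subrK.
(* The singular points are [Lambda] and [Lambda - h]; the second set is reached
   from the first by the invariance [Fh]. *)
have cst := @bounded_elliptic_constant R tau B F ht _ Bq _ FC.
have {}cst : forall z w, ~ B z -> ~ B w -> F z = F w.
  apply: cst.
  - apply: locally_finiteU; first exact: locally_finite_lattice.
    by apply: locally_finite_shift; exact: locally_finite_lattice.
  - move=> x hx; split.
      by have := Fp (1, 0) x hx; rewrite period10.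
    by have := Fp (0, 1) x hx; rewrite period01.
  - move=> z [hz|hz]; first exact: Fl.
    have [K hK] := Fl _ hz; exists K.
    apply: filterS (near_shift hK) => w hw nw.
    by rewrite -Fh //; apply: hw; rewrite Bh.
have nB' : ~ B h' by move=> [].
have F0 x : ~ B x -> F x = 0 by move=> hx; rewrite (cst x h' hx nB') /F -E subrr mulr0.
apply: (@wp_not_locally_constant h e).
apply: filterS2 (wp_neq_near0 e) nlh => x hx nxh x0; have [nx Pe] := hx x0.
have /eqP := F0 x ltac:(by move=> []).
by rewrite /F mulf_eq0 subr_eq0 [wp_series tau x - e == 0]subr_eq0 (negbTE Pe) orbF => /eqP.
Qed.

Definition half_value1 := wp_series tau (1 / 2).
Definition half_value2 := wp_series tau (tau / 2).
Definition half_value3 := wp_series tau ((1 + tau) / 2).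

Lemma halfD x : x / 2 + x / 2 = x. Proof. by field. Qed.
Lemma period11 : period tau (1, 1) = 1 + tau.
Proof. by rewrite /period /= mul1r. Qed.
Lemma halfD1 : 1 / 2 + 1 / 2 = period tau (1, 0). Proof. by rewrite halfD period10. Qed.
Lemma halfD2 : tau / 2 + tau / 2 = period tau (0, 1). Proof. by rewrite halfD period01. Qed.
Lemma halfD3 : (1 + tau) / 2 + (1 + tau) / 2 = period tau (1, 1). Proof. by rewrite halfD period11. Qed.

Lemma half_value12 : half_value1 != half_value2.
Proof.
apply: (wp_half_periods_neq halfD1); [exact: half1_off_lattice | exact: half2_off_lattice |].
by rewrite -mulrDl addrC; exact: half3_off_lattice.
Qed.
Lemma half_value13 : half_value1 != half_value3.
Proof.
apply: (wp_half_periods_neq halfD1); [exact: half1_off_lattice | exact: half3_off_lattice |].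
have -> : (1 + tau) / 2 + 1 / 2 = tau / 2 + period tau (1, 0) by rewrite period10; field.
by rewrite lattice_shift; exact: half2_off_lattice.
Qed.
Lemma half_value23 : half_value2 != half_value3.
Proof.
apply: (wp_half_periods_neq halfD2); [exact: half2_off_lattice | exact: half3_off_lattice |].
have -> : (1 + tau) / 2 + tau / 2 = 1 / 2 + period tau (0, 1) by rewrite period01; field.
by rewrite lattice_shift; exact: half1_off_lattice.
Qed.

(** Three distinct roots of [4 X^3 - 2 A X - B] determine its coefficients. *)
Lemma half_values_vieta A : (forall x, nl x -> wp2 tau x = 6 * wp_series tau x ^+ 2 - A) ->
  half_value1 + half_value2 + half_value3 = 0 /\ A = - 2 * (half_value1 * half_value2 + half_value1 * half_value3 + half_value2 * half_value3).
Proof.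
move=> hA; have [B hB] := wp1_ode ht hA.
have root x q : x + x = period tau q -> nl x -> 4 * wp_series tau x ^+ 3 - 2 * A * wp_series tau x - B = 0.
  by move=> hx nx; rewrite -hB // (wp1_half_period ht hx) expr0n.
have r1 := root _ _ halfD1 (half1_off_lattice ht); rewrite -/half_value1 in r1.
have r2 := root _ _ halfD2 (half2_off_lattice ht); rewrite -/half_value2 in r2.
have r3 := root _ _ halfD3 (half3_off_lattice ht); rewrite -/half_value3 in r3.
have d12 : half_value1 - half_value2 != 0 by rewrite subr_eq0 half_value12.
have d13 : half_value1 - half_value3 != 0 by rewrite subr_eq0 half_value13.
have d23 : half_value2 - half_value3 != 0 by rewrite subr_eq0 half_value23.
have h12 : 4 * (half_value1 ^+ 2 + half_value1 * half_value2 + half_value2 ^+ 2) - 2 * A = 0.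
  apply: (mulfI d12); rewrite mulr0 -[RHS](subrr (0 : C)) -{1}r1 -r2; ring.
have h13 : 4 * (half_value1 ^+ 2 + half_value1 * half_value3 + half_value3 ^+ 2) - 2 * A = 0.
  apply: (mulfI d13); rewrite mulr0 -[RHS](subrr (0 : C)) -{1}r1 -r3; ring.
have two : (2 : C) != 0 by rewrite pnatr_eq0.
have four : (4 : C) != 0 by rewrite pnatr_eq0.
have s0 : half_value1 + half_value2 + half_value3 = 0.
  apply: (mulfI four); apply: (mulfI d23); rewrite !mulr0 -[RHS](subrr (0 : C)) -{1}h12 -h13; ring.
split => //; apply: (mulfI two); apply/eqP; rewrite eq_sym -subr_eq0; apply/eqP.
have e3 : half_value3 = - (half_value1 + half_value2) by apply/eqP; rewrite -subr_eq0 opprK addrC s0.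
by rewrite -h12 e3; ring.
Qed.

End Distinct.

(** * Dependence on the modulus *)

Section TauDer.
Variable R : realType.
Local Notation C := (cplx R).
Implicit Types (x z w tau a b : C).

Lemma isD_affine a b tau : isD (fun t : C => a + b * t) tau b.
Proof.
apply: isD_eq (isD_add (isD_cst _ _) (isD_mul (isD_cst _ _) (isD_id _))) _.
by rewrite mul0r !add0r mulr1.
Qed.

(** Chain rule: the path derivative is the derivative in [tau] at fixed [z] plus
    [b] times the derivative in [z]. *)
Lemma isD_wp_path a b tau : 0 < complex.Im tau -> ~ lattice tau (a + b * tau) ->
  isD (fun t => wp_series t (a + b * t)) tau (lattice_sum (@dtau_wp_term R) (a + b * tau) tau + b * wp1 tau (a + b * tau)).
Proof.
move=> ht hn; apply: isD_eq (isD_add (isD_exprV 2 (isD_affine a b tau) (off_lattice_neq0 hn))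
   (isD_wp_sum_path (lattice_off_nonzero_periods ht hn))) _.
by rewrite /wp1 /pow_series; ring.
Qed.

Lemma isD_zeta_path a b tau : 0 < complex.Im tau -> ~ lattice tau (a + b * tau) ->
  isD (fun t => zeta_series t (a + b * t)) tau (lattice_sum (@dtau_zeta_term R) (a + b * tau) tau - b * wp_series tau (a + b * tau)).
Proof.
move=> ht hn; apply: isD_eq (isD_add (isD_exprV 1 (isD_affine a b tau) (off_lattice_neq0 hn))
   (isD_zeta_sum_path (lattice_off_nonzero_periods ht hn))) _.
by rewrite /wp_series; ring.
Qed.

Lemma near_Im_gt0 tau : 0 < complex.Im tau -> \forall t \near tau, 0 < complex.Im t.
Proof.
move=> ht; have [r r0 Hr] := near_upper_half_plane ht; apply/nearCP; exists r => // t /Hr [h _]; lra.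
Qed.

Lemma dtau_wp_sum_add1 x tau : 0 < complex.Im tau -> ~ lattice tau x ->
  lattice_sum (@dtau_wp_term R) (x + 1) tau = lattice_sum (@dtau_wp_term R) x tau.
Proof.
move=> ht hx.
have e0 a t : a + 0 * t = a :> C by rewrite mul0r addr0.
have h1 : isD (fun t => wp_series t (x + 1)) tau (lattice_sum (@dtau_wp_term R) (x + 1) tau).
  have := @isD_wp_path (x + 1) 0 tau ht; rewrite e0 mul0r addr0 off_lattice_add1 => /(_ hx).
  by apply: eq_isD => t; rewrite e0.
have h2 : isD (fun t => wp_series t x) tau (lattice_sum (@dtau_wp_term R) x tau).
  have := @isD_wp_path x 0 tau ht; rewrite e0 mul0r addr0 => /(_ hx).
  by apply: eq_isD => t; rewrite e0.
apply: isD_unique h1 _; apply: isD_near h2.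
have := @off_lattice_near_tau R x 0 tau ht; rewrite e0 => /(_ hx).
by apply: filterS => t; rewrite e0 => -[ht' hx']; have [-> _] := wp_series_doubly_periodic ht' hx'.
Qed.

(** Differentiate [wp (x + tau | tau) = wp (x | tau)] in [tau]. *)
Lemma dtau_wp_sum_addtau x tau : 0 < complex.Im tau -> ~ lattice tau x ->
  lattice_sum (@dtau_wp_term R) (x + tau) tau = lattice_sum (@dtau_wp_term R) x tau - wp1 tau x.
Proof.
move=> ht hx.
have e0 a t : a + 0 * t = a :> C by rewrite mul0r addr0.
have h1 := @isD_wp_path x 1 tau ht; rewrite !mul1r off_lattice_addtau in h1; have {}h1 := h1 hx.
have h2 : isD (fun t => wp_series t x) tau (lattice_sum (@dtau_wp_term R) x tau).
  have := @isD_wp_path x 0 tau ht; rewrite e0 mul0r addr0 => /(_ hx).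
  by apply: eq_isD => t; rewrite e0.
have E : lattice_sum (@dtau_wp_term R) (x + tau) tau + wp1 tau (x + tau) = lattice_sum (@dtau_wp_term R) x tau.
  apply: isD_unique h1 _; apply: isD_near h2.
  have := @off_lattice_near_tau R x 0 tau ht; rewrite e0 => /(_ hx).
  apply: filterS => t; rewrite e0 => -[ht' hx'].
  by have [_] := wp_series_doubly_periodic ht' hx'; rewrite mul1r => ->.
by rewrite -E (wp1_doubly_periodic ht x).2 addrK.
Qed.

Section Heat.
Variable tau : C.
Hypothesis ht : 0 < complex.Im tau.
Variables eta1 eta2 : C.
Local Notation nl x := (~ lattice tau x).
Local Notation U1 x := (lattice_sum (@dtau_zeta_term R) x tau).
Local Notation U2 x := (lattice_sum (@dtau_wp_term R) x tau).
Hypothesis h1 : forall x, nl x -> zeta_series tau (x + 1) - zeta_series tau x = eta1.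
Hypothesis h2 : forall x, nl x -> zeta_series tau (x + tau) - zeta_series tau x = eta2.
Let c := tau * eta1 - eta2.

(** Translation by [tau] adds [- wp'] to [d(wp)/d(tau)] and [- c] to
    [zeta - z eta1], so the difference of the two sides is elliptic.  Near 0,
    writing [zeta = 1/x + x^3 a], [wp = 1/x^2 + x^2 b], [wp' = -2/x^3 - 2 x g] with
    [a, b, g] bounded, all negative powers of [x] cancel. *)
Lemma wp_heat_equation : exists kap : C, forall x, nl x ->
  c * U2 x = 2 * wp_series tau x ^+ 2 - 2 * eta1 * wp_series tau x + (zeta_series tau x - x * eta1) * wp1 tau x - kap.
Proof.
pose f x := c * U2 x - (2 * wp_series tau x ^+ 2 - 2 * eta1 * wp_series tau x + (zeta_series tau x - x * eta1) * wp1 tau x).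
have [||| k hk] := @elliptic_bounded_near0 R tau ht f.
- move=> x hx; have [p1 p2] := wp_series_doubly_periodic ht hx; have [q1 q2] := wp1_doubly_periodic ht x.
  rewrite /f p1 p2 q1 q2 dtau_wp_sum_add1 // dtau_wp_sum_addtau //.
  have -> : zeta_series tau (x + 1) = zeta_series tau x + eta1 by rewrite -(h1 hx) [RHS]addrC subrK.
  have -> : zeta_series tau (x + tau) = zeta_series tau x + eta2 by rewrite -(h2 hx) [RHS]addrC subrK.
  by split; rewrite /c; ring.
- move=> z hz; apply: derivable2_sub.
    by apply: derivable2_mul (derivable2_cst _ _) _; exact: derivable2_dtau_wp_sum.
  apply: derivable2_add.
    apply: derivable2_sub; first by apply: derivable2_mul (derivable2_cst _ _) (derivable2_exp _ (derivable2_wp_series ht hz)).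
    by apply: derivable2_mul (derivable2_cst _ _) (derivable2_wp_series ht hz).
  apply: derivable2_mul (derivable2_wp1 ht hz); apply: derivable2_sub (derivable2_zeta_series ht hz) _.
  by apply: derivable2_mul (derivable2_id _) (derivable2_cst _ _).
- have bx := bounded0_id R; have x2 := bounded0_exp 2 bx; have x4 := bounded0_exp 4 bx.
  have al := zeta_sum_bounded0 ht; have be := wp_sum_bounded0 ht; have ga := cube_sum_bounded0 ht.
  have hb := bounded0_sub (bounded0_mul (bounded0_cst c) (dtau_wp_sum_bounded0 ht))
    (bounded0_add (bounded0_sub (bounded0_add (bounded0_mul (bounded0_cst 4) be) (bounded0_mul (bounded0_cst 2) (bounded0_mul x4 (bounded0_exp 2 be))))
      (bounded0_mul (bounded0_cst (2 * eta1)) (bounded0_mul x2 be)))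
     (bounded0_mul (bounded0_cst (-2)) (bounded0_sub (bounded0_add (bounded0_add ga al) (bounded0_mul x4 (bounded0_mul al ga)))
         (bounded0_mul (bounded0_cst eta1) (bounded0_mul x2 ga))))).
  apply: near_eq_bounded0 hb _; apply: near_all => x x0.
  by rewrite /f /wp1 /pow_series /wp_series /zeta_series; field.
by exists (- k) => x hx; rewrite opprK -(hk x hx) /f; ring.
Qed.

(** The difference of the two sides has derivative 0 in [x] by the equation for wp
    and [wp'' = 6 wp^2 - A]; it is odd, hence its constant value is 0. *)
Lemma zeta_heat_equation A : (forall x, nl x -> wp2 tau x = 6 * wp_series tau x ^+ 2 - A) ->
  (forall x, nl x -> c * U2 x =
     2 * wp_series tau x ^+ 2 - 2 * eta1 * wp_series tau x + (zeta_series tau x - x * eta1) * wp1 tau x - 2 / 3 * A) ->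
  forall x, nl x -> c * U1 x = - (wp1 tau x / 2) - (zeta_series tau x - x * eta1) * wp_series tau x
     - eta1 * zeta_series tau x + A / 6 * x.
Proof.
move=> hA hU x hx.
pose f x := c * U1 x + wp1 tau x / 2 + (zeta_series tau x - x * eta1) * wp_series tau x + eta1 * zeta_series tau x - A / 6 * x.
have fD z : nl z -> isD f z 0.
  move=> hz; apply: isD_eq (isD_sub (isD_add (isD_add (isD_add
    (isD_mul (isD_cst _ _) (isD_dtau_zeta_sum (lattice_off_nonzero_periods ht hz)))
    (isD_mul (isD_wp1 ht hz) (isD_cst _ _)))
    (isD_mul (isD_sub (isD_zeta_series ht hz) (isD_mul (isD_id _) (isD_cst _ _))) (isD_wp_series ht hz)))
    (isD_mul (isD_cst _ _) (isD_zeta_series ht hz))) (isD_mul (isD_cst _ _) (isD_id _))) _.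
  by rewrite hA // mulrN hU //; field.
have hx' : nl (- x) by rewrite lattice_opp.
have f_odd : f (- x) = - f x.
  by rewrite /f dtau_zeta_sum_odd // wp1_odd // zeta_series_odd // wp_series_even //; ring.
have := zero_derivative_constant ht fD hx' hx; rewrite f_odd => /eqP; rewrite eq_sym -addr_eq0 -mulr2n mulrn_eq0 /=.
move=> /eqP; rewrite /f => E; apply/eqP; rewrite -subr_eq0; apply/eqP; rewrite -E; ring.
Qed.
End Heat.

Section Etas.
Variables eta1 eta2 : C -> C.
Hypothesis h1 : forall tau, 0 < complex.Im tau -> forall x, ~ lattice tau x -> zeta_series tau (x + 1) - zeta_series tau x = eta1 tau.
Hypothesis h2 : forall tau, 0 < complex.Im tau -> forall x, ~ lattice tau x -> zeta_series tau (x + tau) - zeta_series tau x = eta2 tau.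

(** Evaluate the quasi-periodicity at [- w/2], using that zeta is odd. *)
Lemma quasi_period_half tau w : 0 < complex.Im tau -> ~ lattice tau (w / 2) ->
  forall eta, (forall x, ~ lattice tau x -> zeta_series tau (x + w) - zeta_series tau x = eta) ->
  eta = 2 * zeta_series tau (w / 2).
Proof.
move=> ht hw eta H; rewrite -(H (- (w / 2))); last by rewrite lattice_opp.
by rewrite zeta_series_odd // (_ : - (w / 2) + w = w / 2); [ring | field].
Qed.

(** The values of the two heat equations at the half periods, together with the
    relations that fix the constants: [kap = 2 A / 3] from the derivative of
    [e_1 + e_2 + e_3 = 0], and [c <> 0]. *)
Lemma quasi_period_system tau : 0 < complex.Im tau ->
  exists A d1 d2 D1 D2 D3 : C, let c := tau * eta1 tau - eta2 tau in
  [/\ c != 0, A = - 2 * (half_value1 tau * half_value2 tau + half_value1 tau * half_value3 tau + half_value2 tau * half_value3 tau) &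
   [/\ isD eta1 tau d1, isD eta2 tau d2, c * d1 = - eta1 tau ^+ 2 + A / 6 &
     c * d2 = - eta1 tau * eta2 tau + A / 6 * tau]] /\
  [/\ isD (@half_value1 R) tau D1, isD (@half_value2 R) tau D2, isD (@half_value3 R) tau D3 &
   [/\ c * D1 = 2 * half_value1 tau ^+ 2 - 2 * eta1 tau * half_value1 tau - 2 / 3 * A,
       c * D2 = 2 * half_value2 tau ^+ 2 - 2 * eta1 tau * half_value2 tau - 2 / 3 * A &
       c * D3 = 2 * half_value3 tau ^+ 2 - 2 * eta1 tau * half_value3 tau - 2 / 3 * A]].
Proof.
move=> ht; pose c := tau * eta1 tau - eta2 tau.
have [A hA] := wp2_ode ht.
have [s0 AE] := half_values_vieta ht hA.
have [kap hk] := wp_heat_equation ht (h1 ht) (h2 ht); rewrite -/c in hk.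
set U1 := fun x => lattice_sum (@dtau_zeta_term R) x tau; set U2 := fun x => lattice_sum (@dtau_wp_term R) x tau.
have n1 := half1_off_lattice ht; have n2 := half2_off_lattice ht; have n3 := half3_off_lattice ht.
have p1 := wp1_half_period ht (halfD1 tau); have p2 := wp1_half_period ht (halfD2 tau); have p3 := wp1_half_period ht (halfD3 tau).
have hE1 : isD (@half_value1 R) tau (U2 (1 / 2)).
  have := @isD_wp_path (1 / 2) 0 tau ht; rewrite !mul0r !addr0 => /(_ n1).
  by apply: eq_isD => t; rewrite mul0r addr0.
have t2E (t : C) : 0 + 1 / 2 * t = t / 2 by field.
have hE2 : isD (@half_value2 R) tau (U2 (tau / 2)).
  have := @isD_wp_path 0 (1 / 2) tau ht; rewrite t2E p2 mulr0 addr0 => /(_ n2).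
  by apply: eq_isD => t; rewrite t2E.
have t3E (t : C) : 1 / 2 + 1 / 2 * t = (1 + t) / 2 by field.
have hE3 : isD (@half_value3 R) tau (U2 ((1 + tau) / 2)).
  have := @isD_wp_path (1 / 2) (1 / 2) tau ht; rewrite t3E p3 mulr0 addr0 => /(_ n3).
  by apply: eq_isD => t; rewrite t3E.
have k1 := hk _ n1; rewrite p1 mulr0 addr0 -/(half_value1 tau) in k1.
have k2 := hk _ n2; rewrite p2 mulr0 addr0 -/(half_value2 tau) in k2.
have k3 := hk _ n3; rewrite p3 mulr0 addr0 -/(half_value3 tau) in k3.
have sD : U2 (1 / 2) + U2 (tau / 2) + U2 ((1 + tau) / 2) = 0.
  apply: isD_unique (isD_add (isD_add hE1 hE2) hE3) _.
  apply: isD_near (isD_cst 0 tau); apply: filterS (near_Im_gt0 ht) => t ht'.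
  by have [B hB] := wp2_ode ht'; have [-> _] := half_values_vieta ht' hB.
have kE : kap = 2 / 3 * A.
  have three : (3 : C) != 0 by rewrite pnatr_eq0.
  apply: (mulfI three); apply/eqP; rewrite -subr_eq0; apply/eqP.
  have e3 : half_value3 tau = - (half_value1 tau + half_value2 tau) by apply/eqP; rewrite -subr_eq0 opprK addrC s0.
  have : c * (U2 (1 / 2) + U2 (tau / 2) + U2 ((1 + tau) / 2)) = 0 by rewrite sD mulr0.
  rewrite !mulrDr k1 k2 k3 AE e3 => H.
  by rewrite -[RHS]oppr0 -[in RHS]H; field.
rewrite kE in hk k1 k2 k3.
have c0 : c != 0.
  apply/eqP => cz; rewrite cz !mul0r in k1 k2 k3.
  have d12 : half_value1 tau - half_value2 tau != 0 by rewrite subr_eq0 half_value12.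
  have d13 : half_value1 tau - half_value3 tau != 0 by rewrite subr_eq0 half_value13.
  have q12 : 2 * (half_value1 tau + half_value2 tau) - 2 * eta1 tau = 0.
    apply: (mulfI d12); rewrite mulr0 -[RHS](subrr (0 : C)) {1}k1 k2; ring.
  have q13 : 2 * (half_value1 tau + half_value3 tau) - 2 * eta1 tau = 0.
    apply: (mulfI d13); rewrite mulr0 -[RHS](subrr (0 : C)) {1}k1 k3; ring.
  have two : (2 : C) != 0 by rewrite pnatr_eq0.
  have := half_value23 ht; rewrite -subr_eq0 => /eqP; apply; apply: (mulfI two).
  rewrite mulr0 -[RHS](subrr (0 : C)) -{1}q12 -q13; ring.
have hz := zeta_heat_equation ht hA hk.
have eta1E t : 0 < complex.Im t -> eta1 t = 2 * zeta_series t (1 / 2).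
  by move=> ht'; apply: (quasi_period_half ht' (half1_off_lattice ht')); exact: h1.
have eta2E t : 0 < complex.Im t -> eta2 t = 2 * zeta_series t (t / 2).
  by move=> ht'; apply: (quasi_period_half ht' (half2_off_lattice ht')); exact: h2.
have He1 : isD eta1 tau (2 * U1 (1 / 2)).
  have := @isD_zeta_path (1 / 2) 0 tau ht; rewrite !mul0r !(subr0, addr0) => /(_ n1) h.
  have := isD_mul (isD_cst 2 tau) h; rewrite mul0r add0r; apply: isD_near.
  by apply: filterS (near_Im_gt0 ht) => t /eta1E ->; rewrite mul0r addr0.
have He2 : isD eta2 tau (2 * (U1 (tau / 2) - 1 / 2 * half_value2 tau)).
  have := @isD_zeta_path 0 (1 / 2) tau ht; rewrite t2E => /(_ n2) h.
  have := isD_mul (isD_cst 2 tau) h; rewrite mul0r add0r; apply: isD_near.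
  by apply: filterS (near_Im_gt0 ht) => t /eta2E ->; rewrite t2E.
have z1 : zeta_series tau (1 / 2) = eta1 tau / 2 by rewrite (eta1E tau ht); field.
have z2 : zeta_series tau (tau / 2) = eta2 tau / 2 by rewrite (eta2E tau ht); field.
exists A, (2 * U1 (1 / 2)), (2 * (U1 (tau / 2) - 1 / 2 * half_value2 tau)).
exists (U2 (1 / 2)), (U2 (tau / 2)), (U2 ((1 + tau) / 2)); rewrite -/c.
split; last by split.
split => //; split => //.
  by rewrite mulrCA (hz _ n1) p1 z1; field.
have -> : c * (2 * (U1 (tau / 2) - 1 / 2 * half_value2 tau)) = 2 * (c * U1 (tau / 2)) - c * half_value2 tau.
  by field.
by rewrite (hz _ n2) p2 z2 -/(half_value2 tau) /c; field.
Qed.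

End Etas.
End TauDer.

(** * Weierstrass zeta, its quasi-periods and simple zeros *)

Section Link.
Variable R : realType.
Local Notation C := (cplx R).
Implicit Types (x z w tau a b : C).

Definition weierstrass_zeta tau x : C := if `[< lattice tau x >] then 0 else zeta_series tau x.

Lemma weierstrass_zetaE tau x : ~ lattice tau x -> weierstrass_zeta tau x = zeta_series tau x.
Proof. by move=> h; rewrite /weierstrass_zeta; case: asboolP. Qed.

Lemma isD_derivable (f : C -> C) z d : isD f z d -> derivable f z 1.
Proof. by case. Qed.

(** Meromorphy at a period [q] follows from quasi-periodicity: there zeta equals
    [1/(z - q)] plus a function derivable near [q]. *)
Lemma weierstrass_zeta_is_wzeta tau : 0 < complex.Im tau -> is_wzeta tau (weierstrass_zeta tau).
Proof.
move=> ht; split.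
- move=> z0; have [/latticeP [q z0q]|hz] := pselect (lattice tau z0); last first.
    exists 0%N, (zeta_series tau); split.
      apply: filterS (off_lattice_near ht hz) => z /(isD_zeta_series ht); exact: isD_derivable.
    rewrite near_withinE; apply: filterS (off_lattice_near ht hz) => z nz _.
    by rewrite weierstrass_zetaE // expr0 divr1.
  have [eta heta] := zeta_series_quasi_period ht q.
  exists 1%N, (fun z => 1 + (z - z0) * (lattice_sum (@zeta_term R) (z - z0) tau + eta)).
  have hr : \forall z \near z0, off_nonzero_periods (z - z0) tau.
    have := @near_shift R z0 (- z0) (fun z => off_nonzero_periods z tau); rewrite subrr; apply.
    exact: off_nonzero_periods_near (off_nonzero_periods0 ht).
  split.
    apply: filterS hr => z hz; apply: (@isD_derivable _ z).
    apply: isD_add (isD_cst _ _) (isD_mul (isD_sub (isD_id _) (isD_cst _ _)) _).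
    by apply: isD_add (isD_cst _ _); apply: (@isD_shift R (fun x => lattice_sum (@zeta_term R) x tau)); exact: isD_zeta_sum.
  rewrite near_withinE; apply: filterS hr => z hz zz0.
  have zz : z - z0 != 0 by rewrite subr_eq0.
  have nz := off_nonzero_periods_lattice hz zz.
  have zE : z = z - z0 + period tau q by rewrite -z0q subrK.
  have nz' : ~ lattice tau z by rewrite zE lattice_shift.
  rewrite weierstrass_zetaE // {1}zE -[LHS](subrK (zeta_series tau (z - z0))) heta // expr1 /zeta_series.
  by field.
- move=> z hz; apply: isD_near (isD_zeta_series ht hz).
  by apply: filterS (off_lattice_near ht hz) => w nw; rewrite weierstrass_zetaE.
- move=> z; have [hz|hz] := pselect (lattice tau z).
    by rewrite /weierstrass_zeta !asboolT ?oppr0 // lattice_opp.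
  by rewrite !weierstrass_zetaE ?zeta_series_odd // lattice_opp.
- by move=> z hz; rewrite /weierstrass_zeta asboolT.
Qed.

Lemma wzetaE tau x : 0 < complex.Im tau -> ~ lattice tau x -> wzeta tau x = zeta_series tau x.
Proof.
move=> ht hx; have [_ hD hodd _] : is_wzeta tau (wzeta tau).
  by apply: (@getPex _ [set Z | is_wzeta tau Z]); exists (weierstrass_zeta tau); exact: weierstrass_zeta_is_wzeta.
pose f z := wzeta tau z - zeta_series tau z.
have fD z : ~ lattice tau z -> isD f z 0.
  move=> hz; apply: isD_eq (isD_sub (hD z hz) (isD_zeta_series ht hz)) _.
  by rewrite wp_seriesE subrr.
have hx' : ~ lattice tau (- x) by rewrite lattice_opp.
have f_odd : f (- x) = - f x by rewrite /f hodd zeta_series_odd //; ring.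
have := zero_derivative_constant ht fD hx' hx; rewrite f_odd => /eqP; rewrite eq_sym -addr_eq0 -mulr2n mulrn_eq0 /=.
by rewrite subr_eq0 => /eqP.
Qed.

Lemma eta1P tau : 0 < complex.Im tau -> forall x, ~ lattice tau x ->
  zeta_series tau (x + 1) - zeta_series tau x = eta1 tau.
Proof.
move=> ht x hx; have [eta heta] := zeta_series_quasi_period ht (1, 0); rewrite period10 in heta.
have H : forall z, ~ lattice tau z -> wzeta tau (z + 1) - wzeta tau z = eta1 tau.
  apply: (@getPex _ [set eta | forall z, ~ lattice tau z -> wzeta tau (z + 1) - wzeta tau z = eta]).
  exists eta => z hz; rewrite !wzetaE ?off_lattice_add1 //; exact: heta.
by rewrite -(H x hx) !wzetaE ?off_lattice_add1.
Qed.

Lemma eta2P tau : 0 < complex.Im tau -> forall x, ~ lattice tau x ->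
  zeta_series tau (x + tau) - zeta_series tau x = eta2 tau.
Proof.
move=> ht x hx; have [eta heta] := zeta_series_quasi_period ht (0, 1); rewrite period01 in heta.
have H : forall z, ~ lattice tau z -> wzeta tau (z + tau) - wzeta tau z = eta2 tau.
  apply: (@getPex _ [set eta | forall z, ~ lattice tau z -> wzeta tau (z + tau) - wzeta tau z = eta]).
  exists eta => z hz; rewrite !wzetaE ?off_lattice_addtau //; exact: heta.
by rewrite -(H x hx) !wzetaE ?off_lattice_addtau.
Qed.

(** * Forms in the homogeneous parameter and their simple zeros *)

(** Here [n] stands for [eta1] and [G] for [g2]; [D1, D2, D3, dphi, du] are the
    derivatives of [e1, e2, e3, phi, u]. *)

Section Algebra.
Variables (n e1 e2 e3 c phi u dphi du D1 D2 D3 : C).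
Let G := - 4 * (e1 * e2 + e1 * e3 + e2 * e3).
Hypothesis s0 : e1 + e2 + e3 = 0.
Hypotheses (d12 : e1 != e2) (d13 : e1 != e3) (d23 : e2 != e3) (c0 : c != 0).
Hypotheses (hD1 : c * D1 = 2 * e1 ^+ 2 - 2 * n * e1 - G / 3)
  (hD2 : c * D2 = 2 * e2 ^+ 2 - 2 * n * e2 - G / 3)
  (hD3 : c * D3 = 2 * e3 ^+ 2 - 2 * n * e3 - G / 3)
  (hphi : c * dphi = - n * phi + G / 12 * u) (hu : c * du = n * u - phi)
  (nz : ~ (phi = 0 /\ u = 0)).
Let dG := - 4 * (D1 * e2 + e1 * D2 + (D1 * e3 + e1 * D3) + (D2 * e3 + e2 * D3)).

Lemma e3E : e3 = - (e1 + e2).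
Proof. by apply/eqP; rewrite -subr_eq0 opprK addrC s0. Qed.

Lemma g2_derivative : c * dG = - 4 * n * G + 24 * (e1 * e2 * e3).
Proof.
have -> : c * dG = - 4 * (c * D1 * e2 + e1 * (c * D2) + (c * D1 * e3 + e1 * (c * D3)) + (c * D2 * e3 + e2 * (c * D3))).
  by rewrite /dG; ring.
by rewrite hD1 hD2 hD3 /G e3E; field.
Qed.

Lemma discriminant_neq0 : G ^+ 3 - 27 * (4 * (e1 * e2 * e3)) ^+ 2 != 0.
Proof.
have -> : G ^+ 3 - 27 * (4 * (e1 * e2 * e3)) ^+ 2 =
    16 * ((e1 - e2) * (e1 - e3) * (e2 - e3)) ^+ 2.
  by rewrite /G e3E; ring.
by rewrite mulf_neq0 ?pnatr_eq0 // expf_neq0 // !mulf_neq0 // subr_eq0.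
Qed.

(** On [12 phi^2 = G u^2] one finds [c f_0' = 2 u (2 G phi - 3 g3 u)], where
    [g3 = 4 e1 e2 e3].  Both forms vanish only if [G^3 = 27 g3^2]. *)
Lemma quadratic_form_simple : 12 * phi ^+ 2 - G * u ^+ 2 = 0 ->
  24 * phi * dphi - (dG * u ^+ 2 + G * (2 * u * du)) <> 0.
Proof.
move=> f0 D0; set g3 := 4 * (e1 * e2 * e3).
have u0 : u != 0.
  apply/eqP => uz; apply: nz; split => //; apply/eqP; move/eqP: f0.
  by rewrite uz expr0n mulr0 subr0 mulf_eq0 pnatr_eq0 /= expf_eq0.
have H : u * (2 * G * phi - 3 * g3 * u) = 0.
  have E : c * (24 * phi * dphi - (dG * u ^+ 2 + G * (2 * u * du))) = - 2 * n * (12 * phi ^+ 2 - G * u ^+ 2)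
     + 2 * (u * (2 * G * phi - 3 * g3 * u)).
    have -> : c * (24 * phi * dphi - (dG * u ^+ 2 + G * (2 * u * du))) =
      24 * phi * (c * dphi) - (c * dG * u ^+ 2 + G * (2 * u * (c * du))) by ring.
    by rewrite hphi hu g2_derivative /g3; field.
  move: E; rewrite D0 f0 !mulr0 add0r => /eqP; rewrite eq_sym mulf_eq0 pnatr_eq0 /=.
  by move/eqP.
move/eqP: H; rewrite mulf_eq0 (negbTE u0) /= subr_eq0 => /eqP H.
have := discriminant_neq0; rewrite -/g3 => /eqP; apply.
have two : 3 * u ^+ 2 != 0 by rewrite mulf_neq0 ?pnatr_eq0 // expf_neq0.
apply: (mulfI two); rewrite mulr0.
have -> : 3 * u ^+ 2 * (G ^+ 3 - 27 * g3 ^+ 2) = 9 * ((2 * G * phi) ^+ 2 - (3 * g3 * u) ^+ 2)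
   - 3 * G ^+ 2 * (12 * phi ^+ 2 - G * u ^+ 2) by ring.
by rewrite H subrr f0 !mulr0 subrr.
Qed.

(** Modulo [f], the derivative [c f'] is the linear form
    [(9 e^2 - 3 G/2) phi - (3/4) G e u].  Its determinant with [f] is
    [(3/4) (12 e^2 - G) (3 e^2 - G)]; for [e = e1] the factors are
    [4 (e1 - e3)(e1 - e2)] and [- (e2 - e3)^2], and likewise for the others. *)
Lemma linear_form_simple e D : (e, D) \in [:: (e1, D1); (e2, D2); (e3, D3)] ->
  3 * e * phi + (G / 2 - 3 * e ^+ 2) * u = 0 ->
  3 * D * phi + 3 * e * dphi + ((dG / 2 - 6 * e * D) * u + (G / 2 - 3 * e ^+ 2) * du) <> 0.
Proof.
move=> he f0 F0.
have hD : c * D = 2 * e ^+ 2 - 2 * n * e - G / 3.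
  by move: he; rewrite !inE !xpair_eqE => /or3P[] /andP[/eqP -> /eqP ->].
have g3E : 4 * (e1 * e2 * e3) = 4 * e ^+ 3 - G * e.
  by move: he; rewrite !inE !xpair_eqE /G e3E => /or3P[] /andP[/eqP -> _]; ring.
have H : (9 * e ^+ 2 - 3 * G / 2) * phi - 3 / 4 * G * e * u = 0.
  have -> : (9 * e ^+ 2 - 3 * G / 2) * phi - 3 / 4 * G * e * u =
     c * (3 * D * phi + 3 * e * dphi + ((dG / 2 - 6 * e * D) * u + (G / 2 - 3 * e ^+ 2) * du))
      + 3 * n * (3 * e * phi + (G / 2 - 3 * e ^+ 2) * u).
    have -> : c * (3 * D * phi + 3 * e * dphi + ((dG / 2 - 6 * e * D) * u + (G / 2 - 3 * e ^+ 2) * du)) =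
      3 * (c * D) * phi + 3 * e * (c * dphi) + ((c * dG / 2 - 6 * e * (c * D)) * u + (G / 2 - 3 * e ^+ 2) * (c * du)) by ring.
    have dG' : c * dG = - 4 * n * G + 6 * (4 * e ^+ 3 - G * e) by rewrite g2_derivative -g3E; ring.
    by rewrite hphi hu hD dG'; field.
  by rewrite F0 f0 !mulr0 addr0.
set a1 := 3 * e in f0; set b1 := G / 2 - 3 * e ^+ 2 in f0.
set a2 := 9 * e ^+ 2 - 3 * G / 2 in H; set b2 := - (3 / 4 * G * e).
have det : a1 * b2 - a2 * b1 != 0.
  have -> : a1 * b2 - a2 * b1 = 3 / 4 * ((12 * e ^+ 2 - G) * (3 * e ^+ 2 - G)).
    by rewrite /a1 /a2 /b1 /b2; field.
  have h1 : 12 * e ^+ 2 - G != 0 /\ 3 * e ^+ 2 - G != 0.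
    move: he; rewrite !inE !xpair_eqE => /or3P[] /andP[/eqP -> _].
    - have -> : 12 * e1 ^+ 2 - G = 4 * ((e1 - e3) * (e1 - e2)) by rewrite /G e3E; ring.
      have -> : 3 * e1 ^+ 2 - G = - (e2 - e3) ^+ 2 by rewrite /G e3E; ring.
      by rewrite oppr_eq0 expf_neq0 ?subr_eq0 // !mulf_neq0 ?pnatr_eq0 ?subr_eq0.
    - have -> : 12 * e2 ^+ 2 - G = - 4 * ((e2 - e3) * (e1 - e2)) by rewrite /G e3E; ring.
      have -> : 3 * e2 ^+ 2 - G = - (e1 - e3) ^+ 2 by rewrite /G e3E; ring.
      by rewrite oppr_eq0 expf_neq0 ?subr_eq0 // !mulf_neq0 ?oppr_eq0 ?pnatr_eq0 ?subr_eq0.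
    have -> : 12 * e3 ^+ 2 - G = 4 * ((e1 - e3) * (e2 - e3)) by rewrite /G e3E; ring.
    have -> : 3 * e3 ^+ 2 - G = - (e1 - e2) ^+ 2 by rewrite /G e3E; ring.
    by rewrite oppr_eq0 expf_neq0 ?subr_eq0 // !mulf_neq0 ?pnatr_eq0 ?subr_eq0.
  case: h1 => h1 h2; rewrite !mulf_neq0 ?invr_eq0 ?pnatr_eq0 //.
apply: nz; split; apply: (mulfI det); rewrite mulr0.
  have -> : (a1 * b2 - a2 * b1) * phi = b2 * (a1 * phi + b1 * u) - b1 * (a2 * phi - 3 / 4 * G * e * u).
    by rewrite /b2; ring.
  by rewrite f0 H !mulr0 subrr.
have -> : (a1 * b2 - a2 * b1) * u = a1 * (a2 * phi - 3 / 4 * G * e * u) - a2 * (a1 * phi + b1 * u).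
  by rewrite /b2; ring.
by rewrite f0 H !mulr0 subrr.
Qed.
End Algebra.

(** The pair [(phi, u)] homogenizes the parameter, so that the finite and the
    infinite case share one formula. *)
Definition param_phi (o : option C) tau : C :=
  if o is Some c then c * eta1 tau - eta2 tau else eta1 tau.
Definition param_u (o : option C) tau : C := if o is Some c then c - tau else 1.

Lemma f0_homogeneous o tau : f0 o tau = 12 * param_phi o tau ^+ 2 - g2 tau * param_u o tau ^+ 2.
Proof. by case: o => [c|] //=; rewrite expr1n mulr1. Qed.
Lemma f123_homogeneous k o tau : f123 k o tau = 3 * wp_e k tau * param_phi o tau +
  (g2 tau / 2 - 3 * wp_e k tau ^+ 2) * param_u o tau.
Proof. by case: o => [c|] //=; rewrite mulr1 addrA. Qed.

Lemma simple_zeros k o tau : 0 < complex.Im tau -> exists D, isD (@fkC R k o) tau D /\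
  (fkC k o tau = 0 -> D <> 0).
Proof.
move=> ht; have [A [d1 [d2 [D1 [D2 [D3 [[]]]]]]]] := quasi_period_system eta1P eta2P ht.
set c := _ - _ => c0 AE [he1 he2 hd1 hd2] [hE1 hE2 hE3 [hD1 hD2 hD3]].
have [A' hA'] := wp2_ode ht; have [s0 _] := half_values_vieta ht hA'.
have h12 := half_value12 ht; have h13 := half_value13 ht; have h23 := half_value23 ht.
have w1 : @wp_e R 1 = @half_value1 R by [].
have w2 : @wp_e R 2 = @half_value2 R by [].
have w3 : @wp_e R 3 = @half_value3 R by [].
pose G := - 4 * (half_value1 tau * half_value2 tau + half_value1 tau * half_value3 tau + half_value2 tau * half_value3 tau).
have AG : A = G / 2 by rewrite AE /G; field.
have gE : g2 tau = G by [].
pose dG := - 4 * (D1 * half_value2 tau + half_value1 tau * D2 + (D1 * half_value3 tau + half_value1 tau * D3) + (D2 * half_value3 tau + half_value2 tau * D3)).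
have hG : isD (@g2 R) tau dG.
  apply: isD_eq (isD_mul (isD_cst (- 4) tau) (isD_add (isD_add (isD_mul hE1 hE2) (isD_mul hE1 hE3)) (isD_mul hE2 hE3))) _.
  by rewrite mul0r add0r.
have [dphi [du [hp hU hdp hdu nz]]] : exists dphi du, [/\ isD (param_phi o) tau dphi, isD (param_u o) tau du,
    c * dphi = - eta1 tau * param_phi o tau + G / 12 * param_u o tau, c * du = eta1 tau * param_u o tau - param_phi o tau &
    ~ (param_phi o tau = 0 /\ param_u o tau = 0)].
  case: o => [C0|].
    exists (C0 * d1 - d2), (- 1); split.
    - apply: isD_eq (isD_sub (isD_mul (isD_cst C0 tau) he1) he2) _.
      by rewrite mul0r add0r.
    - by apply: isD_eq (isD_sub (isD_cst C0 tau) (isD_id tau)) _; rewrite sub0r.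
    - have -> : c * (C0 * d1 - d2) = C0 * (c * d1) - c * d2 by ring.
      by rewrite hd1 hd2 AG /param_phi /param_u; field.
    - by rewrite /c /param_phi /param_u; ring.
    move=> [q1 q2]; move/eqP: c0; apply.
    have E : C0 = tau by apply/eqP; rewrite -subr_eq0; apply/eqP.
    by rewrite -q1 /param_phi E.
  exists d1, 0; split => //.
  - exact: isD_cst.
  - by rewrite hd1 AG /param_phi /param_u; field.
  - by rewrite /param_phi /param_u; ring.
  by move=> [_ /eqP]; rewrite oner_eq0.
have fix_third e D : c * D = 2 * e ^+ 2 - 2 * eta1 tau * e - 2 / 3 * A -> c * D = 2 * e ^+ 2 - 2 * eta1 tau * e - G / 3.
  by move=> ->; rewrite AG; field.
have {}hD1 := fix_third _ _ hD1; have {}hD2 := fix_third _ _ hD2; have {}hD3 := fix_third _ _ hD3.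
have caseK j D : isD (@wp_e R j) tau D -> (wp_e j tau, D) \in [:: (half_value1 tau, D1); (half_value2 tau, D2); (half_value3 tau, D3)] ->
    exists D, isD (f123 j o) tau D /\ (f123 j o tau = 0 -> D <> 0).
  move=> hj hin; set e := wp_e j tau in hin *.
  exists (3 * D * param_phi o tau + 3 * e * dphi + ((dG / 2 - 6 * e * D) * param_u o tau + (G / 2 - 3 * e ^+ 2) * du)).
  split.
    have -> : f123 j o = fun t => 3 * wp_e j t * param_phi o t + (g2 t / 2 - 3 * wp_e j t ^+ 2) * param_u o t.
      by apply/funext => t; exact: f123_homogeneous.
    apply: isD_eq (isD_add (isD_mul (isD_mul (isD_cst 3 tau) hj) hp)
      (isD_mul (isD_sub (isD_mul hG (isD_cst 2^-1 tau)) (isD_mul (isD_cst 3 tau) (isD_exp 2 hj))) hU)) _.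
    by rewrite gE -/e /=; ring.
  rewrite f123_homogeneous gE => fz.
  exact: (linear_form_simple s0 h12 h13 h23 hD1 hD2 hD3 hdp hdu nz hin fz).
rewrite /fkC; case: eqP => [_|k0].
  exists (24 * param_phi o tau * dphi - (dG * param_u o tau ^+ 2 + G * (2 * param_u o tau * du))); split.
    have -> : f0 o = fun t => 12 * param_phi o t ^+ 2 - g2 t * param_u o t ^+ 2.
      by apply/funext => t; exact: f0_homogeneous.
    apply: isD_eq (isD_sub (isD_mul (isD_cst 12 tau) (isD_exp 2 hp)) (isD_mul hG (isD_exp 2 hU))) _.
    by rewrite gE /=; ring.
  rewrite f0_homogeneous gE => fz.
  exact: (quadratic_form_simple s0 h12 h13 h23 hD1 hD2 hD3 hdp hdu nz fz).
case: k k0 => [[|[|[|[|k]]]] hk] k0 //=.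
- by case: k0; apply: val_inj.
- by apply: (caseK 1%N D1) => //; rewrite !inE eqxx.
- by apply: (caseK 2%N D2) => //; rewrite !inE eqxx orbT.
- by apply: (caseK 3%N D3) => //; rewrite !inE eqxx !orbT.
Qed.

End Link.

Theorem theorem1p1 (R : realType) (k : 'I_4) (c : option (cplx R)) :
  (forall tau : cplx R, upper_half_plane tau -> derivable (fkC k c) tau 1) /\
  (forall tau : cplx R, upper_half_plane tau ->
     fkC k c tau = 0 -> derive1 (fkC k c) tau <> 0).
Proof.
split=> tau ht; have [D [hD hz]] := simple_zeros k c ht; first exact: isD_derivable hD.
by move=> /hz; rewrite derive1E; have [_ ->] := hD.
Qed.
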